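(* Let $N\ge 6$. Given any $\varepsilon>0$, there exist a point $x_3\in\Sigma$ within distance $\varepsilon$ of $\mathbb{T}_3$ (using the usual metric on $\Sigma$), a point $x_{N-2}\in\Sigma$ within distance $\varepsilon$ of $\mathbb{T}_{N-2}$, and a time $t\ge 0$ such that $S(t)x_3=x_{N-2}$.
   Context: Consider the system of ODEs (the Toy Model System) for $b(t)=(b_1(t),\dots,b_N(t))\in\mathbb{C}^N$: $$\partial_t b_j=-i|b_j|^2b_j+2i\,\overline{b_j}\,(b_{j-1}^2+b_{j+1}^2),\qquad 1\le j\le N,$$ with the convention $b_0=b_{N+1}=0$. The quantity $\sum_j|b_j|^2$ is conserved and the system is globally well posed. Let $\Sigma=\{x\in\mathbb{C}^N:|x|^2=1\}$ be the unit sphere, and let $S(t):\Sigma\to\Sigma$ be the flow of the system, $S(t)b(t_0):=b(t+t_0)$. For $1\le j\le N$ define the circle $$\mathbb{T}_j=\{(b_1,\dots,b_N)\in\Sigma:\ |b_j|=1,\ b_k=0\text{ for all }k\ne j\},$$ which is invariant under the flow. *)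

(* Defs.v *)
From Stdlib Require Import Reals ClassicalEpsilon.
From Coquelicot Require Import Coquelicot.
From mathcomp Require Import ssreflect ssrfun ssrbool eqtype ssrnat fintype.

Set Implicit Arguments.
Unset Strict Implicit.
Unset Printing Implicit Defensive.

Definition CN (N : nat) : Type := 'I_N -> C.

(* The 1-based coordinate b_k of b = (b_1, ..., b_N); it is 0 for k outside
   1..N, which realizes the convention b_0 = b_{N+1} = 0. *)
Definition coord (N : nat) (b : CN N) (k : nat) : C :=
  match k with
  | 0 => RtoC 0
  | S i => if insub i is Some j then b j else RtoC 0
  end.

(* Euclidean norm on C^N = R^(2N), and the metric it induces *)
Definition normCN (N : nat) (x : CN N) : R :=
  sqrt (sum_n_m (fun k => (Cmod (coord x k) ^ 2)%R) 1 N).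

Definition distCN (N : nat) (x y : CN N) : R :=
  normCN (fun j => (x j - y j)%C).

Definition toy_field (N : nat) (b : CN N) (j : nat) : C :=
  (- Ci * RtoC (Cmod (coord b j) ^ 2) * coord b j
   + 2 * Ci * Cconj (coord b j)
       * (coord b j.-1 ^ 2 + coord b j.+1 ^ 2))%C.

(* The time derivative is that of a function of the real variable t, with C
   regarded as a real normed space. *)
Definition toy_solution (N : nat) (b : R -> CN N) : Prop :=
  forall (t : R) (j : nat), (1 <= j <= N)%N ->
    @is_derive R_AbsRing C_R_NormedModule (fun s => coord (b s) j) t
      (toy_field (b t) j).

(* The global solution with value x at time 0, selected by Hilbert's epsilon.
   Since the system is globally well posed, such a solution exists and is
   unique, so it does not depend on the choice made. *)
Definition toy_trajectory (N : nat) (x : CN N) : R -> CN N :=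
  epsilon (inhabits (fun (_ : R) (_ : 'I_N) => RtoC 0))
    (fun b => toy_solution b /\ b 0%R = x).

Definition toy_flow (N : nat) (t : R) (x : CN N) : CN N :=
  toy_trajectory x t.

Definition Sigma (N : nat) (x : CN N) : Prop := (normCN x ^ 2)%R = 1%R.

(* The circle T_j, with the 1-based index j *)
Definition circle (N : nat) (j : nat) (x : CN N) : Prop :=
  Sigma x /\ Cmod (coord x j) = 1%R /\
  forall k : nat, (1 <= k <= N)%N -> k <> j -> coord x k = RtoC 0.

Definition within_dist (N : nat) (eps : R) (x : CN N) (A : CN N -> Prop) : Prop :=
  exists y : CN N, A y /\ (distCN x y <= eps)%R.

(* Main.v *)
Require Import Defs.
From Stdlib Require Import Reals Lra ClassicalEpsilon FunctionalExtensionality.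
From Coquelicot Require Import Coquelicot.
From mathcomp Require Import ssreflect ssrfun ssrbool eqtype ssrnat fintype zify.
Local Open Scope R_scope.

(** Write [b_j = sqrt (I_j) exp (i phi_j / 2)] and [psi_j = phi_(j+1) - phi_j].
    The circle of index [j] is a periodic orbit; seen from it, each of the two
    neighbours [j - 1], [j + 1] has one expanding and one contracting direction
    (rate [2 sqrt 3] for the intensity), while the remaining modes only keep
    their intensity. Mass moves from one circle to the next along orbits with
    [psi_j = 2 pi / 3]. A true orbit has to follow several such transfers in
    succession, leaving each circle forwards although the mode it came from
    could grow again at the same rate.

    The quantity that controls this is the two-mode energy
    [Q_j = I_j I_(j+1) (1 + 2 cos psi_j)]: it would be constant if the two modes
    were alone, and in general its derivative is bounded by triple products of
    consecutive intensities ([derive_coupling]). When [Q_j] is small against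
    [I_j I_(j+1)], the angle is pinned near [+- 2 pi / 3] and the weaker mode
    grows or decays at the exact rate ([coupling_sin]).

    Let all modes but two have intensity about [exp (- 2 L)] with [L] large. A
    [gate] is a state in which the mode [z + 2] dominates, having just received
    its mass from [z + 1]. During the following stay [I_(z+1)] decays like
    [exp (- rate t)] and [I_(z+3)] grows at most like [exp (rate t)]; their
    product stays negligible, so that the energies [Q] and the total mass of
    the other modes keep their initial order ([slow_strict], [slow_stay]). When
    the third mode is ready to take over, the first one has fallen to
    [exp (- 2 L)], up to factors [exp (O(m))] with a tolerance [m] much smaller
    than [L]. The transfer itself lasts a time of order [m], and it ends at the
    next gate with tolerance [100 m] ([exit_gate]).

    The one thing that can go wrong is the angle with which the third mode
    enters: close to the contracting direction that mode does not grow in time.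
    This angle cannot be prescribed at all gates at once, so a whole curve of
    states is transported, along which the angle turns around completely
    ([gate_curve]). At some parameter the angle is favourable and the transfer
    happens early ([favourable_exit]); at another one, given by the intermediate
    value theorem, the angle at a fixed late time is far from both pinned
    values, so no transfer has happened yet ([transferred_pinned]). In between
    the exit time therefore sweeps an interval of length [190 m]. The dominant
    mode rotates with angular velocity [-2] while the modes ahead are nearly at
    rest, hence the entrance angle of the next mode turns around completely
    along the curve of exit states, which is again a gate curve
    ([gate_curve_step]). Iterating from an explicit curve near the third circle
    leads to a curve near the circle [N - 2] ([gate_curves]).

    The flow exists globally because in the variables [ln I_j], [phi_j] the
    equations coincide, on states of mass one, with a bounded Lipschitz field,
    for which the Picard iteration converges for all times; solutions of the
    toy model are unique by the same weighted estimate
    ([toy_solution_unique]). *)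

(** * Differential inequalities and first hitting times *)

Lemma derive_continuous (f : R -> R) (t l : R) : is_derive f t l -> continuous f t.
Proof. by move=> h; apply: ex_derive_continuous; exists l. Qed.

Lemma derive_ge0_le (f f' : R -> R) (a b : R) :
  a <= b -> (forall t, is_derive f t (f' t)) ->
  (forall t, a <= t <= b -> 0 <= f' t) -> f a <= f b.
Proof.
move=> hab hd h0.
have [c [hc e]] : exists c, Rmin a b <= c <= Rmax a b /\ f b - f a = f' c * (b - a).
  apply: MVT_gen => x _; first exact: hd.
  by apply/continuity_pt_filterlim; exact: (derive_continuous _ _ _ (hd x)).
move: hc; rewrite Rmin_left // Rmax_right // => hc.
have : 0 <= b - a by lra.
have := h0 c hc; move=> h1 /(Rmult_le_pos _ _ h1); lra.
Qed.

Lemma derive_le_upper (f f' : R -> R) (K a b : R) :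
  a <= b -> (forall t, is_derive f t (f' t)) ->
  (forall t, a <= t <= b -> f' t <= K) -> f b <= f a + K * (b - a).
Proof.
move=> hab hd hK.
suff : K * a - f a <= K * b - f b by lra.
apply: (@derive_ge0_le (fun t => K * t - f t) (fun t => K - f' t)) => // [t|t ht].
  by evar_last; [apply: is_derive_minus; [apply: is_derive_scal; apply: is_derive_id | exact: hd]
                | rewrite /minus /plus /opp /scal /= /mult /= /one /=; ring].
have := hK t ht; lra.
Qed.

Lemma derive_ge_lower (f f' : R -> R) (K a b : R) :
  a <= b -> (forall t, is_derive f t (f' t)) ->
  (forall t, a <= t <= b -> K <= f' t) -> f a + K * (b - a) <= f b.
Proof.
move=> hab hd hK.
have := @derive_le_upper (fun t => - f t) (fun t => - f' t) (- K) a b hab.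
move=> h; have := h _ _; clear h.
have h1 : forall t, is_derive (fun t => - f t) t (- f' t) by move=> t; apply: is_derive_opp.
move=> /(_ h1) h2.
have := h2 _; clear h2 => h2.
have : forall t, a <= t <= b -> - f' t <= - K by move=> t /hK; lra.
move=> /h2; lra.
Qed.

Lemma derive_abs_le (f f' : R -> R) (K a b : R) :
  a <= b -> (forall t, is_derive f t (f' t)) ->
  (forall t, a <= t <= b -> Rabs (f' t) <= K) -> Rabs (f b - f a) <= K * (b - a).
Proof.
move=> hab hd hK.
have h t : a <= t <= b -> - K <= f' t <= K by move=> /hK /Rabs_le_between.
have := @derive_le_upper f f' K a b hab hd (fun t ht => proj2 (h t ht)).
have := @derive_ge_lower f f' (- K) a b hab hd (fun t ht => proj1 (h t ht)).
move=> h1 h2; apply: Rabs_le; lra.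
Qed.

Lemma is_derive_expR_scal (c t : R) : is_derive (fun s => exp (c * s)) t (c * exp (c * t)).
Proof. by auto_derive=> //; ring. Qed.

Lemma gronwall_upper (f f' : R -> R) (c p a b : R) :
  a <= b -> (forall t, is_derive f t (f' t)) ->
  (forall t, a <= t <= b -> f' t <= c * (f t + p)) ->
  f b + p <= (f a + p) * exp (c * (b - a)).
Proof.
move=> hab hd h.
pose g t := - ((f t + p) * exp (- c * t)).
have hg t : is_derive g t (- ((f' t - c * (f t + p)) * exp (- c * t))).
  apply: is_derive_opp.
  evar_last.
    apply: is_derive_mult; last by move=> *; apply: Rmult_comm.
      by apply: is_derive_plus; [exact: hd | apply: is_derive_const].
    exact: is_derive_expR_scal.
  by rewrite /plus /zero /mult /=; ring.
have : g a <= g b.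
  apply: (derive_ge0_le _ _ _ _ hab hg) => t ht.
  have := exp_pos (- c * t); have := h t ht; nra.
rewrite /g => h1.
have e : exp (c * (b - a)) = exp (- c * a) * exp (c * b) by rewrite -exp_plus; f_equal; ring.
have e2 : exp (- c * b) * exp (c * b) = 1 by rewrite -exp_plus -exp_0; f_equal; ring.
have p3 := exp_pos (c * b).
rewrite e.
have : (f b + p) * exp (- c * b) * exp (c * b) <= (f a + p) * exp (- c * a) * exp (c * b).
  by apply: Rmult_le_compat_r; lra.
rewrite Rmult_assoc e2; lra.
Qed.

Lemma gronwall_lower (f f' : R -> R) (c p a b : R) :
  a <= b -> (forall t, is_derive f t (f' t)) ->
  (forall t, a <= t <= b -> c * (f t + p) <= f' t) ->
  (f a + p) * exp (c * (b - a)) <= f b + p.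
Proof.
move=> hab hd h.
have h1 t : is_derive (fun t => - f t) t (- f' t) by apply: is_derive_opp.
have h2 t : a <= t <= b -> - f' t <= c * (- f t + - p) by move=> /h; lra.
have := @gronwall_upper _ _ c (- p) a b hab h1 h2; lra.
Qed.

Lemma abs_le_exp_integral (g g' : R -> R) (c w t : R) :
  0 < w -> 0 <= c -> g 0 = 0 -> (forall s, is_derive g s (g' s)) ->
  (forall s, Rabs s <= Rabs t -> Rabs (g' s) <= c * exp (w * Rabs s)) ->
  Rabs (g t) <= c / w * exp (w * Rabs t).
Proof.
move=> hw hc.
have pos : forall u u' r, 0 <= r -> u 0 = 0 -> (forall s, is_derive u s (u' s)) ->
   (forall s, 0 <= s <= r -> u' s <= c * exp (w * s)) -> u r <= c / w * exp (w * r).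
  move=> u u' r hr u0 hu hb.
  pose h s := c / w * exp (w * s) - u s.
  have dh s : is_derive h s (c * exp (w * s) - u' s).
    apply: is_derive_minus; last exact: hu.
    by evar_last; [apply: is_derive_scal; apply: is_derive_expR_scal
                  | rewrite /scal /= /mult /=; field; lra].
  have := derive_ge0_le _ _ _ _ hr dh.
  have h0 : forall s, 0 <= s <= r -> 0 <= c * exp (w * s) - u' s by move=> s /hb; lra.
  move=> /(_ h0).
  rewrite /h u0 Rmult_0_r exp_0.
  have : 0 <= c / w by apply: Rdiv_le_0_compat.
  lra.
have posabs : forall u u' r, 0 <= r -> u 0 = 0 -> (forall s, is_derive u s (u' s)) ->
   (forall s, 0 <= s <= r -> Rabs (u' s) <= c * exp (w * s)) ->
   Rabs (u r) <= c / w * exp (w * r).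
  move=> u u' r hr u0 hu hb.
  apply: Rabs_le; split; last first.
    apply: (pos u u') => // s /hb /Rabs_le_between; lra.
  suff : - u r <= c / w * exp (w * r) by lra.
  apply: (pos (fun s => - u s) (fun s => - u' s)) => // [|s|s /hb /Rabs_le_between]; try lra.
  by apply: is_derive_opp.
move=> g0 hd hb.
case: (Rle_lt_dec 0 t) => ht.
  rewrite (Rabs_pos_eq t) //; apply: (posabs g g') => // s hs.
  rewrite -{2}(Rabs_pos_eq s); last lra.
  by apply: hb; rewrite !Rabs_pos_eq; lra.
rewrite (Rabs_left t) //.
have -> : g t = (fun s => g (- s)) (- t) by rewrite /= Ropp_involutive.
have dm s : is_derive (fun s => g (- s)) s (- g' (- s)).
  evar_last; [apply: (is_derive_comp g); [exact: hd | apply: is_derive_opp; apply: is_derive_id]|].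
  by rewrite /scal /= /mult /= /opp /= /one /=; ring.
apply: (posabs _ _ _ _ _ dm) => [||s hs]; [lra|by rewrite Ropp_0|].
rewrite Rabs_Ropp -{2}(Rabs_pos_eq s); last lra.
rewrite -(Rabs_Ropp s); apply: hb.
by rewrite Rabs_Ropp Rabs_pos_eq ?(Rabs_left t); lra.
Qed.

Lemma first_hitting (f : R -> R) (c a b : R) :
  (forall t, continuous f t) -> a <= b -> f a < c -> c <= f b ->
  exists t, a < t <= b /\ f t = c /\ forall s, a <= s < t -> f s < c.
Proof.
move=> hf hab hfa hfb.
pose E t := a <= t <= b /\ forall s, a <= s <= t -> f s < c.
have Ea : E a by split; [lra|move=> s hs; have -> : s = a by lra].
have [t [ub lub]] : {t | is_lub E t}.
  by apply: completeness; [exists b => t [] ; lra | exists a].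
have ht : a <= t <= b by split; [exact: ub | apply: lub => s []; lra].
have below s : a <= s < t -> f s < c.
  move=> hs; case: (Rlt_le_dec (f s) c) => // hc.
  suff : t <= s by lra.
  apply: lub => r [hr1 hr2]; case: (Rle_lt_dec r s) => // hrs.
  by have := hr2 s; lra.
have cont eps : 0 < eps -> exists d, 0 < d /\ forall s, Rabs (s - t) < d -> Rabs (f s - f t) < eps.
  move=> he; have := hf t; move/filterlim_locally => /(_ (mkposreal eps he)) [d hd].
  by exists d; split; [apply: cond_pos | move=> s hs; exact: (hd s hs)].
have le : f t <= c.
  case: (Rle_lt_dec (f t) c) => // hc.
  have [d [hd hd2]] := cont (f t - c) ltac:(lra).
  have hat : a < t.
    by case: (Rlt_le_dec a t) => // hh; move: hc; (have -> : t = a by lra); lra.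
  have h1 : Rmax a (t - d / 2) < t by apply: Rmax_lub_lt; lra.
  have := below (Rmax a (t - d / 2)); have := Rmax_l a (t - d/2); have := Rmax_r a (t - d/2).
  move=> l2 l1 /(_ ltac:(lra)).
  have := hd2 (Rmax a (t - d / 2)); rewrite Rabs_left; last lra.
  by move=> /(_ ltac:(lra)) /Rabs_lt_between; lra.
have ge : c <= f t.
  case: (Rle_lt_dec c (f t)) => // hc.
  have [d [hd hd2]] := cont (c - f t) ltac:(lra).
  have htb : t < b by case: (Rlt_le_dec t b) => // hh; move: hc; (have -> : t = b by lra); lra.
  have : E (Rmin b (t + d / 2)).
    have m1 := Rmin_l b (t + d/2); have m2 := Rmin_r b (t + d/2).
    have m3 : t < Rmin b (t + d/2) by apply: Rmin_glb_lt; lra.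
    split; first lra.
    move=> s hs; case: (Rlt_le_dec s t) => hst; first by apply: below; lra.
    have := hd2 s; rewrite Rabs_pos_eq; last lra.
    by move=> /(_ ltac:(lra)) /Rabs_lt_between; lra.
  move=> /ub; have : t < Rmin b (t + d/2) by apply: Rmin_glb_lt; lra.
  lra.
exists t; split; last by split; [lra|].
split; last lra.
by case: (Rlt_le_dec a t) => // hh; move: ge; (have -> : t = a by lra); lra.
Qed.

Lemma derive_first_hitting_ge0 (f : R -> R) (l a t : R) :
  a < t -> is_derive f t l -> (forall s, a <= s < t -> f s < f t) -> 0 <= l.
Proof.
move=> hat hd hs.
case: (Rle_lt_dec 0 l) => // hl; exfalso.
have := proj1 (is_derive_Reals f t l) hd => {}hd.
have [d hd2] := hd (- l) ltac:(lra).
have hdp := cond_pos d.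
pose h := Rmax (a - t) (- (d / 2)).
have h1 : h < 0 by apply: Rmax_lub_lt; lra.
have h2 : a - t <= h by apply: Rmax_l.
have h3 : - (d / 2) <= h by apply: Rmax_r.
have := hd2 h; rewrite Rabs_left // => /(_ ltac:(lra) ltac:(lra)) /Rabs_lt_between [_].
have := hs (t + h) ltac:(lra) => h4 h5.
have : (f (t + h) - f t) / h > 0.
  have -> : (f (t + h) - f t) / h = (f t - f (t + h)) / (- h) by field; lra.
  by apply: Rdiv_lt_0_compat; lra.
lra.
Qed.

Lemma barrier_lt (f f' : R -> R) (c a b : R) :
  (forall t, is_derive f t (f' t)) -> f a < c ->
  (forall t, a <= t <= b -> f t = c -> f' t < 0) ->
  forall t, a <= t <= b -> f t < c.
Proof.
move=> hd ha hb t ht; case: (Rlt_le_dec (f t) c) => // hc; exfalso.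
have [|s [hs [e hs2]]] := first_hitting f c a t (fun t => derive_continuous _ _ _ (hd t)) _ ha hc.
  lra.
have := hb s ltac:(lra) e.
have : 0 <= f' s by apply: (derive_first_hitting_ge0 f _ a s) => //; rewrite ?e //; lra.
lra.
Qed.

Lemma continuous_induction_lt (f : R -> R) (c a b : R) :
  (forall t, continuous f t) -> f a < c ->
  (forall t, a <= t <= b -> (forall s, a <= s <= t -> f s <= c) -> f t < c) ->
  forall t, a <= t <= b -> f t < c.
Proof.
move=> hf ha hb t ht; case: (Rlt_le_dec (f t) c) => // hc; exfalso.
have [|s [hs [e hs2]]] := first_hitting f c a t hf _ ha hc; first lra.
have := hb s ltac:(lra); rewrite e => h; suff : c < c by lra.
apply: h => r hr; case: (Rlt_le_dec r s) => hrs; first by have := hs2 r; lra.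
by (have -> : r = s by lra); rewrite e; lra.
Qed.

Lemma positive_of_no_zero (f : R -> R) (a b : R) :
  (forall t, continuous f t) -> 0 < f a -> (forall t, a <= t <= b -> f t <> 0) ->
  forall t, a <= t <= b -> 0 < f t.
Proof.
move=> hf ha hn t ht; case: (Rlt_le_dec 0 (f t)) => // hc; exfalso.
have hf' s : continuous (fun s => - f s) s by apply: continuous_opp; apply: hf.
have [|||s [hs [e _]]] := first_hitting (fun s => - f s) 0 a t hf'; try lra.
by apply: (hn s); lra.
Qed.

(** * Global flow of a bounded Lipschitz field in the sup norm *)

Section Picard.

Context {A : Type} (F : (A -> R) -> A -> R) (L M : R).
Hypothesis L_ge1 : 1 <= L.
Hypothesis M_ge0 : 0 <= M.
Hypothesis F_bounded : forall x i, Rabs (F x i) <= M.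
Hypothesis F_lipschitz : forall x y d, (forall i, Rabs (x i - y i) <= d) ->
  forall i, Rabs (F x i - F y i) <= L * d.

Definition lipschitz_path (u : R -> A -> R) : Prop :=
  forall s t i, Rabs (u t i - u s i) <= M * Rabs (t - s).

Definition picard_step (x : A -> R) (u : R -> A -> R) : R -> A -> R :=
  fun t i => x i + RInt (fun s => F (u s) i) 0 t.

Fixpoint picard (x : A -> R) (n : nat) : R -> A -> R :=
  if n is S m then picard_step x (picard x m) else fun _ => x.

Lemma continuous_field (u : R -> A -> R) (i : A) (t : R) :
  lipschitz_path u -> continuous (fun s => F (u s) i) t.
Proof.
move=> hu; apply/filterlim_locally => eps.
have he := cond_pos eps.
have hd : 0 < eps / (L * (M + 1)) by apply: Rdiv_lt_0_compat => //; nra.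
exists (mkposreal _ hd) => s hs.
have {}hs : Rabs (s - t) < eps / (L * (M + 1)) by [].
change (Rabs (F (u s) i - F (u t) i) < eps).
have h1 : Rabs (F (u s) i - F (u t) i) <= L * (M * Rabs (s - t)).
  by apply: F_lipschitz => j; apply: hu.
have h2 : Rabs (s - t) * (L * (M + 1)) < eps.
  have := Rmult_lt_compat_r (L * (M + 1)) _ _ ltac:(nra) hs.
  by rewrite /Rdiv Rmult_assoc Rinv_l ?Rmult_1_r //; nra.
have := Rabs_pos (s - t); nra.
Qed.

Lemma derive_picard_step (x : A -> R) (u : R -> A -> R) (i : A) (t : R) :
  lipschitz_path u -> is_derive (fun t => picard_step x u t i) t (F (u t) i).
Proof.
move=> hu; rewrite /picard_step.
evar_last.
  apply: is_derive_plus; first exact: is_derive_const.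
  apply: (is_derive_RInt (fun s => F (u s) i) _ 0); last exact: continuous_field.
  apply: filter_forall => b; apply: RInt_correct.
  by apply: ex_RInt_continuous => z _; apply: continuous_field.
by rewrite /plus /zero /=; ring.
Qed.

Lemma lipschitz_of_derive (u u' : R -> A -> R) :
  (forall i t, is_derive (fun t => u t i) t (u' t i)) ->
  (forall i t, Rabs (u' t i) <= M) -> lipschitz_path u.
Proof.
move=> hd hb s t i; case: (Rle_lt_dec s t) => hst.
  rewrite (Rabs_pos_eq (t - s)); last lra.
  by apply: (derive_abs_le (fun t => u t i) (fun t => u' t i)).
rewrite Rabs_minus_sym (Rabs_minus_sym t) (Rabs_pos_eq (s - t)); last lra.
by apply: (derive_abs_le (fun t => u t i) (fun t => u' t i)) => //; lra.
Qed.

Lemma lipschitz_picard_step (x : A -> R) (u : R -> A -> R) :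
  lipschitz_path u -> lipschitz_path (picard_step x u).
Proof.
move=> hu; apply: (lipschitz_of_derive _ (fun t i => F (u t) i)) => // i t.
exact: derive_picard_step.
Qed.

Lemma lipschitz_picard (x : A -> R) (n : nat) : lipschitz_path (picard x n).
Proof.
elim: n => [|n ih] /=; last exact: lipschitz_picard_step.
by move=> s t i; rewrite Rminus_diag Rabs_R0; apply: Rmult_le_pos => //; apply: Rabs_pos.
Qed.

Lemma picard_step0 (x : A -> R) (u : R -> A -> R) (i : A) : picard_step x u 0 i = x i.
Proof. by rewrite /picard_step RInt_point /zero /=; ring. Qed.

(** The weight [exp (2 L |t|)] makes the Picard operator a contraction of ratio
    one half globally in time. *)
Lemma picard_step_contracts (x y : A -> R) (u v : R -> A -> R) (d : R) (t : R) :
  lipschitz_path u -> lipschitz_path v -> 0 <= d ->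
  (forall s i, Rabs (u s i - v s i) <= d * exp (2 * L * Rabs s)) ->
  forall i, Rabs (picard_step x u t i - picard_step y v t i)
            <= Rabs (x i - y i) + d / 2 * exp (2 * L * Rabs t).
Proof.
move=> hu hv hd huv i.
have h : Rabs ((picard_step x u t i - picard_step y v t i) - (x i - y i))
   <= L * d / (2 * L) * exp (2 * L * Rabs t).
  apply: (abs_le_exp_integral
    (fun t => (picard_step x u t i - picard_step y v t i) - (x i - y i))
    (fun t => F (u t) i - F (v t) i)); [lra|nra| | |].
  - by rewrite !picard_step0; ring.
  - move=> s; evar_last.
      apply: is_derive_minus; last exact: is_derive_const.
      by apply: is_derive_minus; apply: derive_picard_step.
    by rewrite /minus /plus /opp /zero /=; ring.
  - move=> s _; rewrite Rmult_assoc; apply: F_lipschitz => j; exact: huv.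
have e : L * d / (2 * L) = d / 2 by field; lra.
rewrite e in h.
have := Rabs_triang ((picard_step x u t i - picard_step y v t i) - (x i - y i)) (x i - y i).
have -> : picard_step x u t i - picard_step y v t i - (x i - y i) + (x i - y i)
  = picard_step x u t i - picard_step y v t i by ring.
lra.
Qed.

Lemma picard_succ_close (x : A -> R) (n : nat) (t : R) (i : A) :
  Rabs (picard x n.+1 t i - picard x n t i) <= M * (/ 2) ^ n * exp (2 * L * Rabs t).
Proof.
elim: n t i => [|n ih] t i.
  rewrite /= Rmult_1_r.
  have := lipschitz_picard_step x (fun _ => x) _ 0 t i.
  rewrite picard_step0 Rminus_0_r => h.
  apply: Rle_trans (h _) _.
    by move=> s r j; rewrite Rminus_diag Rabs_R0; apply: Rmult_le_pos => //; apply: Rabs_pos.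
  apply: Rmult_le_compat_l => //.
  have := exp_ineq1_le (2 * L * Rabs t); have := Rabs_pos t; nra.
have h := picard_step_contracts x x (picard x n.+1) (picard x n) (M * (/ 2) ^ n) t
  (lipschitz_picard x n.+1) (lipschitz_picard x n) _ ih i.
rewrite Rminus_diag Rabs_R0 Rplus_0_l in h.
apply: Rle_trans (h _) _; first by apply: Rmult_le_pos => //; apply: pow_le; lra.
by right; rewrite /=; field.
Qed.

Lemma picard_close (x : A -> R) (n p : nat) (t : R) (i : A) :
  Rabs (picard x (n + p) t i - picard x n t i)
  <= 2 * M * (/ 2) ^ n * (1 - (/ 2) ^ p) * exp (2 * L * Rabs t).
Proof.
elim: p => [|p ih]; first by rewrite addn0 Rminus_diag Rabs_R0 /=; lra.
rewrite addnS.
have h := picard_succ_close x (n + p) t i.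
have := Rabs_triang (picard x (n + p).+1 t i - picard x (n + p) t i)
                    (picard x (n + p) t i - picard x n t i).
have -> : picard x (n + p).+1 t i - picard x (n + p) t i + (picard x (n + p) t i - picard x n t i)
  = picard x (n + p).+1 t i - picard x n t i by ring.
have e : (/ 2) ^ (n + p) = (/ 2) ^ n * (/ 2) ^ p by rewrite -pow_add.
rewrite e in h.
have -> : 2 * M * (/ 2) ^ n * (1 - (/ 2) ^ p.+1) * exp (2 * L * Rabs t) =
  2 * M * (/ 2) ^ n * (1 - (/ 2) ^ p) * exp (2 * L * Rabs t)
  + M * ((/ 2) ^ n * (/ 2) ^ p) * exp (2 * L * Rabs t) by rewrite /=; field.
lra.
Qed.

Definition flow (x : A -> R) (t : R) (i : A) : R :=
  real (Lim_seq (fun n => picard x n t i)).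

Lemma flow_is_lim (x : A -> R) (t : R) (i : A) :
  is_lim_seq (fun n => picard x n t i) (flow x t i).
Proof.
apply: Lim_seq_correct'; apply/ex_lim_seq_cauchy_corr => eps.
have he := cond_pos eps.
set K := 4 * M * exp (2 * L * Rabs t) + 1.
have hK : 0 < K by rewrite /K; have := exp_pos (2 * L * Rabs t); nra.
have [n0 hn0] := pow_lt_1_zero (/ 2) ltac:(rewrite Rabs_pos_eq; lra) (eps / K)
  ltac:(by apply: Rdiv_lt_0_compat).
have close m : (n0 <= m)%N -> Rabs (picard x m t i - picard x n0 t i) < eps / 2.
  move=> hm; have := picard_close x n0 (m - n0) t i; rewrite subnKC // => h.
  have := hn0 n0 ltac:(lia); rewrite Rabs_pos_eq; last by apply: pow_le; lra.
  move=> h2.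
  have h3 : (/ 2) ^ n0 * K < eps.
    have := Rmult_lt_compat_r K _ _ hK h2.
    by rewrite /Rdiv Rmult_assoc Rinv_l ?Rmult_1_r //; lra.
  have p1 : 0 <= (/ 2) ^ n0 by apply: pow_le; lra.
  have p2 : 0 <= (/ 2) ^ (m - n0) by apply: pow_le; lra.
  have p3 := exp_pos (2 * L * Rabs t).
  apply: Rle_lt_trans h _.
  have p4 : 0 <= 2 * M * (/ 2) ^ n0 * exp (2 * L * Rabs t).
    by apply: Rmult_le_pos; [apply: Rmult_le_pos; lra | lra].
  have : 2 * M * (/ 2) ^ n0 * exp (2 * L * Rabs t) * 2 <= (/ 2) ^ n0 * K - (/ 2) ^ n0.
    by rewrite /K; right; ring.
  have : 0 < (/ 2) ^ n0 by apply: pow_lt; lra.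
  nra.
exists n0 => p q hp hq.
have := close p ltac:(lia); have := close q ltac:(lia) => h1 h2.
have := Rabs_triang (picard x p t i - picard x n0 t i) (- (picard x q t i - picard x n0 t i)).
rewrite Rabs_Ropp.
have -> : picard x p t i - picard x n0 t i + - (picard x q t i - picard x n0 t i)
  = picard x p t i - picard x q t i by ring.
lra.
Qed.

Lemma lim_abs_le (u : nat -> R) (l c K : R) :
  is_lim_seq u l -> (forall n, Rabs (u n - c) <= K) -> Rabs (l - c) <= K.
Proof.
move=> hu hK.
have h : is_lim_seq (fun n => Rabs (u n - c)) (Rabs (l - c)).
  apply: (is_lim_seq_abs _ (Rbar.Finite (l - c))).
  by apply: is_lim_seq_minus'; [exact: hu | exact: is_lim_seq_const].
exact: (is_lim_seq_le _ _ (Rbar.Finite _) (Rbar.Finite _) hK h (is_lim_seq_const K)).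
Qed.

Lemma flow_close (x : A -> R) (n : nat) (t : R) (i : A) :
  Rabs (flow x t i - picard x n t i) <= 2 * M * (/ 2) ^ n * exp (2 * L * Rabs t).
Proof.
apply: (lim_abs_le (fun p => picard x (p + n) t i)).
  by have := is_lim_seq_incr_n (fun n => picard x n t i) n (flow x t i) => -[h _];
     apply: h; apply: flow_is_lim.
move=> p; rewrite addnC; apply: Rle_trans (picard_close _ _ _ _ _) _.
apply: Rmult_le_compat_r; first by left; apply: exp_pos.
have : 0 <= 2 * M * (/ 2) ^ n by apply: Rmult_le_pos; [lra|apply: pow_le; lra].
have : 0 <= (/ 2) ^ p by apply: pow_le; lra.
nra.
Qed.

Lemma lipschitz_flow (x : A -> R) : lipschitz_path (flow x).
Proof.
move=> s t i.
have h : is_lim_seq (fun n => picard x n t i - picard x n s i) (flow x t i - flow x s i).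
  by apply: is_lim_seq_minus'; apply: flow_is_lim.
have := lim_abs_le _ _ 0 (M * Rabs (t - s)) h; rewrite Rminus_0_r; apply => n.
by rewrite Rminus_0_r; apply: lipschitz_picard.
Qed.

Lemma flow_fixed (x : A -> R) (t : R) (i : A) : flow x t i = picard_step x (flow x) t i.
Proof.
apply: cond_eq => eps he.
set K := 2 * M * exp (2 * L * Rabs t) + 1.
have hE := exp_pos (2 * L * Rabs t).
have hK : 0 < K by rewrite /K; nra.
have [n hn] := pow_lt_1_zero (/ 2) ltac:(rewrite Rabs_pos_eq; lra) (eps / K)
  ltac:(by apply: Rdiv_lt_0_compat).
have hp : 0 <= (/ 2) ^ n by apply: pow_le; lra.
have := hn n ltac:(lia); rewrite Rabs_pos_eq // => h2.
have h3 : (/ 2) ^ n * K < eps.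
  have := Rmult_lt_compat_r K _ _ hK h2.
  by rewrite /Rdiv Rmult_assoc Rinv_l ?Rmult_1_r //; lra.
have h4 := flow_close x n.+1 t i.
have h5 := picard_step_contracts x x (flow x) (picard x n) (2 * M * (/ 2) ^ n) t
  (lipschitz_flow x) (lipschitz_picard x n) ltac:(nra) (flow_close x n) i.
rewrite Rminus_diag Rabs_R0 Rplus_0_l in h5.
have e : 2 * M * (/ 2) ^ n.+1 = M * (/ 2) ^ n by rewrite /=; field.
rewrite e in h4.
have := Rabs_triang (flow x t i - picard x n.+1 t i)
   (- (picard_step x (flow x) t i - picard_step x (picard x n) t i)).
rewrite Rabs_Ropp.
have -> : flow x t i - picard x n.+1 t i
   + - (picard_step x (flow x) t i - picard_step x (picard x n) t i)
   = flow x t i - picard_step x (flow x) t i by rewrite /=; ring.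
have : (/ 2) ^ n * K = 2 * (M * (/ 2) ^ n * exp (2 * L * Rabs t)) + (/ 2) ^ n by rewrite /K; ring.
lra.
Qed.

Lemma flow0 (x : A -> R) (i : A) : flow x 0 i = x i.
Proof. by rewrite flow_fixed picard_step0. Qed.

Lemma derive_flow (x : A -> R) (i : A) (t : R) :
  is_derive (fun t => flow x t i) t (F (flow x t) i).
Proof.
apply: (is_derive_ext (fun t => picard_step x (flow x) t i)).
  by move=> s; rewrite -flow_fixed.
by apply: derive_picard_step; apply: lipschitz_flow.
Qed.

Lemma flow_dependence (x y : A -> R) (d t : R) :
  (forall i, Rabs (x i - y i) <= d) ->
  forall i, Rabs (flow x t i - flow y t i) <= 2 * d * exp (2 * L * Rabs t).
Proof.
move=> hxy i.
have hd : 0 <= d by apply: Rle_trans (hxy i); apply: Rabs_pos.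
have hn n : forall s j, Rabs (picard x n s j - picard y n s j) <= 2 * d * exp (2 * L * Rabs s).
  have one s : 1 <= exp (2 * L * Rabs s).
    have := exp_ineq1_le (2 * L * Rabs s); have := Rabs_pos s; nra.
  elim: n => [|n ih] s j; first by have := one s; have := hxy j; rewrite /=; nra.
  have h := picard_step_contracts x y (picard x n) (picard y n) (2 * d) s
   (lipschitz_picard x n) (lipschitz_picard y n) ltac:(lra) ih j.
  have := one s; have := hxy j; rewrite /=; nra.
have h : is_lim_seq (fun n => picard x n t i - picard y n t i) (flow x t i - flow y t i).
  by apply: is_lim_seq_minus'; apply: flow_is_lim.
have := lim_abs_le _ _ 0 _ h; rewrite Rminus_0_r; apply => n.
by rewrite Rminus_0_r; apply: hn.
Qed.

End Picard.

(** * The toy model in polar coordinates *)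

(** [x (true, j)] is the logarithm of the intensity of the mode [j], so that
    intensities stay positive, and [x (false, j)] is the phase [phi_j]. *)
Definition state : Type := bool * nat -> R.

Definition intensity (N : nat) (x : state) (j : nat) : R :=
  if (0 < j <= N)%N then exp (x (true, j)) else 0.

(** The cap makes the field below globally Lipschitz; it is inactive on states
    of mass one. *)
Definition capped_intensity (N : nat) (x : state) (j : nat) : R :=
  if (0 < j <= N)%N then exp (Rmin (x (true, j)) 0) else 0.

Definition phase_gap (x : state) (j : nat) : R := x (false, j.+1) - x (false, j).

Definition polar_field (N : nat) (x : state) (i : bool * nat) : R :=
  match i with
  | (_, 0%N) => 0
  | (true, j.+1) => 4 * (capped_intensity N x j * sin (phase_gap x j)
                         - capped_intensity N x j.+2 * sin (phase_gap x j.+1))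
  | (false, j.+1) => - 2 * capped_intensity N x j.+1
                     + 4 * capped_intensity N x j * cos (phase_gap x j)
                     + 4 * capped_intensity N x j.+2 * cos (phase_gap x j.+1)
  end.

Lemma lipschitz1_of_derive (f f' : R -> R) :
  (forall t, is_derive f t (f' t)) -> (forall t, Rabs (f' t) <= 1) ->
  forall a b, Rabs (f a - f b) <= Rabs (a - b).
Proof.
move=> hd hb a b; case: (Rle_lt_dec b a) => h.
  rewrite (Rabs_pos_eq (a - b)); last lra.
  by have := derive_abs_le f f' 1 b a h hd (fun t _ => hb t); lra.
rewrite Rabs_minus_sym (Rabs_minus_sym a) (Rabs_pos_eq (b - a)); last lra.
by have := derive_abs_le f f' 1 a b ltac:(lra) hd (fun t _ => hb t); lra.
Qed.

Lemma Rabs_sin_le1 (a : R) : Rabs (sin a) <= 1.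
Proof. by apply: Rabs_le; have := SIN_bound a; lra. Qed.

Lemma Rabs_cos_le1 (a : R) : Rabs (cos a) <= 1.
Proof. by apply: Rabs_le; have := COS_bound a; lra. Qed.

Lemma sin_lipschitz (a b : R) : Rabs (sin a - sin b) <= Rabs (a - b).
Proof.
by apply: (lipschitz1_of_derive sin cos) => [t|t]; [exact: is_derive_sin | exact: Rabs_cos_le1].
Qed.

Lemma cos_lipschitz (a b : R) : Rabs (cos a - cos b) <= Rabs (a - b).
Proof.
apply: (lipschitz1_of_derive cos (fun t => - sin t)) => [t|t]; first exact: is_derive_cos.
by rewrite Rabs_Ropp; exact: Rabs_sin_le1.
Qed.

Lemma exp_min_bounds (a : R) : 0 < exp (Rmin a 0) <= 1.
Proof.
split; first exact: exp_pos.
rewrite -exp_0; case: (Rle_lt_or_eq_dec (Rmin a 0) 0 (Rmin_r _ _)) => [h|->]; last by right.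
by left; apply: exp_increasing.
Qed.

Lemma exp_min_lipschitz (a b : R) : Rabs (exp (Rmin a 0) - exp (Rmin b 0)) <= Rabs (a - b).
Proof.
have key u v : u <= v -> Rabs (exp (Rmin v 0) - exp (Rmin u 0)) <= v - u.
  move=> huv.
  have h1 : Rmin u 0 <= Rmin v 0 by apply: Rle_min_compat_r.
  have h2 := Rmin_r v 0.
  have := derive_abs_le exp exp 1 _ _ h1 is_derive_exp _ => h.
  apply: Rle_trans (h _) _.
    move=> t ht; rewrite Rabs_pos_eq; last by left; apply: exp_pos.
    by rewrite -exp_0; case: (Rle_lt_or_eq_dec t 0) => [|/exp_increasing|->]; lra.
  rewrite Rmult_1_l; rewrite /Rmin; case: Rle_dec; case: Rle_dec; lra.
case: (Rle_lt_dec b a) => h.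
  by rewrite (Rabs_pos_eq (a - b)); [apply: key | lra].
rewrite Rabs_minus_sym (Rabs_minus_sym a) (Rabs_pos_eq (b - a)); last lra.
by apply: key; lra.
Qed.

Lemma capped_bounds (N : nat) (x : state) (j : nat) : 0 <= capped_intensity N x j <= 1.
Proof. rewrite /capped_intensity; case: ifP => _; last lra; have := exp_min_bounds (x (true, j)); lra. Qed.

Lemma capped_lipschitz (N : nat) (x y : state) (d : R) (j : nat) :
  (forall i, Rabs (x i - y i) <= d) ->
  Rabs (capped_intensity N x j - capped_intensity N y j) <= d.
Proof.
move=> h; have hd : 0 <= d by apply: Rle_trans (h (true, j)); apply: Rabs_pos.
rewrite /capped_intensity; case: ifP => _; last by rewrite Rminus_diag Rabs_R0.
exact: Rle_trans (exp_min_lipschitz _ _) (h _).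
Qed.

Lemma phase_gap_lipschitz (x y : state) (d : R) (j : nat) :
  (forall i, Rabs (x i - y i) <= d) -> Rabs (phase_gap x j - phase_gap y j) <= 2 * d.
Proof.
move=> h; have /Rabs_le_between h1 := h (false, j); have /Rabs_le_between h2 := h (false, j.+1).
by apply: Rabs_le; rewrite /phase_gap; lra.
Qed.

Lemma product_lipschitz (a b s t d : R) :
  Rabs (a - b) <= d -> Rabs (s - t) <= 2 * d -> 0 <= a <= 1 -> Rabs t <= 1 ->
  Rabs (a * s - b * t) <= 3 * d.
Proof.
move=> h1 h2 ha ht.
have -> : a * s - b * t = a * (s - t) + (a - b) * t by ring.
apply: Rle_trans (Rabs_triang _ _) _; rewrite !Rabs_mult (Rabs_pos_eq a); last lra.
have := Rabs_pos (s - t); have := Rabs_pos (a - b); have := Rabs_pos t; nra.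
Qed.

Lemma Rabs_mult_le (a s : R) : 0 <= a -> Rabs s <= 1 -> Rabs (a * s) <= a.
Proof. by move=> ha hs; rewrite Rabs_mult Rabs_pos_eq //; have := Rabs_pos s; nra. Qed.

Lemma polar_field_bounded (N : nat) (x : state) (i : bool * nat) :
  Rabs (polar_field N x i) <= 10.
Proof.
have hI j := capped_bounds N x j.
have hs j : - capped_intensity N x j <= capped_intensity N x j * sin (phase_gap x j) <= capped_intensity N x j.
  by apply/Rabs_le_between/Rabs_mult_le; [have := hI j; lra | exact: Rabs_sin_le1].
have hs' j : - capped_intensity N x j.+1 <= capped_intensity N x j.+1 * sin (phase_gap x j) <= capped_intensity N x j.+1.
  by apply/Rabs_le_between/Rabs_mult_le; [have := hI j.+1; lra | exact: Rabs_sin_le1].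
have hc j : - capped_intensity N x j <= capped_intensity N x j * cos (phase_gap x j) <= capped_intensity N x j.
  by apply/Rabs_le_between/Rabs_mult_le; [have := hI j; lra | exact: Rabs_cos_le1].
have hc' j : - capped_intensity N x j.+1 <= capped_intensity N x j.+1 * cos (phase_gap x j) <= capped_intensity N x j.+1.
  by apply/Rabs_le_between/Rabs_mult_le; [have := hI j.+1; lra | exact: Rabs_cos_le1].
case: i => [[] [|j]] /=; rewrite ?Rabs_R0; try lra; apply: Rabs_le.
  have := hs j; have := hs' j.+1; have := hI j; have := hI j.+2; lra.
have := hc j; have := hc' j.+1; have := hI j; have := hI j.+1; have := hI j.+2; lra.
Qed.

Lemma polar_field_lipschitz (N : nat) (x y : state) (d : R) :
  (forall i, Rabs (x i - y i) <= d) ->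
  forall i, Rabs (polar_field N x i - polar_field N y i) <= 26 * d.
Proof.
move=> h i; have hd : 0 <= d by apply: Rle_trans (h i); apply: Rabs_pos.
have hI j := capped_lipschitz N x y d j h.
have gs j k := product_lipschitz _ _ _ _ d (hI k)
  (Rle_trans _ _ _ (sin_lipschitz _ _) (phase_gap_lipschitz x y d j h))
  (capped_bounds N x k) (Rabs_sin_le1 _).
have gc j k := product_lipschitz _ _ _ _ d (hI k)
  (Rle_trans _ _ _ (cos_lipschitz _ _) (phase_gap_lipschitz x y d j h))
  (capped_bounds N x k) (Rabs_cos_le1 _).
case: i => [[] [|j]] /=; try (by rewrite Rminus_diag Rabs_R0; lra); apply: Rabs_le.
  have /Rabs_le_between := gs j j; have /Rabs_le_between := gs j.+1 j.+2; lra.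
have /Rabs_le_between := gc j j; have /Rabs_le_between := gc j.+1 j.+2.
have /Rabs_le_between := hI j.+1; lra.
Qed.

Definition polar_flow (N : nat) : state -> R -> state := flow (polar_field N).

Definition mass (N : nat) (x : state) : R := sum_n (intensity N x) N.

(** Solutions of the toy model in the polar coordinates
    [b_j = sqrt (I j) * exp (i * phi j / 2)], of total mass one. *)
Record polar_orbit (N : nat) (I phi : nat -> R -> R) : Prop := {
  orbit_dI : forall j t, is_derive (I j.+1) t
    (4 * I j.+1 t * (I j t * sin (phi j.+1 t - phi j t)
                     - I j.+2 t * sin (phi j.+2 t - phi j.+1 t)));
  orbit_dphi : forall j t, is_derive (phi j.+1) t
    (- 2 * I j.+1 t + 4 * I j t * cos (phi j.+1 t - phi j t)
     + 4 * I j.+2 t * cos (phi j.+2 t - phi j.+1 t));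
  orbit_pos : forall j t, (0 < j <= N)%N -> 0 < I j t;
  orbit_out : forall j t, ~~ (0 < j <= N)%N -> I j t = 0;
  orbit_mass : forall t, sum_n (fun j => I j t) N = 1 }.

Lemma polar_flow0 (N : nat) (x : state) (i : bool * nat) : polar_flow N x 0 i = x i.
Proof.
apply: (flow0 _ 26 10); try lra; [exact: polar_field_bounded | exact: polar_field_lipschitz].
Qed.

Lemma derive_polar_flow (N : nat) (x : state) (i : bool * nat) (t : R) :
  is_derive (fun t => polar_flow N x t i) t (polar_field N (polar_flow N x t) i).
Proof.
apply: (derive_flow _ 26 10); try lra; [exact: polar_field_bounded | exact: polar_field_lipschitz].
Qed.

Lemma polar_flow_dependence (N : nat) (x y : state) (d t : R) :
  (forall i, Rabs (x i - y i) <= d) ->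
  forall i, Rabs (polar_flow N x t i - polar_flow N y t i) <= 2 * d * exp (52 * Rabs t).
Proof.
move=> h i; have -> : 52 = 2 * 26 by ring.
by apply: (flow_dependence _ 26 10); try lra; [exact: polar_field_bounded | exact: polar_field_lipschitz | ].
Qed.

Lemma polar_flow_lipschitz (N : nat) (x : state) (s t : R) (i : bool * nat) :
  Rabs (polar_flow N x t i - polar_flow N x s i) <= 10 * Rabs (t - s).
Proof.
apply: (lipschitz_flow _ 26 10); try lra; [exact: polar_field_bounded | exact: polar_field_lipschitz].
Qed.

Lemma derive_intensity (N : nat) (x : state) (j : nat) (t : R) :
  is_derive (fun t => intensity N (polar_flow N x t) j) t
    (intensity N (polar_flow N x t) j * polar_field N (polar_flow N x t) (true, j)).
Proof.
rewrite /intensity; case: ifP => _; last by rewrite Rmult_0_l; apply: is_derive_const.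
evar_last; [apply: (is_derive_comp exp); [exact: is_derive_exp | exact: derive_polar_flow]|].
by rewrite /scal /= /mult /=; ring.
Qed.

Lemma intensity_ge0 (N : nat) (x : state) (j : nat) : 0 <= intensity N x j.
Proof. by rewrite /intensity; case: ifP => _; [left; apply: exp_pos | lra]. Qed.

Lemma sum_n_ge0 (f : nat -> R) (n : nat) : (forall j, 0 <= f j) -> 0 <= sum_n f n.
Proof.
by move=> h; elim: n => [|n ih]; rewrite ?sum_O // sum_Sn /plus /=; have := h n.+1; lra.
Qed.

Lemma term_le_sum_n (f : nat -> R) (n k : nat) :
  (forall j, 0 <= f j) -> (k <= n)%N -> f k <= sum_n f n.
Proof.
move=> h; elim: n => [|n ih] hk; first by rewrite sum_O (_ : k = 0%N) ; [lra | lia].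
rewrite sum_Sn /plus /=; case: (leqP k n) => hkn; first by have := ih hkn; have := h n.+1; lra.
by rewrite (_ : k = n.+1); [have := sum_n_ge0 f n h; lra | lia].
Qed.

Lemma capped_below1 (N : nat) (x : state) (j : nat) :
  intensity N x j <= 1 -> capped_intensity N x j = intensity N x j.
Proof.
rewrite /intensity /capped_intensity; case: ifP => // _ h.
rewrite Rmin_left //; case: (Rle_lt_dec (x (true, j)) 0) => // /exp_increasing; rewrite exp_0; lra.
Qed.

Lemma capped_above1 (N : nat) (x : state) (j : nat) :
  1 <= intensity N x j -> capped_intensity N x j = 1.
Proof.
rewrite /intensity /capped_intensity; case: ifP => _ h; last lra.
rewrite Rmin_right ?exp_0 //; case: (Rle_lt_dec 0 (x (true, j))) => // /exp_increasing; rewrite exp_0; lra.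
Qed.

(** Capping breaks the exact exchange of mass between neighbours, but only by
    the excess of the total mass over one. *)
Lemma exchange_defect (N : nat) (x : state) (j : nat) :
  (j <= N)%N ->
  Rabs (intensity N x j.+1 * capped_intensity N x j
        - intensity N x j * capped_intensity N x j.+1) <= Rabs (mass N x - 1).
Proof.
move=> hj.
have m1 : intensity N x j <= mass N x by apply: term_le_sum_n => // k; apply: intensity_ge0.
have m2 : intensity N x j.+1 <= mass N x.
  case: (ltnP j N) => h; first by apply: term_le_sum_n => // k; apply: intensity_ge0.
  rewrite {1}/intensity ifF; last lia.
  by apply: sum_n_ge0 => k; apply: intensity_ge0.
have a1 := intensity_ge0 N x j; have a2 := intensity_ge0 N x j.+1.
case: (Rle_lt_dec (intensity N x j) 1) => h1; case: (Rle_lt_dec (intensity N x j.+1) 1) => h2.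
- by rewrite !capped_below1 //; rewrite (_ : _ - _ = 0) ?Rabs_R0; [apply: Rabs_pos | ring].
- rewrite (capped_below1 _ _ j) // (capped_above1 _ _ j.+1); last lra.
  by rewrite (Rabs_pos_eq (mass _ _ - 1)); [apply: Rabs_le; nra | lra].
- rewrite (capped_below1 _ _ j.+1) // (capped_above1 _ _ j); last lra.
  by rewrite (Rabs_pos_eq (mass _ _ - 1)); [apply: Rabs_le; nra | lra].
- rewrite !capped_above1; try lra.
  by rewrite (Rabs_pos_eq (mass _ _ - 1)); [apply: Rabs_le; lra | lra].
Qed.

Lemma mass_rate (N n : nat) (x : state) :
  (n <= N)%N ->
  Rabs (sum_n (fun j => intensity N x j * polar_field N x (true, j)) n
        + 4 * intensity N x n * capped_intensity N x n.+1 * sin (phase_gap x n))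
  <= 4 * INR n * Rabs (mass N x - 1).
Proof.
elim: n => [|n ih] hn.
  rewrite sum_O /= /intensity /= (_ : _ + _ = 0); last ring.
  by rewrite Rabs_R0; lra.
rewrite sum_Sn /plus S_INR.
move: (ih ltac:(lia)) => /Rabs_le_between {}ih.
have /Rabs_le_between hd := exchange_defect N x n ltac:(lia).
set D := intensity N x n.+1 * capped_intensity N x n
        - intensity N x n * capped_intensity N x n.+1 in hd.
have : Rabs (D * sin (phase_gap x n)) <= Rabs (mass N x - 1).
  rewrite Rabs_mult.
  have h1 := Rabs_le _ _ hd; have h2 := Rabs_sin_le1 (phase_gap x n).
  have := Rabs_pos D; have := Rabs_pos (sin (phase_gap x n)); nra.
move=> /Rabs_le_between h3.
set T := sum_n _ n in ih *.
apply: Rabs_le.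
have -> : T + intensity N x n.+1 * polar_field N x (true, n.+1)
  + 4 * intensity N x n.+1 * capped_intensity N x n.+2 * sin (phase_gap x n.+1)
  = (T + 4 * intensity N x n * capped_intensity N x n.+1 * sin (phase_gap x n))
    + 4 * (D * sin (phase_gap x n)) by rewrite /D /=; ring.
lra.
Qed.

Lemma zero_of_derive_bound (v v' : R -> R) (w : R) :
  0 < w -> v 0 = 0 -> (forall t, is_derive v t (v' t)) ->
  (forall t, Rabs (v' t) <= w * Rabs (v t)) -> forall t, v t = 0.
Proof.
move=> hw v0 hd hb.
have pos (u u' : R -> R) : u 0 = 0 -> (forall t, is_derive u t (u' t)) ->
    (forall t, Rabs (u' t) <= w * Rabs (u t)) -> forall t, 0 <= t -> u t = 0.
  move=> u0 ud ub t ht.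
  have := gronwall_upper (fun t => u t * u t) (fun t => 2 * u t * u' t) (2 * w) 0 0 t ht.
  rewrite /= u0 => h.
  have : u t * u t + 0 <= (0 * 0 + 0) * exp (2 * w * (t - 0)).
    apply: h => [s|s _].
      evar_last; [by apply: is_derive_mult; try exact: ud; move=> *; apply: Rmult_comm|].
      by rewrite /plus /mult /=; ring.
    have : u s * u' s <= Rabs (u s) * (w * Rabs (u s)).
      apply: Rle_trans (Rle_abs _) _; rewrite Rabs_mult.
      by apply: Rmult_le_compat_l; [apply: Rabs_pos | exact: ub].
    have : Rabs (u s) * Rabs (u s) = u s * u s by rewrite -Rabs_mult Rabs_pos_eq //; nra.
    nra.
  by nra.
move=> t; case: (Rle_lt_dec 0 t) => ht; first exact: (pos v v').
have -> : v t = (fun s => v (- s)) (- t) by rewrite Ropp_involutive.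
have dm s : is_derive (fun s => v (- s)) s (- v' (- s)).
  evar_last; [apply: (is_derive_comp v); [exact: hd | apply: is_derive_opp; apply: is_derive_id]|].
  by rewrite /scal /= /mult /= /opp /= /one /=; ring.
apply: (pos _ _ _ dm) => [|s|]; [by rewrite Ropp_0|by rewrite Rabs_Ropp|lra].
Qed.

Lemma mass_conserved (N : nat) (x : state) (t : R) :
  mass N x = 1 -> mass N (polar_flow N x t) = 1.
Proof.
move=> hx.
suff : mass N (polar_flow N x t) - 1 = 0 by lra.
apply: (zero_of_derive_bound (fun t => mass N (polar_flow N x t) - 1)
  (fun t => sum_n (fun j => intensity N (polar_flow N x t) j
                            * polar_field N (polar_flow N x t) (true, j)) N)
  (4 * INR N + 1)).
- by have := pos_INR N; lra.
- suff -> : mass N (polar_flow N x 0) = mass N x by rewrite hx; ring.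
  by apply: sum_n_ext => j; rewrite /intensity polar_flow0.
- move=> s; evar_last.
    apply: is_derive_minus; last exact: is_derive_const.
    by apply: is_derive_sum_n => k _; apply: derive_intensity.
  by rewrite minus_zero_r.
- move=> s; have := mass_rate N N (polar_flow N x s) ltac:(lia).
  rewrite {1}/capped_intensity ifF; last lia.
  rewrite Rmult_0_r Rmult_0_l Rplus_0_r => h.
  have := Rabs_pos (mass N (polar_flow N x s) - 1); lra.
Qed.

Lemma polar_flow_orbit (N : nat) (x : state) :
  mass N x = 1 ->
  polar_orbit N (fun j t => intensity N (polar_flow N x t) j)
                (fun j t => polar_flow N x t (false, j)).
Proof.
move=> hx.
have cap t j : capped_intensity N (polar_flow N x t) j = intensity N (polar_flow N x t) j.
  apply: capped_below1; rewrite -(mass_conserved N x t hx).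
  case: (leqP j N) => h; first by apply: term_le_sum_n => // k; apply: intensity_ge0.
  rewrite {1}/intensity ifF; last lia.
  by apply: sum_n_ge0 => k; apply: intensity_ge0.
split.
- move=> j t; evar_last; first exact: derive_intensity.
  by rewrite /= !cap /phase_gap; ring.
- by move=> j t; evar_last; [exact: derive_polar_flow | rewrite /= !cap /phase_gap].
- by move=> j t h; rewrite /intensity h; apply: exp_pos.
- by move=> j t /negbTE h; rewrite /intensity h.
- by move=> t; exact: (mass_conserved N x t hx).
Qed.

(** * Energy exchange between neighbouring modes *)

(** Growth rate of the intensity along the expanding direction of a mode next
    to a dominant mode of intensity one. *)
Definition rate : R := 2 * sqrt 3.

Lemma rate_sqr : rate * rate = 12.
Proof. rewrite /rate; have := sqrt_sqrt 3 ltac:(lra); nra. Qed.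

Lemma rate_bounds : 3.46 <= rate <= 3.47.
Proof.
have h0 : 0 <= rate by rewrite /rate; have := sqrt_pos 3; lra.
have := rate_sqr; split; nra.
Qed.

Definition angle (phi : nat -> R -> R) (j : nat) (t : R) : R := phi j.+1 t - phi j t.

(** Conserved when the modes [j] and [j + 1] are the only ones: there the
    Hamiltonian is a function of the mass and of this quantity. *)
Definition coupling (I phi : nat -> R -> R) (j : nat) (t : R) : R :=
  I j t * I j.+1 t * (1 + 2 * cos (angle phi j t)).

Section Orbit.

Context (N : nat) (I phi : nat -> R -> R) (orb : polar_orbit N I phi).

Local Notation psi := (angle phi).
Local Notation Q := (coupling I phi).

Lemma orbit_ge0 (j : nat) (t : R) : 0 <= I j t.
Proof.
case e : (0 < j <= N)%N; first by left; apply: (orbit_pos _ _ _ orb).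
by rewrite (orbit_out _ _ _ orb) ?e //; lra.
Qed.

Lemma sum_n_remove (f : nat -> R) (n k : nat) : (k <= n)%N ->
  sum_n f n = f k + sum_n (fun j => if j == k then 0 else f j) n.
Proof.
elim: n => [|n ih] hk.
  have -> : k = 0%N by lia.
  by rewrite !sum_O eqxx Rplus_0_r.
rewrite !sum_Sn /plus /=; case: (ltnP n k) => h; last first.
  rewrite ih //; have -> : (n.+1 == k) = false by lia.
  by ring.
have -> : k = n.+1 by lia.
rewrite eqxx (sum_n_ext_loc (fun j => if j == n.+1 then 0 else f j) f); first by ring.
by move=> j hj; rewrite ifF //; lia.
Qed.

Lemma term_le_sum (f : nat -> R) (k : nat) : (forall j, 0 <= f j) ->
  (forall j, ~~ (0 < j <= N)%N -> f j = 0) -> f k <= sum_n f N.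
Proof.
move=> h0 hout; case: (leqP k N) => hk; first exact: term_le_sum_n.
by rewrite hout; [apply: sum_n_ge0 | lia].
Qed.

Lemma sum_remove_le (f : nat -> R) (k : nat) : (forall j, 0 <= f j) ->
  (forall j, ~~ (0 < j <= N)%N -> f j = 0) ->
  f k + sum_n (fun j => if j == k then 0 else f j) N <= sum_n f N.
Proof.
move=> h0 hout; case: (leqP k N) => hk; first by right; rewrite (sum_n_remove f N k).
rewrite hout; last lia.
rewrite (sum_n_ext_loc (fun j => if j == k then 0 else f j) f); first by lra.
by move=> j hj; rewrite ifF //; lia.
Qed.

Lemma four_modes_le1 (j1 j2 j3 j4 : nat) (t : R) :
  [&& j2 != j1, j3 != j1, j3 != j2, j4 != j1, j4 != j2 & j4 != j3] -> I j1 t + I j2 t + I j3 t + I j4 t <= 1.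
Proof.
move=> u.
rewrite -(orbit_mass _ _ _ orb t).
set f0 := fun j => I j t.
pose f1 j := if j == j1 then 0 else f0 j.
pose f2 j := if j == j2 then 0 else f1 j.
pose f3 j := if j == j3 then 0 else f2 j.
have p0 j : 0 <= f0 j by apply: orbit_ge0.
have p1 j : 0 <= f1 j by rewrite /f1; case: ifP => _; [lra | apply: p0].
have p2 j : 0 <= f2 j by rewrite /f2; case: ifP => _; [lra | apply: p1].
have p3 j : 0 <= f3 j by rewrite /f3; case: ifP => _; [lra | apply: p2].
have o0 j : ~~ (0 < j <= N)%N -> f0 j = 0 by apply: (orbit_out _ _ _ orb).
have o1 j : ~~ (0 < j <= N)%N -> f1 j = 0 by move=> h; rewrite /f1 o0 //; case: ifP.
have o2 j : ~~ (0 < j <= N)%N -> f2 j = 0 by move=> h; rewrite /f2 o1 //; case: ifP.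
have o3 j : ~~ (0 < j <= N)%N -> f3 j = 0 by move=> h; rewrite /f3 o2 //; case: ifP.
have s1 := sum_remove_le f0 j1 p0 o0; have s2 := sum_remove_le f1 j2 p1 o1.
have s3 := sum_remove_le f2 j3 p2 o2; have s4 := term_le_sum f3 j4 p3 o3.
have e2 : f1 j2 = I j2 t by rewrite /f1 ifF //; lia.
have e3 : f2 j3 = I j3 t by rewrite /f2 ifF /f1 ?ifF //; lia.
have e4 : f3 j4 = I j4 t by rewrite /f3 ifF /f2 ?ifF /f1 ?ifF //; lia.
rewrite e2 in s2; rewrite e3 in s3; rewrite e4 in s4.
have {}s1 : I j1 t + sum_n f1 N <= sum_n f0 N by exact: s1.
have {}s2 : I j2 t + sum_n f2 N <= sum_n f1 N by exact: s2.
have {}s3 : I j3 t + sum_n f3 N <= sum_n f2 N by exact: s3.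
lra.
Qed.

Lemma derive_gap (j : nat) (t : R) :
  is_derive (psi j.+1) t
    (2 * (I j.+1 t - I j.+2 t) * (1 + 2 * cos (psi j.+1 t))
     + 4 * I j.+3 t * cos (psi j.+2 t) - 4 * I j t * cos (psi j t)).
Proof.
evar_last.
  by apply: is_derive_minus; apply: (orbit_dphi _ _ _ orb).
by rewrite /minus /plus /opp /= /angle; ring.
Qed.

Lemma is_derive_mult_R (f g : R -> R) (t f' g' : R) :
  is_derive f t f' -> is_derive g t g' -> is_derive (fun s => f s * g s) t (f' * g t + f t * g').
Proof. by move=> hf hg; apply: is_derive_mult => // *; apply: Rmult_comm. Qed.

(** All terms that involve only the two modes cancel, since they would conserve
    [Q] alone; each term left contains a third, adjacent mode. *)
Lemma derive_coupling (j : nat) (t : R) :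
  is_derive (Q j.+1) t (I j.+1 t * I j.+2 t *
    ((1 + 2 * cos (psi j.+1 t)) * (4 * I j t * sin (psi j t) - 4 * I j.+3 t * sin (psi j.+2 t))
     - 8 * sin (psi j.+1 t) * (I j.+3 t * cos (psi j.+2 t) - I j t * cos (psi j t)))).
Proof.
evar_last.
  apply: is_derive_mult_R.
    by apply: is_derive_mult_R; apply: (orbit_dI _ _ _ orb).
  apply: is_derive_plus; first exact: is_derive_const.
  apply: is_derive_scal; apply: (is_derive_comp cos); first exact: is_derive_cos.
  exact: derive_gap.
rewrite /plus /zero /scal /= /mult /= -!/(psi _ _); ring.
Qed.

Lemma coupling_rate_le (j : nat) (t : R) :
  Rabs (I j.+1 t * I j.+2 t *
    ((1 + 2 * cos (psi j.+1 t)) * (4 * I j t * sin (psi j t) - 4 * I j.+3 t * sin (psi j.+2 t))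
     - 8 * sin (psi j.+1 t) * (I j.+3 t * cos (psi j.+2 t) - I j t * cos (psi j t))))
  <= 20 * (I j.+1 t * I j.+2 t) * (I j t + I j.+3 t).
Proof.
have h0 := orbit_ge0 j t; have h1 := orbit_ge0 j.+1 t.
have h2 := orbit_ge0 j.+2 t; have h3 := orbit_ge0 j.+3 t.
have hJ : 0 <= I j.+1 t * I j.+2 t by apply: Rmult_le_pos.
rewrite Rabs_mult (Rabs_pos_eq _ hJ).
suff h : Rabs ((1 + 2 * cos (psi j.+1 t)) * (4 * I j t * sin (psi j t) - 4 * I j.+3 t * sin (psi j.+2 t))
     - 8 * sin (psi j.+1 t) * (I j.+3 t * cos (psi j.+2 t) - I j t * cos (psi j t)))
     <= 20 * (I j t + I j.+3 t) by nra.
have a1 := Rabs_mult_le _ _ h0 (Rabs_sin_le1 (psi j t)).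
have a2 := Rabs_mult_le _ _ h3 (Rabs_sin_le1 (psi j.+2 t)).
have a3 := Rabs_mult_le _ _ h0 (Rabs_cos_le1 (psi j t)).
have a4 := Rabs_mult_le _ _ h3 (Rabs_cos_le1 (psi j.+2 t)).
apply: Rle_trans (Rabs_triang _ _) _; rewrite Rabs_Ropp Rabs_mult (Rmult_assoc 8) (Rabs_mult 8) (Rabs_mult (sin _)).
have b1 : Rabs (1 + 2 * cos (psi j.+1 t)) <= 3.
  by apply: Rabs_le; have := COS_bound (psi j.+1 t); lra.
have b2 : Rabs (4 * I j t * sin (psi j t) - 4 * I j.+3 t * sin (psi j.+2 t)) <= 4 * (I j t + I j.+3 t).
  by move/Rabs_le_between: a1 => a1; move/Rabs_le_between: a2 => a2; apply: Rabs_le; lra.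
have b3 : Rabs (I j.+3 t * cos (psi j.+2 t) - I j t * cos (psi j t)) <= I j t + I j.+3 t.
  by move/Rabs_le_between: a3 => a3; move/Rabs_le_between: a4 => a4; apply: Rabs_le; lra.
have b4 := Rabs_sin_le1 (psi j.+1 t).
rewrite (Rabs_pos_eq 8); last lra.

have c1 := Rmult_le_compat _ _ _ _ (Rabs_pos _) (Rabs_pos _) b1 b2.
have c2 := Rmult_le_compat _ _ _ _ (Rabs_pos _) (Rabs_pos _) b4 b3.
lra.
Qed.

(** With [J] the product of the two intensities, [4 J sin psi] is the rate of
    exchange of mass; eliminating the angle through [Q] shows that this rate is
    [rate * J] up to an error of the order of [Q]. *)
Lemma coupling_sin (j : nat) (t : R) :
  (4 * (I j t * I j.+1 t) * sin (psi j t)) ^ 2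
  = 12 * (I j t * I j.+1 t) ^ 2 + 8 * Q j t * (I j t * I j.+1 t) - 4 * Q j t ^ 2.
Proof.
rewrite /coupling; have := sin2_cos2 (psi j t); rewrite /Rsqr => e.
have -> : (4 * (I j t * I j.+1 t) * sin (psi j t)) ^ 2
   = 16 * (I j t * I j.+1 t) ^ 2 * (sin (psi j t) * sin (psi j t)) by ring.
have -> : sin (psi j t) * sin (psi j t) = 1 - cos (psi j t) * cos (psi j t) by lra.
ring.
Qed.

Lemma coupling_sin_upper (j : nat) (t : R) :
  4 * (I j t * I j.+1 t) * Rabs (sin (psi j t)) <= rate * (I j t * I j.+1 t) + 2 * Rabs (Q j t).
Proof.
have hJ : 0 <= I j t * I j.+1 t by apply: Rmult_le_pos; apply: orbit_ge0.
have := coupling_sin j t; have := rate_bounds; have := rate_sqr.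
set J := I j t * I j.+1 t in hJ *.
set S := Rabs (sin (psi j t)); set P := Rabs (Q j t).
have hS : 0 <= S by apply: Rabs_pos.
have hP : 0 <= P by apply: Rabs_pos.
have eS : S * S = sin (psi j t) * sin (psi j t) by rewrite -Rabs_mult Rabs_pos_eq //; nra.
have eP : P * P = Q j t * Q j t by rewrite -Rabs_mult Rabs_pos_eq //; nra.
have hQ : Q j t <= P by apply: Rle_abs.
move=> r1 r2 e.
apply: Rsqr_incr_0_var; last by nra.
rewrite /Rsqr.
have -> : 4 * J * S * (4 * J * S) = 16 * J ^ 2 * (S * S) by ring.
rewrite eS; have -> : 16 * J ^ 2 * (sin (psi j t) * sin (psi j t)) = (4 * J * sin (psi j t)) ^ 2 by ring.
rewrite e.
have : 0 <= J * P by apply: Rmult_le_pos.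
have -> : (rate * J + 2 * P) * (rate * J + 2 * P) = rate * rate * J ^ 2 + 4 * rate * (J * P) + 4 * (P * P) by ring.
rewrite r1 eP; nra.
Qed.

Lemma coupling_sin_lower (j : nat) (t : R) :
  rate * (I j t * I j.+1 t - Rabs (Q j t)) <= 4 * (I j t * I j.+1 t) * Rabs (sin (psi j t)).
Proof.
have hJ : 0 <= I j t * I j.+1 t by apply: Rmult_le_pos; apply: orbit_ge0.
have := coupling_sin j t; have := rate_bounds; have := rate_sqr.
set J := I j t * I j.+1 t in hJ *.
set S := Rabs (sin (psi j t)); set P := Rabs (Q j t).
have hS : 0 <= S by apply: Rabs_pos.
have hP : 0 <= P by apply: Rabs_pos.
have eS : S * S = sin (psi j t) * sin (psi j t) by rewrite -Rabs_mult Rabs_pos_eq //; nra.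
have eP : P * P = Q j t * Q j t by rewrite -Rabs_mult Rabs_pos_eq //; nra.
have hQ : - P <= Q j t by rewrite /P; have := Rle_abs (- Q j t); rewrite Rabs_Ropp; lra.
move=> r1 r2 e.
have hJS : 0 <= J * S by apply: Rmult_le_pos.
case: (Rle_lt_dec J P) => hJP; first by nra.
apply: Rsqr_incr_0_var; last by lra.
rewrite /Rsqr.
have -> : 4 * J * S * (4 * J * S) = 16 * J ^ 2 * (S * S) by ring.
rewrite eS; have -> : 16 * J ^ 2 * (sin (psi j t) * sin (psi j t)) = (4 * J * sin (psi j t)) ^ 2 by ring.
rewrite e.
have -> : rate * (J - P) * (rate * (J - P)) = rate * rate * (J - P) ^ 2 by ring.
rewrite r1; nra.
Qed.

End Orbit.

Lemma exp_le_exp (x y : R) : x <= y -> exp x <= exp y.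
Proof. by case/Rle_lt_or_eq_dec => [/exp_increasing|->]; lra. Qed.

(** * A stay near one circle *)

(** The mode [z + 2] dominates, [z + 1] is the mode it was fed by and [z + 3]
    the one it will feed. The modes behind are only required to be small; those
    ahead must also be bounded below, and their phases are bounded because the
    transport of curves compares phases of different states. *)
Record gate (N : nat) (L m : R) (z : nat) (J f : nat -> R) : Prop := {
  gate_ratio : J z.+2 = exp m * J z.+1;
  gate_rest : 1 - exp (- 2 * L + 10 * m) <= J z.+1 + J z.+2;
  gate_coupling : Rabs (J z.+1 * J z.+2 * (1 + 2 * cos (f z.+2 - f z.+1)))
                  <= exp (- 2 * L + 10 * m);
  gate_sin : 0 < sin (f z.+2 - f z.+1);
  gate_low : forall j, (z.+3 <= j <= N)%N -> exp (- 2 * L - 10 * m) <= J j;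
  gate_phase : forall j, (z.+3 <= j <= N)%N -> Rabs (f j) <= 10 * m }.

Lemma continuous_max (f g : R -> R) (t : R) :
  continuous f t -> continuous g t -> continuous (fun s => Rmax (f s) (g s)) t.
Proof.
move=> hf hg.
apply: (continuous_ext (fun s => (f s + g s + Rabs (f s - g s)) * / 2)).
  by move=> s; rewrite /Rmax /Rabs; case: Rle_dec; case: Rcase_abs; lra.
apply: (continuous_mult (fun s => f s + g s + Rabs (f s - g s)) (fun _ => / 2));
  last exact: continuous_const.
apply: (continuous_plus (fun s => f s + g s)); first exact: continuous_plus.
by apply: continuous_Rabs_comp; exact: (continuous_minus f g).
Qed.

(** In this section the modes [z], ..., [z + 4] are called Z, A, B, C, D. *)

Section Stage.

Context (N : nat) (I phi : nat -> R -> R) (orb : polar_orbit N I phi).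
Context (z : nat) (hz : (z.+3 <= N)%N) (L m : R).
Hypothesis m_big : 100 <= m.
Hypothesis L_big : 10000 * m <= L.
Hypothesis m_vs_L : 10000 * L * exp (- m) <= 1.
Hypothesis start : gate N L m z (fun j => I j 0) (fun j => phi j 0).

Local Notation psi := (angle phi).
Local Notation Q := (coupling I phi).
Local Notation IZ := (I z).
Local Notation IA := (I z.+1).
Local Notation IB := (I z.+2).
Local Notation IC := (I z.+3).
Local Notation ID := (I z.+4).
Local Notation E := (exp (- m)).
Local Notation G := (exp (- 2 * L + 12 * m)).

(** Total mass of all modes other than A, B, C; one function bounds them all,
    and mass enters it only through the pairs Z, A and C, D. *)
Definition rest (t : R) : R := 1 - IA t - IB t - IC t.

Definition dA (t : R) : R := 4 * IA t * (IZ t * sin (psi z t) - IB t * sin (psi z.+1 t)).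
Definition dB (t : R) : R := 4 * IB t * (IA t * sin (psi z.+1 t) - IC t * sin (psi z.+2 t)).
Definition dC (t : R) : R := 4 * IC t * (IB t * sin (psi z.+2 t) - ID t * sin (psi z.+3 t)).

Lemma is_derive_A t : is_derive IA t (dA t).
Proof. exact: (orbit_dI _ _ _ orb). Qed.
Lemma is_derive_B t : is_derive IB t (dB t).
Proof. exact: (orbit_dI _ _ _ orb). Qed.
Lemma is_derive_C t : is_derive IC t (dC t).
Proof. exact: (orbit_dI _ _ _ orb). Qed.

Definition drest (t : R) : R :=
  4 * IC t * ID t * sin (psi z.+3 t) - 4 * IA t * IZ t * sin (psi z t).

Lemma is_derive_rest t : is_derive rest t (drest t).
Proof.
evar_last.
  apply: is_derive_minus; last exact: is_derive_C.
  apply: is_derive_minus; last exact: is_derive_B.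
  by apply: is_derive_minus; [exact: is_derive_const | exact: is_derive_A].
by rewrite /minus /plus /opp /zero /= /dA /dB /dC /drest; ring.
Qed.

Lemma A_ge0 t : 0 <= IA t. Proof. exact: (orbit_ge0 _ _ _ orb). Qed.
Lemma B_ge0 t : 0 <= IB t. Proof. exact: (orbit_ge0 _ _ _ orb). Qed.
Lemma C_ge0 t : 0 <= IC t. Proof. exact: (orbit_ge0 _ _ _ orb). Qed.

Lemma other_le_rest (j : nat) (t : R) :
  [&& j != z.+1, j != z.+2 & j != z.+3] -> 0 <= I j t <= rest t.
Proof.
move=> h; split; first exact: (orbit_ge0 _ _ _ orb).
have := four_modes_le1 _ _ _ orb z.+1 z.+2 z.+3 j t; rewrite /rest => h4.
have := h4 ltac:(lia); lra.
Qed.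

Lemma Z_le_rest t : 0 <= IZ t <= rest t. Proof. by apply: other_le_rest; lia. Qed.
Lemma D_le_rest t : 0 <= ID t <= rest t. Proof. by apply: other_le_rest; lia. Qed.

Lemma rest_ge0 t : 0 <= rest t. Proof. have := Z_le_rest t; lra. Qed.

Lemma intensities_le1 t : [/\ IA t <= 1, IB t <= 1, IC t <= 1 & rest t <= 1].
Proof.
have := A_ge0 t; have := B_ge0 t; have := C_ge0 t; have := rest_ge0 t.
by rewrite /rest; split; lra.
Qed.

Lemma mode_mult_sin (j k : nat) (t : R) : Rabs (I j t * sin (psi k t)) <= I j t.
Proof. by apply: Rabs_mult_le; [exact: (orbit_ge0 _ _ _ orb) | exact: Rabs_sin_le1]. Qed.

Lemma drest_le t : Rabs (drest t) <= 4 * (IA t + IC t) * rest t.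
Proof.
have /Rabs_le_between h1 := mode_mult_sin z z t.
have /Rabs_le_between h2 := mode_mult_sin z.+4 z.+3 t.
have a := A_ge0 t; have c := C_ge0 t; have hZ := Z_le_rest t; have hD := D_le_rest t.
have -> : drest t = 4 * (IC t * (ID t * sin (psi z.+3 t)) - IA t * (IZ t * sin (psi z t))).
  by rewrite /drest; ring.
apply: Rabs_le; split; nra.
Qed.

Lemma dA_upper_crude t : dA t <= 4 * IA t.
Proof.
have /Rabs_le_between h1 := mode_mult_sin z z t.
have /Rabs_le_between h2 := mode_mult_sin z.+2 z.+1 t.
have a := A_ge0 t; have hZ := Z_le_rest t; have c := C_ge0 t.
have : IZ t + IB t <= 1 by move: hZ; rewrite /rest; lra.
rewrite /dA; nra.
Qed.

Lemma dA_lower t : - rate * IA t - 2 * Rabs (Q z.+1 t) - 4 * IA t * rest t <= dA t.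
Proof.
have /Rabs_le_between h1 := mode_mult_sin z z t.
have h2 := coupling_sin_upper _ _ _ orb z.+1 t.
have h3 := Rle_abs (sin (psi z.+1 t)).
have a := A_ge0 t; have b := B_ge0 t; have hZ := Z_le_rest t; have [_ b1 _ _] := intensities_le1 t.
have hab : 0 <= IA t * IB t by apply: Rmult_le_pos.
have r := rate_bounds.
have : IA t * IB t <= IA t by nra.
have : IA t * IB t * sin (psi z.+1 t) <= IA t * IB t * Rabs (sin (psi z.+1 t)) by nra.
have : - (IA t * rest t) <= IA t * (IZ t * sin (psi z t)) by nra.
rewrite /dA; nra.
Qed.

Lemma dA_upper t : 0 <= sin (psi z.+1 t) ->
  dA t <= - rate * (IA t * IB t - Rabs (Q z.+1 t)) + 4 * IA t * rest t.
Proof.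
move=> hs.
have /Rabs_le_between h1 := mode_mult_sin z z t.
have h2 := coupling_sin_lower _ _ _ orb z.+1 t.
rewrite (Rabs_pos_eq _ hs) in h2.
have a := A_ge0 t; have hZ := Z_le_rest t.
have : IA t * (IZ t * sin (psi z t)) <= IA t * rest t by nra.
rewrite /dA; nra.
Qed.

Lemma dC_upper t : dC t <= rate * IC t + 2 * Rabs (Q z.+2 t) + 4 * IC t * rest t.
Proof.
have /Rabs_le_between h1 := mode_mult_sin z.+4 z.+3 t.
have h2 := coupling_sin_upper _ _ _ orb z.+2 t.
have h3 := Rle_abs (sin (psi z.+2 t)).
have c := C_ge0 t; have b := B_ge0 t; have hD := D_le_rest t; have [_ b1 _ _] := intensities_le1 t.
have hbc : 0 <= IB t * IC t by apply: Rmult_le_pos.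
have r := rate_bounds.
have : IB t * IC t <= IC t by nra.
have : IB t * IC t * sin (psi z.+2 t) <= IB t * IC t * Rabs (sin (psi z.+2 t)) by nra.
have : - (IC t * rest t) <= IC t * (ID t * sin (psi z.+3 t)) by nra.
rewrite /dC; nra.
Qed.

Lemma dC_lower t : 0 <= sin (psi z.+2 t) ->
  rate * (IB t * IC t - Rabs (Q z.+2 t)) - 4 * IC t * rest t <= dC t.
Proof.
move=> hs.
have /Rabs_le_between h1 := mode_mult_sin z.+4 z.+3 t.
have h2 := coupling_sin_lower _ _ _ orb z.+2 t.
rewrite (Rabs_pos_eq _ hs) in h2.
have c := C_ge0 t; have hD := D_le_rest t.
have : IC t * (ID t * sin (psi z.+3 t)) <= IC t * rest t by nra.
rewrite /dC; nra.
Qed.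

Definition dQ (j : nat) (t : R) : R := I j.+1 t * I j.+2 t *
    ((1 + 2 * cos (psi j.+1 t)) * (4 * I j t * sin (psi j t) - 4 * I j.+3 t * sin (psi j.+2 t))
     - 8 * sin (psi j.+1 t) * (I j.+3 t * cos (psi j.+2 t) - I j t * cos (psi j t))).

Lemma is_derive_Q j t : is_derive (Q j.+1) t (dQ j t).
Proof. exact: (derive_coupling _ _ _ orb). Qed.

Lemma dQA_le t : Rabs (dQ z t) <= 20 * (IA t * rest t + IA t * IC t).
Proof.
apply: Rle_trans (coupling_rate_le _ _ _ orb z t) _.
have a := A_ge0 t; have b := B_ge0 t; have c := C_ge0 t; have hZ := Z_le_rest t.
have [_ b1 _ _] := intensities_le1 t.
have : IA t * IB t <= IA t by nra.
have : 0 <= IA t * IB t by apply: Rmult_le_pos.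
nra.
Qed.

Lemma dQB_le t : Rabs (dQ z.+1 t) <= 20 * (IC t * rest t + IA t * IC t).
Proof.
apply: Rle_trans (coupling_rate_le _ _ _ orb z.+1 t) _.
have a := A_ge0 t; have b := B_ge0 t; have c := C_ge0 t; have hD := D_le_rest t.
have [_ b1 _ _] := intensities_le1 t.
have : IB t * IC t <= IC t by nra.
have : 0 <= IB t * IC t by apply: Rmult_le_pos.
nra.
Qed.

Lemma continuous_Q j t : continuous (Q j.+1) t.
Proof. exact: derive_continuous (is_derive_Q j t). Qed.

Lemma continuous_rest t : continuous rest t.
Proof. exact: derive_continuous (is_derive_rest t). Qed.

Lemma continuous_sin_psi (j : nat) t : continuous (fun t => sin (psi j.+1 t)) t.
Proof.
apply: (derive_continuous _ _ _ (is_derive_comp sin (psi j.+1) t _ _ (is_derive_sin _) _)).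
exact: (derive_gap _ _ _ orb).
Qed.

Lemma exp_m_ge : 10000 * L <= exp m.
Proof.
have h : exp m * E = 1 by rewrite -exp_plus -exp_0; f_equal; ring.
have := exp_pos m; have := exp_pos (- m); nra.
Qed.

(** Numerical constants are absorbed by one factor [exp m]. *)
Lemma absorb (K x y : R) : K <= 10 ^ 10 -> x + m <= y -> K * exp x <= exp y.
Proof.
move=> hK h; apply: Rle_trans (exp_le_exp _ _ h).
rewrite exp_plus; have := exp_m_ge; have := exp_pos x; nra.
Qed.

Lemma E_bounds : 0 < E <= / 10 ^ 10.
Proof.
split; first exact: exp_pos.
have := absorb (10 ^ 10) (- m) 0 ltac:(lra) ltac:(lra); rewrite exp_0 => h.
apply: (Rmult_le_reg_l (10 ^ 10)); lra.
Qed.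

Lemma G_bounds : 0 < G /\ 1000 * G <= E.
Proof. by split; [exact: exp_pos | apply: absorb; lra]. Qed.

(** Chosen so that at growth rate [rate] the mode C, starting from about
    [exp (- 2 L + 12 m)], is still below [exp (- 3 m)] at the end, while A,
    decaying from [exp (- m)], still dominates the errors of that size. *)
Definition stay_time : R := (2 * L - 16 * m) / rate.

Lemma stay_time_bounds : 0.57 * L <= stay_time <= L.
Proof.
have r := rate_bounds; rewrite /stay_time.
have e : (2 * L - 16 * m) / rate * rate = 2 * L - 16 * m by field; lra.
set T := (2 * L - 16 * m) / rate in e *.
split; nra.
Qed.

Lemma rate_stay_time : rate * stay_time = 2 * L - 16 * m.
Proof. by have r := rate_bounds; rewrite /stay_time; field; lra. Qed.

Lemma gate_open0 : rest 0 + IC 0 <= exp (- 2 * L + 10 * m).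
Proof. by have := gate_rest _ _ _ _ _ _ start; rewrite /rest; lra. Qed.

Lemma A0_bounds : E / 3 <= IA 0 <= E.
Proof.
have h1 := gate_ratio _ _ _ _ _ _ start; have h2 := gate_rest _ _ _ _ _ _ start.
rewrite /= in h1 h2.
have h : exp m * E = 1 by rewrite -exp_plus -exp_0; f_equal; ring.
have e1 := exp_m_ge; have [e2 e3] := E_bounds.
have b := intensities_le1 0; case: b => _ b _ _.
have hg : 1000 * exp (- 2 * L + 10 * m) <= E by apply: absorb; lra.
have a : IA 0 = E * IB 0 by rewrite h1 -Rmult_assoc (Rmult_comm E) h; ring.
rewrite a in h2 *; split; nra.
Qed.

Lemma slow_initial : [/\ Rabs (Q z.+1 0) <= exp (- 2 * L + 10 * m),
  Rabs (Q z.+2 0) <= 3 * exp (- 2 * L + 10 * m) & rest 0 <= exp (- 2 * L + 10 * m)].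
Proof.
have qA : Rabs (Q z.+1 0) <= exp (- 2 * L + 10 * m) by exact: (gate_coupling _ _ _ _ _ _ start).
have qB : Rabs (Q z.+2 0) <= 3 * exp (- 2 * L + 10 * m).
  rewrite /coupling Rabs_mult.
  have b := B_ge0 0; have c := C_ge0 0; have [_ b1 _ _] := intensities_le1 0.
  rewrite Rabs_pos_eq; last by apply: Rmult_le_pos.
  have h3 : Rabs (1 + 2 * cos (psi z.+2 0)) <= 3.
    by apply: Rabs_le; have := COS_bound (psi z.+2 0); lra.
  have := gate_open0; have := rest_ge0 0; have := Rabs_pos (1 + 2 * cos (psi z.+2 0)) => p1 p2 p3.
  have : IB 0 * IC 0 <= exp (- 2 * L + 10 * m) by nra.
  have : 0 <= IB 0 * IC 0 by apply: Rmult_le_pos.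
  nra.
split=> //; have := gate_open0; have := C_ge0 0; lra.
Qed.

(** Up to a time [T] the slow quantities are assumed to have grown by a factor
    [exp (2 m)] at most; this is then improved to a strict inequality at [T]. *)
Section Bootstrap.

Context (T : R) (hT : 0 <= T <= stay_time).
Hypothesis slow : forall s, 0 <= s <= T ->
  [/\ Rabs (Q z.+1 s) <= G, Rabs (Q z.+2 s) <= G & rest s <= G].

Lemma C_growth t : 0 <= t <= T -> IC t <= 3 * G * exp (rate * t).
Proof.
move=> ht; have r := rate_bounds; have [g1 g2] := G_bounds.
have := gronwall_upper IC dC rate (2 * G) 0 t ltac:(lra) is_derive_C.
rewrite Rminus_0_r => h.
have : IC t + 2 * G <= (IC 0 + 2 * G) * exp (rate * t).
  apply: h => s hs.
  have [_ q o] := slow s ltac:(lra); have := dC_upper s; have := C_ge0 s.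
  have [_ _ c _] := intensities_le1 s; have := rest_ge0 s; nra.
have : exp (- 2 * L + 10 * m) <= G by apply: exp_le_exp; lra.
have := gate_open0; have := rest_ge0 0; have := exp_pos (rate * t); nra.
Qed.

Lemma exp_rate_le t : 0 <= t <= T -> exp (rate * t) <= exp (2 * L - 16 * m).
Proof.
by move=> ht; apply: exp_le_exp; have := rate_stay_time; have := rate_bounds; nra.
Qed.

Lemma C_small t : 0 <= t <= T -> IC t <= exp (- 3 * m).
Proof.
move=> ht; apply: Rle_trans (C_growth t ht) _.
have h := exp_rate_le t ht; have [g1 _] := G_bounds.
apply: (Rle_trans _ (3 * (G * exp (2 * L - 16 * m)))).
  by rewrite Rmult_assoc; apply: Rmult_le_compat_l; [lra | apply: Rmult_le_compat_l; lra].
by rewrite -exp_plus; apply: absorb; lra.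
Qed.

Lemma A_stays_large t : 0 <= t <= T -> 10 * G <= IA t.
Proof.
move=> ht; have r := rate_bounds; have [g1 g2] := G_bounds.
have := gronwall_lower IA dA (- rate) (2 * G) 0 t ltac:(lra) is_derive_A.
rewrite Rminus_0_r => h.
have {}h : (IA 0 + 2 * G) * exp (- rate * t) <= IA t + 2 * G.
  apply: h => s hs.
  have [q _ o] := slow s ltac:(lra); have := dA_lower s; have := A_ge0 s.
  have [a _ _ _] := intensities_le1 s; have := rest_ge0 s; nra.
have h2 : exp (- 2 * L + 16 * m) <= exp (- rate * t).
  by apply: exp_le_exp; have := rate_stay_time; nra.
have h3 : 100 * G <= E * exp (- 2 * L + 16 * m) by rewrite -exp_plus; apply: absorb; lra.
have [a0 _] := A0_bounds; have y0 := exp_pos (- 2 * L + 16 * m).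
have : E / 3 * exp (- 2 * L + 16 * m) <= (IA 0 + 2 * G) * exp (- rate * t).
  by apply: Rmult_le_compat; have := exp_pos (- m); lra.
lra.
Qed.

Lemma sin_zero_small_coupling (j : nat) t : sin (psi j t) = 0 ->
  I j t * I j.+1 t <= Rabs (Q j t).
Proof.
move=> e; have := coupling_sin_lower _ _ _ orb j t.
by rewrite e Rabs_R0 Rmult_0_r; have := rate_bounds; nra.
Qed.

(** The sign of [sin psi] is not known in advance: the bound is proved while it
    is nonnegative, and [forward_A] then excludes a change of sign, which would
    force [I_A I_B] below [Q]. *)
Lemma A_small_while_forward t : 0 <= t <= T ->
  (forall s, 0 <= s <= t -> 0 <= sin (psi z.+1 s)) -> IA t <= 2 * E.
Proof.
move=> ht hs; have [g1 g2] := G_bounds; have r := rate_bounds.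
have := derive_le_upper IA dA (8 * G) 0 t ltac:(lra) is_derive_A.
have hb s : 0 <= s <= t -> dA s <= 8 * G.
  move=> hst; have := dA_upper s (hs s hst).
  have [q _ o] := slow s ltac:(lra); have := A_ge0 s; have := B_ge0 s.
  have [a _ _ _] := intensities_le1 s; have := rest_ge0 s.
  move=> o0 b0 a0; have : 0 <= IA s * IB s by apply: Rmult_le_pos.
  nra.
move=> /(_ hb) h.
have := A0_bounds.
have : 8 * G * (t - 0) <= E.
  have : 10000 * L * G <= E.
    apply: (Rle_trans _ (exp m * G)); last by rewrite -exp_plus; apply: exp_le_exp; lra.
    by apply: Rmult_le_compat_r; have := exp_m_ge; lra.
  by have := stay_time_bounds; nra.
lra.
Qed.

Lemma B_large_of_A t : 0 <= t <= T -> IA t <= 2 * E -> 1 - 3 * E <= IB t.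
Proof.
move=> ht ha; have [_ _ o] := slow t ht; have := C_small t ht.
have : 4 * exp (- 3 * m) <= E by apply: absorb; lra.
have [g1 g2] := G_bounds; move: o; rewrite /rest; lra.
Qed.

Lemma forward_A t : 0 <= t <= T -> 0 < sin (psi z.+1 t).
Proof.
move=> ht; case: (Rlt_le_dec 0 (sin (psi z.+1 t))) => // hneg; exfalso.
have hc s : continuous (fun s => - sin (psi z.+1 s)) s.
  by apply: continuous_opp; apply: continuous_sin_psi.
have h0 := gate_sin _ _ _ _ _ _ start.
have [||s [hs [e hb]]] := first_hitting (fun s => - sin (psi z.+1 s)) 0 0 t hc ltac:(lra).
- by rewrite /angle; lra.
- by lra.
have a : IA s <= 2 * E.
  apply: A_small_while_forward => [|r hr]; first lra.
  by case: (Rlt_le_dec r s) => hrs; [have := hb r; lra | (have -> : r = s by lra); lra].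
have b := B_large_of_A s ltac:(lra) a.
have a2 := A_stays_large s ltac:(lra).
have [q _ _] := slow s ltac:(lra).
have := sin_zero_small_coupling z.+1 s ltac:(lra).
have := E_bounds; have := G_bounds; nra.
Qed.

Lemma A_small t : 0 <= t <= T -> IA t <= 2 * E.
Proof.
by move=> ht; apply: A_small_while_forward => // s hs; left; apply: forward_A; lra.
Qed.

Lemma B_large t : 0 <= t <= T -> 1 - 3 * E <= IB t.
Proof. by move=> ht; apply: B_large_of_A => //; apply: A_small. Qed.

Lemma A_decay t : 0 <= t <= T -> IA t <= 2 * E * exp (- rate * t) + 3 * G.
Proof.
move=> ht; have r := rate_bounds; have [g1 g2] := G_bounds; have [e1 e2] := E_bounds.
set r' := rate * (1 - 3 * E).
have := gronwall_upper IA dA (- r') (- 3 * G) 0 t ltac:(lra) is_derive_A.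
rewrite Rminus_0_r => h.
have {}h : IA t + - 3 * G <= (IA 0 + - 3 * G) * exp (- r' * t).
  apply: h => s hs.
  have := dA_upper s ltac:(left; apply: forward_A; lra).
  have [q _ o] := slow s ltac:(lra); have a := A_ge0 s.
  have b := B_large s ltac:(lra); have o0 := rest_ge0 s; have a2 := A_small s ltac:(lra).
  have pB : IA s * (1 - 3 * E) <= IA s * IB s by apply: Rmult_le_compat_l.
  have [a1 _ _ _] := intensities_le1 s.
  have p0 : IA s * rest s <= 1 * G by apply: Rmult_le_compat.
  have p1 : rate * (IA s * (1 - 3 * E) - G) <= rate * (IA s * IB s - Rabs (Q z.+1 s)).
    by apply: Rmult_le_compat_l; lra.
  have p2 : 3.4 * G <= r' * G by apply: Rmult_le_compat_r; rewrite /r'; nra.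
  have p3 : rate * G <= 3.47 * G by apply: Rmult_le_compat_r; lra.
  have -> : - r' * (IA s + -3 * G) = - (rate * (IA s * (1 - 3 * E) - G)) - rate * G + 3 * (r' * G).
    by rewrite /r'; ring.
  lra.
have h2 : exp (- r' * t) <= 2 * exp (- rate * t).
  have -> : - r' * t = 3 * rate * E * t + - rate * t by rewrite /r'; ring.
  rewrite exp_plus; apply: Rmult_le_compat_r; first by left; apply: exp_pos.
  have h3 : 3 * rate * E * t <= / 2.
    have p0 : 0 <= E * t by apply: Rmult_le_pos; lra.
    have p1 : E * t <= E * L by apply: Rmult_le_compat_l; have := stay_time_bounds; lra.
    have p2 : rate * (E * t) <= 3.47 * (E * t) by apply: Rmult_le_compat_r; lra.
    lra.
  apply: Rle_trans (exp_le_exp _ _ h3) _.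
  have hh : exp (/ 2) * exp (/ 2) = exp 1 by rewrite -exp_plus; f_equal; lra.
  have := exp_le_3; have := exp_pos (/ 2); nra.
have := A0_bounds; have := exp_pos (- rate * t); have := exp_pos (- r' * t); nra.
Qed.

(** The decay of A compensates the growth of C, since both have the same
    exponential rate; only the small initial value of A remains as a gain. *)
Lemma AC_product t : 0 <= t <= T -> IA t * IC t <= 7 * E * G.
Proof.
move=> ht; have c1 := C_growth t ht; have c2 := C_small t ht; have a := A_decay t ht.
have c0 := C_ge0 t; have [g1 g2] := G_bounds; have [e1 e2] := E_bounds.
have : 4 * exp (- 3 * m) <= E by apply: absorb; lra.
have e : exp (- rate * t) * exp (rate * t) = 1 by rewrite -exp_plus -exp_0; f_equal; ring.
have p := exp_pos (- rate * t).
have : exp (- rate * t) * IC t <= 3 * G by nra.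
nra.
Qed.

(** All derivatives are at most [200 exp (- m) G], and the stay is shorter than
    [L], which is small against [exp m]. *)
Lemma slow_strict : [/\ Rabs (Q z.+1 T) < G, Rabs (Q z.+2 T) < G & rest T < G].
Proof.
have [g1 g2] := G_bounds; have [e1 e2] := E_bounds.
have g : 10 * exp (- 2 * L + 10 * m) <= G by apply: absorb; lra.
have hE : 10000 * (E * T) <= 1 by have := stay_time_bounds; have := exp_pos (- m); nra.
have cE : 4 * exp (- 3 * m) <= E by apply: absorb; lra.
have hA : Rabs (Q z.+1 T - Q z.+1 0) <= (200 * E * G) * (T - 0).
  apply: (derive_abs_le _ (dQ z)) => [|t|t ht]; [lra|exact: is_derive_Q|].
  have := dQA_le t; have := AC_product t ht; have := A_small t ht; have [_ _ o] := slow t ht.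
  by have := rest_ge0 t; have := A_ge0 t; nra.
have hB : Rabs (Q z.+2 T - Q z.+2 0) <= (200 * E * G) * (T - 0).
  apply: (derive_abs_le _ (dQ z.+1)) => [|t|t ht]; [lra|exact: is_derive_Q|].
  have := dQB_le t; have := AC_product t ht; have := C_small t ht; have [_ _ o] := slow t ht.
  by have := rest_ge0 t; have := C_ge0 t; nra.
have hR : Rabs (rest T - rest 0) <= (200 * E * G) * (T - 0).
  apply: (derive_abs_le _ drest) => [|t|t ht]; [lra|exact: is_derive_rest|].
  have := drest_le t; have := A_small t ht; have := C_small t ht; have [_ _ o] := slow t ht.
  by have := rest_ge0 t; have := A_ge0 t; have := C_ge0 t; nra.
have small : 200 * E * G * (T - 0) <= G / 2 by nra.
have [qA qB _] := slow_initial.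
have tri u v : Rabs u <= Rabs (u - v) + Rabs v.
  by have := Rabs_triang (u - v) v; rewrite (_ : u - v + v = u) //; ring.
split.
- by have := tri (Q z.+1 T) (Q z.+1 0); lra.
- by have := tri (Q z.+2 T) (Q z.+2 0); lra.
- by have := tri (rest T) (rest 0); have := gate_open0; have := C_ge0 0;
     have := Rle_abs (rest T); rewrite (Rabs_pos_eq (rest 0)); [lra | exact: rest_ge0].
Qed.

End Bootstrap.

Lemma slow_stay t : 0 <= t <= stay_time ->
  [/\ Rabs (Q z.+1 t) <= G, Rabs (Q z.+2 t) <= G & rest t <= G].
Proof.
pose f t := Rmax (Rabs (Q z.+1 t)) (Rmax (Rabs (Q z.+2 t)) (rest t)).
have le_f s c : (f s <= c) <-> [/\ Rabs (Q z.+1 s) <= c, Rabs (Q z.+2 s) <= c & rest s <= c].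
  rewrite /f; split=> [h|[h1 h2 h3]]; last by do 2?apply: Rmax_lub.
  have a1 := Rmax_l (Rabs (Q z.+1 s)) (Rmax (Rabs (Q z.+2 s)) (rest s)).
  have a2 := Rmax_r (Rabs (Q z.+1 s)) (Rmax (Rabs (Q z.+2 s)) (rest s)).
  have a3 := Rmax_l (Rabs (Q z.+2 s)) (rest s); have a4 := Rmax_r (Rabs (Q z.+2 s)) (rest s).
  by split; lra.
have step s : 0 <= s <= stay_time -> (forall r, 0 <= r <= s -> f r <= G) -> f s < G.
  move=> hs h; have [h1 h2 h3] := slow_strict s hs (fun r hr => proj1 (le_f r G) (h r hr)).
  by rewrite /f; do 2?apply: Rmax_lub_lt.
have fc s : continuous f s.
  rewrite /f; apply: continuous_max; first by apply: continuous_Rabs_comp; exact: continuous_Q.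
  apply: continuous_max; first by apply: continuous_Rabs_comp; exact: continuous_Q.
  exact: continuous_rest.
have f0 : f 0 < G.
  have [h1 h2 h3] := slow_initial.
  have g : 10 * exp (- 2 * L + 10 * m) <= G by apply: absorb; lra.
  have gp := exp_pos (- 2 * L + 10 * m).
  by rewrite /f; do 2?apply: Rmax_lub_lt; lra.
by move=> ht; apply/le_f; left; apply: (continuous_induction_lt f G 0 stay_time).
Qed.

Lemma stay_ge0 : 0 <= stay_time.
Proof. by have := stay_time_bounds; lra. Qed.

Lemma stay_end_A : IA stay_time <= exp (- 2 * L + 16 * m).
Proof.
have h := A_decay stay_time (conj stay_ge0 (Rle_refl _)) slow_stay stay_time (conj stay_ge0 (Rle_refl _)).
apply: Rle_trans h _.
have -> : - rate * stay_time = - 2 * L + 16 * m by have := rate_stay_time; lra.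
have h1 : 10 * (E * exp (- 2 * L + 16 * m)) <= exp (- 2 * L + 16 * m).
  have := E_bounds; have := exp_pos (- 2 * L + 16 * m); nra.
have : 10 * G <= exp (- 2 * L + 16 * m) by apply: absorb; lra.
have := exp_pos (- 2 * L + 16 * m); lra.
Qed.

(** After the stay, the exponential rates are not needed any more: over a time
    [240 m] the crude rate [4] costs a factor [exp (960 m)], which the tolerance
    [10 * 100 m] of the next gate allows. A favourable orbit starts the transfer
    with logarithmic ratio at least [- 49 m] and slope at least [3], hence
    reaches the exit value [100 m] within [50 m]. The difference [190 m] exceeds
    what the uncontrolled phases can undo. *)
Definition late_time : R := stay_time + 240 * m.
Definition early_exit_time : R := stay_time + 50 * m.

Local Notation G' := (exp (- 2 * L + 978 * m)).

Lemma late_A t : stay_time <= t <= late_time -> IA t <= exp (- 2 * L + 976 * m).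
Proof.
rewrite /late_time => ht.
have := gronwall_upper IA dA 4 0 stay_time t ltac:(lra) is_derive_A.
rewrite !Rplus_0_r => h.
apply: Rle_trans (h _) _; first by move=> s _; have := dA_upper_crude s; lra.
have -> : exp (- 2 * L + 976 * m) = exp (- 2 * L + 16 * m) * exp (960 * m).
  by rewrite -exp_plus; f_equal; ring.
apply: Rmult_le_compat; [exact: A_ge0 | by left; apply: exp_pos | exact: stay_end_A |].
by apply: exp_le_exp; lra.
Qed.

Lemma late_rest t : stay_time <= t <= late_time -> rest t <= exp (- 2 * L + 972 * m).
Proof.
rewrite /late_time => ht.
have := gronwall_upper rest drest 4 0 stay_time t ltac:(lra) is_derive_rest.
rewrite !Rplus_0_r => h.
apply: Rle_trans (h _) _.
  move=> s _; have := Rle_trans _ _ _ (Rle_abs _) (drest_le s); have := rest_ge0 s.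
  have : IA s + IC s <= 1 by have := B_ge0 s; have := rest_ge0 s; rewrite /rest; lra.
  by have := A_ge0 s; have := C_ge0 s; nra.
have -> : exp (- 2 * L + 972 * m) = G * exp (960 * m).
  by rewrite -exp_plus; f_equal; ring.
have [_ _ o] := slow_stay stay_time (conj stay_ge0 (Rle_refl _)).
apply: Rmult_le_compat; [exact: rest_ge0 | by left; apply: exp_pos | exact: o |].
by apply: exp_le_exp; lra.
Qed.

Lemma late_coupling t : stay_time <= t <= late_time -> Rabs (Q z.+2 t) <= G'.
Proof.
rewrite /late_time => ht.
have hd : Rabs (Q z.+2 t - Q z.+2 stay_time) <= 40 * exp (- 2 * L + 976 * m) * (t - stay_time).
  apply: (derive_abs_le _ (dQ z.+1)) => [|s|s hs]; [lra|exact: is_derive_Q|].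
  have hs' : stay_time <= s <= late_time by rewrite /late_time; lra.
  have := dQB_le s; have := late_A s hs'; have := late_rest s hs'.
  have : exp (- 2 * L + 972 * m) <= exp (- 2 * L + 976 * m) by apply: exp_le_exp; lra.
  have [_ _ c _] := intensities_le1 s; have := C_ge0 s; have := A_ge0 s; have := rest_ge0 s.
  nra.
have [_ q _] := slow_stay stay_time (conj stay_ge0 (Rle_refl _)).
have tri : Rabs (Q z.+2 t) <= Rabs (Q z.+2 t - Q z.+2 stay_time) + Rabs (Q z.+2 stay_time).
  have := Rabs_triang (Q z.+2 t - Q z.+2 stay_time) (Q z.+2 stay_time).
  by rewrite (_ : Q z.+2 t - Q z.+2 stay_time + Q z.+2 stay_time = Q z.+2 t) //; ring.
have h1 : 40 * exp (- 2 * L + 976 * m) * (t - stay_time) <= exp (- 2 * L + 977 * m).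
  have -> : exp (- 2 * L + 977 * m) = exp (- 2 * L + 976 * m) * exp m by rewrite -exp_plus; f_equal; ring.
  have := exp_pos (- 2 * L + 976 * m); have := exp_m_ge; nra.
have h2 : 2 * exp (- 2 * L + 977 * m) <= G' by apply: absorb; lra.
have h3 : G <= exp (- 2 * L + 977 * m) by apply: exp_le_exp; lra.
lra.
Qed.

Lemma stay_le_late : stay_time <= early_exit_time <= late_time /\ late_time <= 1.03 * L.
Proof. by have := stay_time_bounds; rewrite /early_exit_time /late_time; lra. Qed.

Lemma A_le t : 0 <= t <= late_time -> IA t <= 2 * E.
Proof.
move=> ht; case: (Rle_lt_dec t stay_time) => h.
  by apply: (A_small stay_time (conj stay_ge0 (Rle_refl _)) slow_stay); lra.
apply: Rle_trans (late_A t ltac:(lra)) _.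
have : exp (- 2 * L + 976 * m) <= E by apply: exp_le_exp; lra.
have := exp_pos (- m); lra.
Qed.

Lemma rest_le t : 0 <= t <= late_time -> rest t <= E.
Proof.
move=> ht; case: (Rle_lt_dec t stay_time) => h.
  by have [_ _ o] := slow_stay t ltac:(lra); have := G_bounds; lra.
by apply: Rle_trans (late_rest t ltac:(lra)) _; apply: exp_le_exp; lra.
Qed.

(** * The transfer from one mode to the next *)

Definition log_ratio (t : R) : R := ln (IC t) - ln (IB t).

Definition dlog_ratio (t : R) : R :=
  4 * (IB t + IC t) * sin (psi z.+2 t) - 4 * (ID t * sin (psi z.+3 t)) - 4 * (IA t * sin (psi z.+1 t)).

Lemma B_gt0 t : 0 < IB t. Proof. by apply: (orbit_pos _ _ _ orb); lia. Qed.
Lemma C_gt0 t : 0 < IC t. Proof. by apply: (orbit_pos _ _ _ orb); lia. Qed.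

Lemma is_derive_ln_comp (f : R -> R) (t f' : R) : 0 < f t -> is_derive f t f' ->
  is_derive (fun s => ln (f s)) t (f' / f t).
Proof.
move=> hf hd; evar_last.
  by apply: (is_derive_comp ln); [exact: is_derive_ln | exact: hd].
by rewrite /scal /= /mult /=.
Qed.

Lemma is_derive_log_ratio t : is_derive log_ratio t (dlog_ratio t).
Proof.
have b := B_gt0 t; have c := C_gt0 t.
evar_last.
  by apply: is_derive_minus; apply: is_derive_ln_comp; [exact: c | exact: is_derive_C
    | exact: b | exact: is_derive_B].
by rewrite /minus /plus /opp /= /dB /dC /dlog_ratio; field; lra.
Qed.

Lemma dlog_ratio_abs t : Rabs (dlog_ratio t) <= 4.
Proof.
have /Rabs_le_between h1 := mode_mult_sin z.+1 z.+1 t.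
have /Rabs_le_between h2 := mode_mult_sin z.+4 z.+3 t.
have /Rabs_le_between h3 := mode_mult_sin z.+2 z.+2 t.
have /Rabs_le_between h4 := mode_mult_sin z.+3 z.+2 t.
have := D_le_rest t; rewrite /rest => hD.
by apply: Rabs_le; rewrite /dlog_ratio; lra.
Qed.

Lemma C_of_log_ratio t : IC t = exp (log_ratio t) * IB t.
Proof.
have b := B_gt0 t; have c := C_gt0 t.
by rewrite /log_ratio exp_plus exp_Ropp !exp_ln //; field; lra.
Qed.

Lemma BC_sum t : 0 <= t <= late_time -> 1 - 3 * E <= IB t + IC t.
Proof. by move=> ht; have := A_le t ht; have := rest_le t ht; rewrite /rest; lra. Qed.

Lemma BC_product_large t : 0 <= t <= late_time -> Rabs (log_ratio t) <= 1100 * m ->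
  exp (- 1101 * m) <= IB t * IC t.
Proof.
move=> ht /Rabs_le_between hr.
have s := BC_sum t ht; have [e1 e2] := E_bounds.
have b := B_gt0 t; have c := C_gt0 t; have [_ b1 c1 _] := intensities_le1 t.
have e := C_of_log_ratio t.
have e' : IB t = exp (- log_ratio t) * IC t.
  by rewrite e -Rmult_assoc -exp_plus (_ : - log_ratio t + log_ratio t = 0) ?exp_0; ring.
have h : 100 * exp (- 1101 * m) <= exp (- 1100 * m) by apply: absorb; lra.
have p := exp_pos (- 1100 * m).
case: (Rle_lt_dec (IB t) (IC t)) => hbc.
  have h1 : exp (- 1100 * m) <= exp (- log_ratio t) by apply: exp_le_exp; lra.
  have : exp (- 1100 * m) * (/ 4 * / 4) <= IB t * IC t.
    rewrite {1}e' Rmult_assoc; apply: Rmult_le_compat; nra.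
  lra.
have h1 : exp (- 1100 * m) <= exp (log_ratio t) by apply: exp_le_exp; lra.
have : exp (- 1100 * m) * (/ 4 * / 4) <= IB t * IC t.
  rewrite e (Rmult_comm (IB t)) Rmult_assoc; apply: Rmult_le_compat; nra.
lra.
Qed.

(** As long as neither of the two modes is negligible, the coupling is so small
    that the angle between them is pinned to one of its two equilibria. *)
Lemma pinned_angle t : stay_time <= t <= late_time -> Rabs (log_ratio t) <= 1100 * m ->
  0.86 <= Rabs (sin (psi z.+2 t)) /\ Rabs (1 + 2 * cos (psi z.+2 t)) <= E.
Proof.
move=> ht hr; have hJ := BC_product_large t ltac:(have := stay_ge0; lra) hr.
have hq := late_coupling t ht.
have qJ : Rabs (Q z.+2 t) <= E * (IB t * IC t).
  apply: Rle_trans hq _; apply: (Rle_trans _ (E * exp (- 1101 * m))).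
    by rewrite -exp_plus; apply: exp_le_exp; lra.
  by apply: Rmult_le_compat_l => //; left; apply: exp_pos.
have p := exp_pos (- 1101 * m).
have [e1 e2] := E_bounds; have r := rate_bounds.
split.
  have h := coupling_sin_lower _ _ _ orb z.+2 t.
  have S0 := Rabs_pos (sin (psi z.+2 t)).
  apply: (Rmult_le_reg_l (4 * (IB t * IC t))); first by lra.
  apply: Rle_trans h.
  have : rate * (0.999 * (IB t * IC t)) <= rate * (IB t * IC t - Rabs (Q z.+2 t)).
    by apply: Rmult_le_compat_l; nra.
  have : 3.46 * (IB t * IC t) <= rate * (IB t * IC t) by apply: Rmult_le_compat_r; lra.
  lra.
apply: (Rmult_le_reg_l (IB t * IC t)); first lra.
rewrite (Rmult_comm _ E); apply: Rle_trans qJ.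
by rewrite /coupling (Rabs_mult (IB t * IC t)) (Rabs_pos_eq (IB t * IC t)); lra.
Qed.

Lemma log_ratio_drift (s t : R) : s <= t -> Rabs (log_ratio t - log_ratio s) <= 4 * (t - s).
Proof.
move=> h; apply: (derive_abs_le _ dlog_ratio) => // [r|r _].
  exact: is_derive_log_ratio.
exact: dlog_ratio_abs.
Qed.

Lemma transfer_onset (t0 : R) : stay_time <= t0 <= late_time ->
  Rabs (log_ratio t0) <= 49 * m -> 0 < sin (psi z.+2 t0) ->
  forall t, t0 <= t <= late_time ->
  [/\ 0 < sin (psi z.+2 t), Rabs (log_ratio t) <= 1100 * m & 3 <= dlog_ratio t].
Proof.
move=> ht0 /Rabs_le_between hr hs.
have big t : t0 <= t <= late_time -> Rabs (log_ratio t) <= 1100 * m.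
  move=> ht; have /Rabs_le_between := log_ratio_drift t0 t ltac:(lra).
  by move=> hd; apply: Rabs_le; move: ht ht0; rewrite /late_time; lra.
have pos : forall t, t0 <= t <= late_time -> 0 < sin (psi z.+2 t).
  apply: (positive_of_no_zero (fun t => sin (psi z.+2 t))) => // [t|t ht].
    exact: continuous_sin_psi.
  have [h _] := pinned_angle t ltac:(lra) (big t ht) => e.
  by move: h; rewrite e Rabs_R0; lra.
move=> t ht; split; [exact: pos | exact: big |].
have [h _] := pinned_angle t ltac:(lra) (big t ht).
rewrite Rabs_pos_eq in h; last by left; apply: pos.
have ht' : 0 <= t <= late_time by have := stay_ge0; lra.
have := BC_sum t ht'; have := A_le t ht'; have := rest_le t ht'; have := E_bounds.
have /Rabs_le_between := mode_mult_sin z.+1 z.+1 t.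
have /Rabs_le_between := mode_mult_sin z.+4 z.+3 t.
have := D_le_rest t; rewrite /dlog_ratio => hD h2 h1 [e1 e2] o a bc.
have : 0.86 * (IB t + IC t) <= (IB t + IC t) * sin (psi z.+2 t).
  by rewrite Rmult_comm; apply: Rmult_le_compat_l; lra.
lra.
Qed.

Lemma transfer_growth (t0 s t : R) : stay_time <= t0 <= late_time ->
  Rabs (log_ratio t0) <= 49 * m -> 0 < sin (psi z.+2 t0) ->
  t0 <= s -> s <= t -> t <= late_time -> log_ratio s + 3 * (t - s) <= log_ratio t.
Proof.
move=> h0 hr hs h1 h2 h3.
apply: (derive_ge_lower _ dlog_ratio) => // [r|r h]; first exact: is_derive_log_ratio.
by have [_ _] := transfer_onset t0 h0 hr hs r ltac:(lra).
Qed.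

Lemma C_le_exp_log_ratio t : IC t <= exp (log_ratio t).
Proof.
rewrite C_of_log_ratio; have [_ b _ _] := intensities_le1 t; have := exp_pos (log_ratio t).
have := B_gt0 t; nra.
Qed.

Lemma C_small_stay t : 0 <= t <= stay_time -> IC t <= exp (- 3 * m).
Proof. by move=> ht; apply: (C_small stay_time (conj stay_ge0 (Rle_refl _)) slow_stay). Qed.

Lemma B_large_stay t : 0 <= t <= stay_time -> 1 - 3 * E <= IB t.
Proof. by move=> ht; apply: (B_large stay_time (conj stay_ge0 (Rle_refl _)) slow_stay). Qed.

Lemma log_ratio_stay : log_ratio stay_time < - 2 * m.
Proof.
have hs := conj stay_ge0 (Rle_refl stay_time).
have c := C_small_stay stay_time hs; have b := B_large_stay stay_time hs.
have [e1 e2] := E_bounds.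
apply: exp_lt_inv.
have e := C_of_log_ratio stay_time.
have h : 100 * exp (- 3 * m) <= exp (- 2 * m) by apply: absorb; lra.
have := exp_pos (log_ratio stay_time); have := exp_pos (- 3 * m); nra.
Qed.

(** The ratio has to cross the level [- 2 m], where the angle is already pinned;
    at the first crossing the ratio does not decrease, which selects the
    expanding one of the two pinned angles. *)
Lemma transfer_start : 100 * m <= log_ratio late_time ->
  exists ta, [/\ stay_time <= ta <= late_time, log_ratio ta = - 2 * m,
    0 < sin (psi z.+2 ta) & forall t, stay_time <= t <= ta -> log_ratio t <= - 2 * m].
Proof.
move=> hl; have [hse hl2] := stay_le_late.
have cl t : continuous log_ratio t := derive_continuous _ _ _ (is_derive_log_ratio t).
have [||ta [ha [e hb]]] := first_hitting log_ratio (- 2 * m) stay_time late_time cl ltac:(lra).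
- exact: log_ratio_stay.
- lra.
exists ta; split=> //; first lra; last first.
  move=> t ht; case: (Rlt_le_dec t ta) => h; first by have := hb t; lra.
  by (have -> : t = ta by lra); lra.
have hd : 0 <= dlog_ratio ta.
  apply: (derive_first_hitting_ge0 log_ratio _ stay_time ta); [lra|exact: is_derive_log_ratio|].
  by move=> t ht; rewrite e; apply: hb; lra.
have [p _] := pinned_angle ta ltac:(lra) ltac:(rewrite e Rabs_left; lra).
case: (Rlt_le_dec 0 (sin (psi z.+2 ta))) => // hn; exfalso.
rewrite Rabs_left1 // in p.
have ht' : 0 <= ta <= late_time by have := stay_ge0; lra.
have := BC_sum ta ht'; have := A_le ta ht'; have := rest_le ta ht'; have := E_bounds.
have /Rabs_le_between := mode_mult_sin z.+1 z.+1 ta.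
have /Rabs_le_between := mode_mult_sin z.+4 z.+3 ta.
have := D_le_rest ta; move: hd; rewrite /dlog_ratio => hd hD h2 h1 [e1 e2] o a bc.
have : (IB ta + IC ta) * sin (psi z.+2 ta) <= (IB ta + IC ta) * - 0.86.
  by apply: Rmult_le_compat_l; lra.
lra.
Qed.

Lemma transferred_pinned : 100 * m <= log_ratio late_time ->
  Rabs (1 + 2 * cos (psi z.+2 late_time)) <= E.
Proof.
move=> hl; have [ta [ha ea hs hb]] := transfer_start hl.
have hr : Rabs (log_ratio ta) <= 49 * m by rewrite ea Rabs_left; lra.
have [_ h _] := transfer_onset ta ha hr hs late_time ltac:(lra).
by have [] := pinned_angle late_time ltac:(lra) h.
Qed.

Lemma exit_unique (tau t : R) : 100 * m <= log_ratio late_time ->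
  stay_time <= tau <= late_time -> log_ratio tau = 100 * m -> stay_time <= t <= late_time ->
  (t < tau -> log_ratio t < 100 * m) /\ (tau < t -> 100 * m < log_ratio t).
Proof.
move=> hl htau e ht.
have [ta [ha ea hs hb]] := transfer_start hl.
have hr : Rabs (log_ratio ta) <= 49 * m by rewrite ea Rabs_left; lra.
have htau2 : ta < tau.
  by case: (Rlt_le_dec ta tau) => // h; have := hb tau ltac:(lra); lra.
split=> h.
  case: (Rle_lt_dec t ta) => h2; first by have := hb t ltac:(lra); lra.
  by have := transfer_growth ta t tau ha hr hs; lra.
by have := transfer_growth ta tau t ha hr hs; lra.
Qed.

(** * Orbits whose third mode enters with a favourable angle *)

Section Favourable.

Context (v : R).
Hypothesis sin_v : sin v = 1.
Hypothesis angle_v : psi z.+2 0 = v.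

Lemma cos_v : cos v = 0.
Proof. by have := sin2_cos2 v; rewrite /Rsqr sin_v; nra. Qed.

Lemma sin_shift w : sin (v + w) = cos w.
Proof. by rewrite sin_plus sin_v cos_v; ring. Qed.

Lemma cos_shift w : cos (v + w) = - sin w.
Proof. by rewrite cos_plus sin_v cos_v; ring. Qed.

(** As long as B dominates, the angle is attracted by [2 pi / 3] and repelled by
    [- 2 pi / 3], so the vector field points into the cone of half-opening
    [pi / 3] around [v], which is congruent to [pi / 2]. *)
Lemma favourable_cone t : 0 <= t <= stay_time ->
  - (PI / 3) < psi z.+2 t - v < PI / 3.
Proof.
move=> ht; have pp := PI_RGT_0.
pose d t := 2 * (I z.+2 t - I z.+3 t) * (1 + 2 * cos (psi z.+2 t))
     + 4 * I z.+4 t * cos (psi z.+3 t) - 4 * I z.+1 t * cos (psi z.+1 t).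
have hd s : is_derive (psi z.+2) s (d s) by apply: (derive_gap _ _ _ orb).
have small s : 0 <= s <= stay_time -> [/\ 0.99 <= IB s - IC s,
   Rabs (4 * I z.+4 s * cos (psi z.+3 s)) <= 0.01 & Rabs (4 * I z.+1 s * cos (psi z.+1 s)) <= 0.01].
  move=> hs; have hs' : 0 <= s <= late_time by have := stay_le_late; lra.
  have := B_large_stay s hs; have := C_small_stay s hs; have := A_le s hs'; have := rest_le s hs'.
  have : 100 * exp (- 3 * m) <= E by apply: absorb; lra.
  have [e1 e2] := E_bounds; have hD := D_le_rest s; have a := A_ge0 s.
  move=> h1 h2 h3 h4 h5; split; first lra.
    by apply: Rle_trans (Rabs_mult_le _ _ _ (Rabs_cos_le1 _)) _; lra.
  by apply: Rle_trans (Rabs_mult_le _ _ _ (Rabs_cos_le1 _)) _; lra.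
have s3 : 1.7 <= sqrt 3.
  by apply: Rsqr_incr_0_var; [rewrite /Rsqr sqrt_sqrt; lra | apply: sqrt_pos].
split.
  have hd' s : is_derive (fun s => v - psi z.+2 s) s (- d s).
    evar_last; [apply: is_derive_minus; [exact: is_derive_const | exact: hd]|].
    by rewrite /minus /plus /opp /zero /=; ring.
  have hb s : 0 <= s <= stay_time -> v - psi z.+2 s = PI / 3 -> - d s < 0.
    move=> hs e; have [b /Rabs_le_between c1 /Rabs_le_between c2] := small s hs.
    have c : cos (psi z.+2 s) = sqrt 3 / 2.
      rewrite (_ : psi z.+2 s = v + - (PI / 3)); last by lra.
      by rewrite cos_shift sin_neg sin_PI3; lra.
    by rewrite /d c; nra.
  have h0 : v - psi z.+2 0 < PI / 3 by rewrite angle_v; lra.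
  by have := barrier_lt _ _ (PI / 3) 0 stay_time hd' h0 hb t ht; lra.
have hd' s : is_derive (fun s => psi z.+2 s - v) s (d s).
  evar_last; [apply: is_derive_minus; [exact: hd | exact: is_derive_const]|].
  by rewrite /minus /plus /opp /zero /=; ring.
have hb s : 0 <= s <= stay_time -> psi z.+2 s - v = PI / 3 -> d s < 0.
  move=> hs e; have [b /Rabs_le_between c1 /Rabs_le_between c2] := small s hs.
  have c : cos (psi z.+2 s) = - (sqrt 3 / 2).
    rewrite (_ : psi z.+2 s = v + PI / 3); last by lra.
    by rewrite cos_shift sin_PI3; lra.
  by rewrite /d c; nra.
have h0 : psi z.+2 0 - v < PI / 3 by rewrite angle_v; lra.
by have := barrier_lt _ _ (PI / 3) 0 stay_time hd' h0 hb t ht; lra.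
Qed.

Lemma favourable_sin_stay t : 0 <= t <= stay_time -> / 2 <= sin (psi z.+2 t).
Proof.
move=> ht; have [h1 h2] := favourable_cone t ht; have pp := PI_RGT_0.
have -> : psi z.+2 t = v + (psi z.+2 t - v) by ring.
rewrite sin_shift; have <- : cos (PI / 3) = / 2 by rewrite cos_PI3; lra.
case: (Rle_lt_dec 0 (psi z.+2 t - v)) => h; first by apply: cos_decr_1; lra.
by rewrite -(cos_neg (_ - v)); apply: cos_decr_1; lra.
Qed.

Lemma favourable_C_stay : exp (- 49 * m) <= IC stay_time.
Proof.
have T := stay_time_bounds; have [g1 g2] := G_bounds; have [e1 e2] := E_bounds.
have r := rate_bounds.
have c0 := gate_low _ _ _ _ _ _ start z.+3 ltac:(lia).
rewrite /= in c0.
(* Over a time [13 m] the weak growth rate [1.9] lifts C from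
   [exp (- 2 L - 10 m)] above the coupling error [G]; from then on C grows at
   the full rate. *)
have h1 : exp (- 2 * L + 14 * m) <= IC (13 * m).
  have := gronwall_lower IC dC 1.9 0 0 (13 * m) ltac:(lra) is_derive_C.
  rewrite !Rplus_0_r Rminus_0_r => h.
  have {}h : IC 0 * exp (1.9 * (13 * m)) <= IC (13 * m).
    apply: h => s hs; have hs' : 0 <= s <= stay_time by lra.
    have [_ _ o] := slow_stay s hs'; have b := B_large_stay s hs'; have c := C_ge0 s.
    have hsin := favourable_sin_stay s hs'.
    have /Rabs_le_between hD := mode_mult_sin z.+4 z.+3 s; have hD2 := D_le_rest s.
    have : (1 - 3 * E) * / 2 <= IB s * sin (psi z.+2 s) by apply: Rmult_le_compat; lra.
    by rewrite Rplus_0_r /dC => hB; nra.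
  apply: Rle_trans h.
  apply: (Rle_trans _ (exp (- 2 * L - 10 * m) * exp (1.9 * (13 * m)))).
    by rewrite -exp_plus; apply: exp_le_exp; lra.
  by apply: Rmult_le_compat_r => //; left; apply: exp_pos.
set r' := rate * (1 - 3 * E).
have := gronwall_lower IC dC r' (- 3 * G) (13 * m) stay_time ltac:(lra) is_derive_C.
move=> h; have {}h : (IC (13 * m) + - 3 * G) * exp (r' * (stay_time - 13 * m)) <= IC stay_time + - 3 * G.
  apply: h => s hs; have hs' : 0 <= s <= stay_time by lra.
  have [_ q o] := slow_stay s hs'; have b := B_large_stay s hs'; have c := C_ge0 s.
  have := dC_lower s ltac:(have := favourable_sin_stay s hs'; lra).
  have [_ _ cc _] := intensities_le1 s; have o0 := rest_ge0 s.
  have p0 : IC s * rest s <= 1 * G by apply: Rmult_le_compat.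
  have p1 : rate * ((1 - 3 * E) * IC s - G) <= rate * (IB s * IC s - Rabs (Q z.+2 s)).
    have pB : (1 - 3 * E) * IC s <= IB s * IC s by apply: Rmult_le_compat_r.
    by apply: Rmult_le_compat_l; lra.
  have p2 : 3.4 * G <= r' * G by apply: Rmult_le_compat_r; rewrite /r'; nra.
  have p3 : rate * G <= 3.47 * G by apply: Rmult_le_compat_r; lra.
  have -> : r' * (IC s + -3 * G) = rate * ((1 - 3 * E) * IC s - G) + rate * G - 3 * (r' * G).
    by rewrite /r'; ring.
  lra.
have x : 2 * L - 62 * m <= r' * (stay_time - 13 * m).
  have -> : r' * (stay_time - 13 * m) = rate * stay_time - rate * (3 * (E * stay_time)) - r' * (13 * m).
    by rewrite /r'; ring.
  rewrite rate_stay_time.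
  have p1 : E * stay_time <= E * L by apply: Rmult_le_compat_l; lra.
  have p1' : 0 <= E * stay_time by apply: Rmult_le_pos; lra.
  have p2 : rate * (3 * (E * stay_time)) <= 3.47 * (3 * (E * stay_time)) by apply: Rmult_le_compat_r; lra.
  have p3 : r' * (13 * m) <= 3.47 * (13 * m) by apply: Rmult_le_compat_r; rewrite /r'; nra.
  lra.
have y : exp (- 2 * L + 13 * m) <= IC (13 * m) + - 3 * G.
  have : 10 * exp (- 2 * L + 13 * m) <= exp (- 2 * L + 14 * m) by apply: absorb; lra.
  have : G <= exp (- 2 * L + 13 * m) by apply: exp_le_exp; lra.
  by have := exp_pos (- 2 * L + 13 * m); lra.
have : exp (- 2 * L + 13 * m) * exp (2 * L - 62 * m) <= IC stay_time + - 3 * G.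
  apply: Rle_trans h; apply: Rmult_le_compat => //; try (by left; apply: exp_pos).
  exact: exp_le_exp.
by rewrite -exp_plus => h3; have : exp (- 49 * m) <= exp (- 2 * L + 13 * m + (2 * L - 62 * m)); [apply: exp_le_exp | ]; lra.
Qed.

Lemma favourable_onset : Rabs (log_ratio stay_time) <= 49 * m /\ 0 < sin (psi z.+2 stay_time).
Proof.
have hs := conj stay_ge0 (Rle_refl stay_time).
split; last by have := favourable_sin_stay stay_time hs; lra.
have h1 := log_ratio_stay; have h2 := Rle_trans _ _ _ favourable_C_stay (C_le_exp_log_ratio stay_time).
have h3 : - 49 * m <= log_ratio stay_time.
  by apply: Rnot_lt_le => /exp_increasing; lra.
by apply: Rabs_le; lra.
Qed.

Lemma favourable_sin t : 0 <= t <= late_time -> 0 < sin (psi z.+2 t).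
Proof.
move=> ht; have [h1 h2] := favourable_onset; have [l1 l2] := stay_le_late.
case: (Rle_lt_dec t stay_time) => h; first by have := favourable_sin_stay t ltac:(lra); lra.
have hst : stay_time <= stay_time <= late_time by lra.
by have [] := transfer_onset stay_time hst h1 h2 t ltac:(lra).
Qed.

Lemma favourable_angle t : 0 <= t <= late_time -> v - PI / 2 < psi z.+2 t < v + PI / 2.
Proof.
move=> ht; have pp := PI_RGT_0.
have hd s : is_derive (psi z.+2) s _ := derive_gap _ _ _ orb z.+1 s.
have c1 s : continuous (psi z.+2) s := derive_continuous _ _ _ (hd s).
have c2 s : continuous (fun s => - psi z.+2 s) s by apply: continuous_opp; exact: c1.
split; apply: Rnot_le_lt => hneg.
  have [||s [hs [e _]]] := first_hitting (fun s => - psi z.+2 s) (- v + PI / 2) 0 t c2 ltac:(lra); rewrite ?angle_v; try lra.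
  have := favourable_sin s ltac:(lra).
  by rewrite (_ : psi z.+2 s = v + - (PI / 2)) ?sin_shift ?cos_neg ?cos_PI2; lra.
have [||s [hs [e _]]] := first_hitting (psi z.+2) (v + PI / 2) 0 t c1 ltac:(lra); rewrite ?angle_v; try lra.
have := favourable_sin s ltac:(lra).
by rewrite e sin_shift cos_PI2; lra.
Qed.

Lemma favourable_exit t : early_exit_time <= t <= late_time -> 101 * m <= log_ratio t.
Proof.
rewrite /early_exit_time => ht; have [h1 h2] := favourable_onset.
have [l1 l2] := stay_le_late.
have hst : stay_time <= stay_time <= late_time by lra.
have := transfer_growth stay_time stay_time t hst h1 h2.
move: h1 => /Rabs_le_between; lra.
Qed.

End Favourable.

(** * The next gate *)

Section Exit.

Context (tau : R) (htau : stay_time <= tau <= late_time).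
Hypothesis exit_ratio : log_ratio tau = 100 * m.
Hypothesis transferred : 100 * m <= log_ratio late_time.

(** The mode C is negligible until [ta] and its angle is pinned afterwards; the
    logarithmic ratio gains [102 m] in between, at speed at least [3]. *)
Lemma transfer_window : exists ta,
  [/\ stay_time <= ta <= tau, tau - ta <= 34 * m,
      forall t, 0 <= t <= ta -> 100 * IC t <= E
    & forall t, ta <= t <= tau -> 0 < sin (psi z.+2 t) /\ Rabs (1 + 2 * cos (psi z.+2 t)) <= E].
Proof.
have [ta [ha e hs hb]] := transfer_start transferred.
have hr : Rabs (log_ratio ta) <= 49 * m by rewrite e Rabs_left; lra.
have hlt : ta < tau by case: (Rlt_le_dec ta tau) => // h; have := hb tau ltac:(lra); lra.
exists ta; split; first lra.
- by have := transfer_growth ta ta tau ha hr hs; lra.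
- move=> t ht; case: (Rle_lt_dec t stay_time) => h.
    have := C_small_stay t ltac:(lra).
    have : 100 * exp (- 3 * m) <= E by apply: absorb; lra.
    lra.
  have := C_le_exp_log_ratio t; have := exp_le_exp _ _ (hb t ltac:(lra)).
  have : 100 * exp (- 2 * m) <= E by apply: absorb; lra.
  lra.
- move=> t ht; have [h1 h2 _] := transfer_onset ta ha hr hs t ltac:(lra).
  by split=> //; have [] := pinned_angle t ltac:(lra) h2.
Qed.

Lemma exit_sin : 0 < sin (psi z.+2 tau).
Proof. by have [ta [h1 _ _ h]] := transfer_window; have [] := h tau ltac:(lra). Qed.

(** The velocity of [phi_B] is [- 2] times the mass, up to terms that are small
    because [I_A] and [rest] are, and because [I_C (1 + 2 cos psi_B)] is small
    both before the transfer (small [I_C]) and during it (pinned angle). *)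
Lemma exit_phase : Rabs (phi z.+2 tau - phi z.+2 0 + 2 * tau) <= 1.
Proof.
have [ta [h1 _ h2 h3]] := transfer_window.
have [l1 l2] := stay_le_late; have s0 := stay_ge0.
have [e1 e2] := E_bounds.
pose d t := - 2 * IB t + 4 * IA t * cos (psi z.+1 t) + 4 * IC t * cos (psi z.+2 t) + 2.
have hd t : is_derive (fun t => phi z.+2 t + 2 * t) t (d t).
  evar_last.
    by apply: is_derive_plus; [apply: (orbit_dphi _ _ _ orb) | apply: is_derive_scal; apply: is_derive_id].
  by rewrite /plus /scal /= /mult /one /= /d /angle; ring.
have -> : phi z.+2 tau - phi z.+2 0 + 2 * tau = (phi z.+2 tau + 2 * tau) - (phi z.+2 0 + 2 * 0) by ring.
have : 20 * E * (tau - 0) <= 1.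
  have : E * tau <= E * (1.03 * L) by apply: Rmult_le_compat_l; lra.
  lra.
apply: Rle_trans; apply: (derive_abs_le (fun t => phi z.+2 t + 2 * t) d) => // [|t ht]; first lra.
have ht' : 0 <= t <= late_time by lra.
have o := rest_le t ht'; have o0 := rest_ge0 t; have a := A_le t ht'; have a0 := A_ge0 t.
have c0 := C_ge0 t; have [_ _ c1 _] := intensities_le1 t.
have -> : d t = 2 * rest t + 2 * (IA t * (1 + 2 * cos (psi z.+1 t)))
   + 2 * (IC t * (1 + 2 * cos (psi z.+2 t))) by rewrite /d /rest; ring.
have x j : Rabs (1 + 2 * cos (psi j t)) <= 3.
  by apply: Rabs_le; have := COS_bound (psi j t); lra.
have xA : Rabs (IA t * (1 + 2 * cos (psi z.+1 t))) <= 6 * E.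
  rewrite Rabs_mult (Rabs_pos_eq (IA t)) //.
  have := x z.+1; have := Rabs_pos (1 + 2 * cos (psi z.+1 t)); nra.
have xC : Rabs (IC t * (1 + 2 * cos (psi z.+2 t))) <= E.
  rewrite Rabs_mult (Rabs_pos_eq (IC t)) //.
  have p := Rabs_pos (1 + 2 * cos (psi z.+2 t)).
  case: (Rle_lt_dec t ta) => h.
    have := h2 t ltac:(lra); have := x z.+2; nra.
  have [_ y] := h3 t ltac:(lra).
  by apply: (Rle_trans _ (1 * E)); [apply: Rmult_le_compat | lra].
move/Rabs_le_between: xA => xA; move/Rabs_le_between: xC => xC; apply: Rabs_le; lra.
Qed.

(** Modes ahead of C feel it only during the transfer window, of length at most
    [34 m], and at velocity at most [4]. *)
Lemma leading_drift (f f' : R -> R) : (forall t, is_derive f t (f' t)) ->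
  (forall t, Rabs (f' t) <= 10 * rest t + 4 * IC t) ->
  Rabs (f tau - f 0) <= 137 * m.
Proof.
move=> hd hb; have [ta [h1 h4 h2 h3]] := transfer_window.
have [l1 l2] := stay_le_late; have s0 := stay_ge0; have [e1 e2] := E_bounds.
have b1 : Rabs (f ta - f 0) <= 11 * E * (ta - 0).
  apply: (derive_abs_le f f') => // [|t ht]; first lra.
  by have := hb t; have := h2 t ht; have := rest_le t ltac:(lra); lra.
have b2 : Rabs (f tau - f ta) <= 4.01 * (tau - ta).
  apply: (derive_abs_le f f') => // [|t ht]; first lra.
  by have := hb t; have [_ _ c _] := intensities_le1 t; have := rest_le t ltac:(lra); lra.
have b3 : E * ta <= E * (1.03 * L) by apply: Rmult_le_compat_l; lra.
move/Rabs_le_between: b1 => b1; move/Rabs_le_between: b2 => b2; apply: Rabs_le; lra.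
Qed.

Lemma leading_neighbours (i : nat) (t : R) : (z.+3 <= i)%N ->
  [/\ 0 <= I i t <= IC t + rest t, 0 <= I i.+1 t <= rest t & 0 <= I i.+2 t <= rest t].
Proof.
move=> hi; have o := rest_ge0 t; have c := C_ge0 t.
split; try by apply: other_le_rest; lia.
have [->|hne] : i = z.+3 \/ (z.+3 < i)%N by lia.
  by lra.
by have := other_le_rest i t ltac:(lia); lra.
Qed.

Lemma exit_leading_phase (j : nat) : (z.+4 <= j <= N)%N -> Rabs (phi j tau) <= 147 * m.
Proof.
case: j => [|i] hj; first lia.
have h0 : Rabs (phi i.+1 0) <= 10 * m by apply: (gate_phase _ _ _ _ _ _ start); lia.
have := leading_drift (phi i.+1) _ (orbit_dphi _ _ _ orb i).
move=> h; have {}h : Rabs (phi i.+1 tau - phi i.+1 0) <= 137 * m.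
  apply: h => t; have [a b c] := leading_neighbours i t ltac:(lia).
  have /Rabs_le_between x := Rabs_mult_le _ _ (proj1 a) (Rabs_cos_le1 (phi i.+1 t - phi i t)).
  have /Rabs_le_between y := Rabs_mult_le _ _ (proj1 c) (Rabs_cos_le1 (phi i.+2 t - phi i.+1 t)).
  by apply: Rabs_le; lra.
move/Rabs_le_between: h => h; move/Rabs_le_between: h0 => h0; apply: Rabs_le; lra.
Qed.

Lemma exit_leading_low (j : nat) : (z.+4 <= j <= N)%N -> exp (- 2 * L - 147 * m) <= I j tau.
Proof.
case: j => [|i] hj; first lia.
have pos t : 0 < I i.+1 t by apply: (orbit_pos _ _ _ orb); lia.
have h0 : exp (- 2 * L - 10 * m) <= I i.+1 0 by apply: (gate_low _ _ _ _ _ _ start); lia.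
have := leading_drift (fun t => ln (I i.+1 t))
  (fun t => 4 * (I i t * sin (phi i.+1 t - phi i t)) - 4 * (I i.+2 t * sin (phi i.+2 t - phi i.+1 t))).
move=> h; have {}h : Rabs (ln (I i.+1 tau) - ln (I i.+1 0)) <= 137 * m.
  apply: h => t.
    evar_last; first by apply: is_derive_ln_comp; [exact: pos | exact: (orbit_dI _ _ _ orb)].
    by field; have := pos t; lra.
  have [a b c] := leading_neighbours i t ltac:(lia).
  have /Rabs_le_between x := Rabs_mult_le _ _ (proj1 a) (Rabs_sin_le1 (phi i.+1 t - phi i t)).
  have /Rabs_le_between y := Rabs_mult_le _ _ (proj1 c) (Rabs_sin_le1 (phi i.+2 t - phi i.+1 t)).
  by apply: Rabs_le; lra.
rewrite -(exp_ln _ (pos tau)); apply: exp_le_exp.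
have : - 2 * L - 10 * m <= ln (I i.+1 0) by rewrite -(ln_exp (_ - _)); apply: ln_le => //; apply: exp_pos.
move/Rabs_le_between: h; lra.
Qed.

Lemma exit_gate : gate N L (100 * m) z.+1 (fun j => I j tau) (fun j => phi j tau).
Proof.
split.
- by rewrite (C_of_log_ratio tau) exit_ratio.
- have := late_A tau htau; have := late_rest tau htau; rewrite /rest.
  have : 2 * exp (- 2 * L + 976 * m) <= exp (- 2 * L + 10 * (100 * m)) by apply: absorb; lra.
  have : exp (- 2 * L + 972 * m) <= exp (- 2 * L + 976 * m) by apply: exp_le_exp; lra.
  lra.
- apply: Rle_trans (late_coupling tau htau) _; apply: exp_le_exp; lra.
- exact: exit_sin.
- move=> j hj; apply: Rle_trans (exit_leading_low j hj); apply: exp_le_exp; lra.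
- by move=> j hj; have := exit_leading_phase j hj; lra.
Qed.

End Exit.

End Stage.

Lemma Rabs_lt (x a : R) : - a < x < a -> Rabs x < a.
Proof. by move=> h; apply/Rabs_lt_between. Qed.

Lemma continuous_of_eps (f : R -> R) (t : R) :
  (forall eps, 0 < eps -> exists d, 0 < d /\ forall s, Rabs (s - t) < d -> Rabs (f s - f t) < eps) ->
  continuous f t.
Proof.
move=> h; apply/filterlim_locally => eps.
have [d [hd hb]] := h eps (cond_pos eps).
by exists (mkposreal d hd) => s hs; apply: hb.
Qed.

(** * Curves of states at a gate *)

(** The last passage through [c] before the first passage through [d]. *)
Lemma crossing_subinterval (f : R -> R) (a b c d : R) :
  (forall t, continuous f t) -> a <= b -> f a <= c -> c < d -> d <= f b ->
  exists a' b', [/\ a <= a' < b', b' <= b, f a' = c, f b' = d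
    & forall s, a' <= s <= b' -> c <= f s].
Proof.
move=> hf hab hfa hcd hfb.
have [b' [hb' [eb lb]]] := first_hitting f d a b hf hab ltac:(lra) hfb.
have hg s : continuous (fun s => - f (b' - s)) s.
  apply: continuous_opp; apply: (continuous_comp (fun s => b' - s) f); last exact: hf.
  by apply: (continuous_minus (fun _ => b') (fun s => s)); [exact: continuous_const | exact: continuous_id].
have g0 : - f (b' - 0) < - c by rewrite Rminus_0_r eb; lra.
have gb : - c <= - f (b' - (b' - a)) by rewrite (_ : b' - (b' - a) = a); [lra | ring].
have [u [hu [eu lu]]] := first_hitting _ (- c) 0 (b' - a) hg ltac:(lra) g0 gb.
exists (b' - u), b'; split; try lra.
move=> s hs; case: (Rle_lt_or_eq_dec (b' - u) s (proj1 hs)) => h; last by rewrite -h; lra.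
by have := lu (b' - s) ltac:(lra); rewrite (_ : b' - (b' - s) = s); [lra | ring].
Qed.

Lemma exists_sin1 (x : R) : exists v, x <= v <= x + 2 * PI /\ sin v = 1.
Proof.
have pp := PI_RGT_0.
have [n hn] : exists n : Z, x <= PI / 2 + 2 * IZR n * PI <= x + 2 * PI.
  exists (up ((x - PI / 2) / (2 * PI))).
  have [h1 h2] := archimed ((x - PI / 2) / (2 * PI)).
  set q := (x - PI / 2) / (2 * PI) in h1 h2 *.
  have e : x = PI / 2 + 2 * q * PI by rewrite /q; field; lra.
  by rewrite e; split; nra.
exists (PI / 2 + 2 * IZR n * PI); split=> //.
have e : sin (2 * IZR n * PI) = 0 /\ cos (2 * IZR n * PI) = 1.
  have -> : 2 * IZR n * PI = 2 * (IZR n * PI) by ring.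
  have h0 : sin (IZR n * PI) = 0 by apply: sin_eq_0_1; exists n.
  split; first by rewrite sin_2a h0; ring.
  by rewrite cos_2a_sin h0; ring.
by rewrite sin_plus sin_PI2 cos_PI2 (proj1 e) (proj2 e); ring.
Qed.

Lemma gate_ext (N : nat) (L m : R) (z : nat) (J f J' f' : nat -> R) :
  (forall j, J j = J' j) -> (forall j, f j = f' j) -> gate N L m z J f -> gate N L m z J' f'.
Proof. by move=> hJ hf [h1 h2 h3 h4 h5 h6]; split; intros; rewrite -?hJ -?hf; auto. Qed.

Definition state_gate (N : nat) (L m : R) (z : nat) (x : state) : Prop :=
  mass N x = 1 /\ gate N L m z (intensity N x) (fun j => x (false, j)).

Definition continuous_curve (gamma : R -> state) : Prop :=
  forall s eps, 0 < eps -> exists d, 0 < d /\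
    forall s', Rabs (s' - s) < d -> forall i, Rabs (gamma s' i - gamma s i) < eps.

(** The number [17] exceeds [4 pi], so that a full turn that starts at a
    favourable angle fits in. The curve is defined and at the gate on the whole
    line, which makes reparametrization by clamping possible. *)
Record gate_curve (N : nat) (L m : R) (z : nat) (gamma : R -> state) : Prop := {
  curve_gate : forall s, state_gate N L m z (gamma s);
  curve_continuous : continuous_curve gamma;
  curve_turns : exists a b, a <= b /\
    phase_gap (gamma a) z.+2 + 17 <= phase_gap (gamma b) z.+2 }.

Lemma flow_curve_continuous (N : nat) (gamma : R -> state) : continuous_curve gamma ->
  forall s t eps, 0 < eps -> exists d, 0 < d /\
    forall s' t', Rabs (s' - s) < d -> Rabs (t' - t) < d ->
    forall i, Rabs (polar_flow N (gamma s') t' i - polar_flow N (gamma s) t i) < eps.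
Proof.
move=> hg s t eps he.
have hE := exp_pos (52 * Rabs t).
set K := 8 * exp (52 * Rabs t).
have hK : 0 < K by rewrite /K; lra.
have [d [hd hb]] := hg s (eps / K) ltac:(by apply: Rdiv_lt_0_compat).
exists (Rmin d (eps / 40)); split; first by apply: Rmin_glb_lt; lra.
move=> s' t' hs ht i.
have m1 := Rmin_l d (eps / 40); have m2 := Rmin_r d (eps / 40).
have h1 := polar_flow_lipschitz N (gamma s') t t' i.
have h2 := polar_flow_dependence N (gamma s') (gamma s) (eps / K) t
  (fun i => Rlt_le _ _ (hb s' ltac:(lra) i)) i.
have e : 2 * (eps / K) * exp (52 * Rabs t) = eps / 4 by rewrite /K; field; lra.
have := Rabs_triang (polar_flow N (gamma s') t' i - polar_flow N (gamma s') t i)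
  (polar_flow N (gamma s') t i - polar_flow N (gamma s) t i).
have -> : polar_flow N (gamma s') t' i - polar_flow N (gamma s') t i +
   (polar_flow N (gamma s') t i - polar_flow N (gamma s) t i)
   = polar_flow N (gamma s') t' i - polar_flow N (gamma s) t i by ring.
lra.
Qed.

Definition clamp (a b x : R) : R := Rmax a (Rmin x b).

Lemma clamp_bounds a b x : a <= b -> a <= clamp a b x <= b.
Proof. by rewrite /clamp /Rmax /Rmin => h; case: Rle_dec; case: Rle_dec; lra. Qed.

Lemma clamp_id a b x : a <= x <= b -> clamp a b x = x.
Proof. by move=> h; rewrite /clamp Rmin_left ?Rmax_right; lra. Qed.

Lemma clamp_lipschitz a b x y : Rabs (clamp a b x - clamp a b y) <= Rabs (x - y).
Proof.
have key u v : u <= v -> Rabs (clamp a b u - clamp a b v) <= v - u.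
  by move=> h; apply: Rabs_le; rewrite /clamp /Rmax /Rmin; do 4!case: Rle_dec; lra.
case: (Rle_lt_dec x y) => h.
  by rewrite (Rabs_left1 (x - y)); [have := key x y h; lra | lra].
by rewrite Rabs_minus_sym (Rabs_pos_eq (x - y)); [have := key y x ltac:(lra); lra | lra].
Qed.

Section Step.

Context (N z : nat) (hz : (z.+4 <= N)%N) (L m : R).
Hypothesis m_big : 100 <= m.
Hypothesis L_big : 10000 * m <= L.
Hypothesis m_vs_L : 10000 * L * exp (- m) <= 1.
Context (gamma : R -> state).
Hypothesis curve : gate_curve N L m z gamma.

Let hz3 : (z.+3 <= N)%N. Proof. exact: ltnW. Qed.

Local Notation X s t := (polar_flow N (gamma s) t).
Local Notation I s := (fun j t => intensity N (X s t) j).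
Local Notation phi s := (fun j t => X s t (false, j)).
Local Notation T1 := (early_exit_time L m).
Local Notation T2 := (late_time L m).
Local Notation T0 := (stay_time L m).

Lemma curve_orbit s : polar_orbit N (I s) (phi s).
Proof. by apply: polar_flow_orbit; case: (curve_gate _ _ _ _ _ curve s). Qed.

Lemma curve_start s : gate N L m z (fun j => I s j 0) (fun j => phi s j 0).
Proof.
have [_ h] := curve_gate _ _ _ _ _ curve s.
by apply: gate_ext h => j; rewrite /intensity ?polar_flow0.
Qed.

Lemma curve_log_ratio s t : log_ratio (I s) z t = X s t (true, z.+3) - X s t (true, z.+2).
Proof. by rewrite /log_ratio /intensity !ifT ?ln_exp //; lia. Qed.

Lemma continuous_log_ratio_s t s : continuous (fun s => log_ratio (I s) z t) s.
Proof.
apply: continuous_of_eps => eps he.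
have [d [hd hb]] := flow_curve_continuous N gamma (curve_continuous _ _ _ _ _ curve) s t (eps / 2) ltac:(lra).
exists d; split=> // s' hs; rewrite !curve_log_ratio.
have h t' := hb s' t hs t'; rewrite Rminus_diag Rabs_R0 in h.
have /Rabs_lt_between h1 := h ltac:(lra) (true, z.+3).
have /Rabs_lt_between h2 := h ltac:(lra) (true, z.+2).
by apply: Rabs_lt; lra.
Qed.

Lemma continuous_angle_s t s : continuous (fun s => angle (phi s) z.+2 t) s.
Proof.
apply: continuous_of_eps => eps he.
have [d [hd hb]] := flow_curve_continuous N gamma (curve_continuous _ _ _ _ _ curve) s t (eps / 2) ltac:(lra).
exists d; split=> // s' hs; rewrite /angle.
have /Rabs_lt_between h1 := hb s' t hs ltac:(rewrite Rminus_diag Rabs_R0; lra) (false, z.+3).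
have /Rabs_lt_between h2 := hb s' t hs ltac:(rewrite Rminus_diag Rabs_R0; lra) (false, z.+2).
by apply: Rabs_lt; lra.
Qed.

Lemma continuous_log_ratio_t s t : continuous (fun t => log_ratio (I s) z t) t.
Proof. exact: derive_continuous (is_derive_log_ratio _ _ _ (curve_orbit s) z hz3 t). Qed.

Definition transferred (s : R) : Prop := 100 * m <= log_ratio (I s) z T2.

Definition is_exit (s t : R) : Prop := T0 <= t <= T2 /\ log_ratio (I s) z t = 100 * m.

(** On transferred orbits this time is unique by [exit_time_unique], so its
    continuity does not depend on the choice made by [epsilon]. *)
Definition exit_time (s : R) : R := epsilon (inhabits 0) (is_exit s).

Lemma exit_timeP s : transferred s -> is_exit s (exit_time s).
Proof.
move=> hs; apply: epsilon_spec.
have l0 := log_ratio_stay _ _ _ (curve_orbit s) z hz3 L m m_big L_big m_vs_L (curve_start s).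
have [le1 le2] := stay_le_late L m m_big L_big.
have [|t [ht [e _]]] := first_hitting (log_ratio (I s) z) (100 * m) T0 T2
  (continuous_log_ratio_t s) ltac:(lra) _ hs; first lra.
by exists t; split=> //; lra.
Qed.

Lemma exit_time_unique s t : transferred s -> T0 <= t <= T2 ->
  (t < exit_time s -> log_ratio (I s) z t < 100 * m) /\
  (exit_time s < t -> 100 * m < log_ratio (I s) z t).
Proof.
move=> hs ht; have [h1 h2] := exit_timeP s hs.
exact: (exit_unique _ _ _ (curve_orbit s) z hz3 L m m_big L_big m_vs_L (curve_start s)).
Qed.

Lemma exit_time_continuous s eps : transferred s -> 0 < eps ->
  exists d, 0 < d /\ forall s', transferred s' -> Rabs (s' - s) < d ->
  Rabs (exit_time s' - exit_time s) < eps.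
Proof.
move=> hs he; have [h1 h2] := exit_timeP s hs.
have near t : exists d, 0 < d /\ forall s', Rabs (s' - s) < d ->
   (log_ratio (I s) z t < 100 * m -> log_ratio (I s') z t < 100 * m) /\
   (100 * m < log_ratio (I s) z t -> 100 * m < log_ratio (I s') z t).
  case: (Req_dec (log_ratio (I s) z t) (100 * m)) => e.
    by exists 1; split; [lra | move=> s' _; split; lra].
  have := continuous_log_ratio_s t s; move/filterlim_locally.
  have hp : 0 < Rabs (log_ratio (I s) z t - 100 * m) by apply: Rabs_pos_lt; lra.
  move=> /(_ (mkposreal _ hp)) [d hd]; exists d; split; first exact: cond_pos.
  move=> s' hs'; have : Rabs (log_ratio (I s') z t - log_ratio (I s) z t)
     < Rabs (log_ratio (I s) z t - 100 * m) := hd s' hs'.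
  by rewrite /Rabs; case: Rcase_abs; case: Rcase_abs; split; lra.
have [d1 [hd1 n1]] := near (exit_time s - eps / 2).
have [d2 [hd2 n2]] := near (exit_time s + eps / 2).
exists (Rmin d1 d2); split; first exact: Rmin_glb_lt.
move=> s' hs' hd; have m1 := Rmin_l d1 d2; have m2 := Rmin_r d1 d2.
have [h1' h2'] := exit_timeP s' hs'.
apply: Rabs_lt; split.
  case: (Rlt_le_dec (- eps) (exit_time s' - exit_time s)) => // hc; exfalso.
  have ht : T0 <= exit_time s - eps / 2 <= T2 by lra.
  have [a _] := exit_time_unique s _ hs ht; have [_ b] := exit_time_unique s' _ hs' ht.
  have [c _] := n1 s' ltac:(lra).
  by have := a ltac:(lra) => /c; have := b ltac:(lra); lra.
case: (Rlt_le_dec (exit_time s' - exit_time s) eps) => // hc; exfalso.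
have ht : T0 <= exit_time s + eps / 2 <= T2 by lra.
have [_ a] := exit_time_unique s _ hs ht; have [b _] := exit_time_unique s' _ hs' ht.
have [_ c] := n2 s' ltac:(lra).
by have := a ltac:(lra) => /c; have := b ltac:(lra); lra.
Qed.

Definition exit_state (s : R) : state := X s (exit_time s).

Lemma exit_state_gate s : transferred s -> state_gate N L (100 * m) z.+1 (exit_state s).
Proof.
move=> hs; have [h1 h2] := exit_timeP s hs; split.
  by apply: mass_conserved; case: (curve_gate _ _ _ _ _ curve s).
exact: (exit_gate _ _ _ (curve_orbit s) z hz3 L m m_big L_big m_vs_L (curve_start s)).
Qed.

(** The phase of D has hardly moved, and the phase of C is that of B, which has
    rotated by [- 2 exit_time], increased by the angle between the two. *)
Lemma exit_phase_gap s : transferred s ->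
  Rabs (phase_gap (exit_state s) z.+3
        - (2 * exit_time s + phase_gap (gamma s) z.+2 - angle (phi s) z.+2 (exit_time s)))
  <= 158 * m.
Proof.
move=> hs; have [h1 h2] := exit_timeP s hs.
have /Rabs_le_between p1 := exit_phase _ _ _ (curve_orbit s) z hz3 L m m_big L_big m_vs_L (curve_start s) _ h1 h2 hs.
have /Rabs_le_between p2 := exit_leading_phase _ _ _ (curve_orbit s) z hz3 L m m_big L_big m_vs_L (curve_start s) _ h1 h2 hs z.+4 ltac:(lia).
have [_ g] := curve_gate _ _ _ _ _ curve s.
have /Rabs_le_between p3 := gate_phase _ _ _ _ _ _ g z.+3 ltac:(lia).
rewrite !polar_flow0 in p1; apply: Rabs_le.
rewrite /exit_state /phase_gap /angle; lra.
Qed.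

(** Start at a favourable parameter [sa] and stop at the first parameter [s1]
    whose exit time is the late time. In [exit_phase_gap] the difference of the
    exit times contributes at least [2 * 190 m], the errors at most
    [2 * 158 m], and the entrance angle is lowest at [sa]. *)
Lemma step_interval : exists sa sb, [/\ sa < sb, forall s, sa <= s <= sb -> transferred s
  & phase_gap (exit_state sa) z.+3 + 17 <= phase_gap (exit_state sb) z.+3].
Proof.
have pp := PI_RGT_0; have p4 := PI_4.
have [le1 le2] := stay_le_late L m m_big L_big; have s0 := stay_ge0 L m m_big L_big.
have [a [b [hab hturn]]] := curve_turns _ _ _ _ _ curve.
pose Psi s := angle (phi s) z.+2 0.
have ePsi s : Psi s = phase_gap (gamma s) z.+2 by rewrite /Psi /angle !polar_flow0.
have [v [hv sv]] := exists_sin1 (Psi a).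
have [sa [sb [h1 h2 ea eb hlow]]] := crossing_subinterval Psi a b v (v + 2 * PI)
  (continuous_angle_s 0) hab ltac:(lra) ltac:(lra) ltac:(rewrite !ePsi in hv *; lra).
have fav s := favourable_angle _ _ _ (curve_orbit s) z hz3 L m m_big L_big m_vs_L (curve_start s).
have [f1 f2] := fav sa v sv ea T2 ltac:(lra).
have sv' : sin (v + 2 * PI) = 1 by rewrite sin_plus sin_2PI cos_2PI sv; ring.
have [f3 f4] := fav sb _ sv' eb T2 ltac:(lra).
(* [s2] is not transferred: at the late time its angle is far from pinned. *)
have [||s2 [hs2 [e2 l2]]] := first_hitting (fun s => angle (phi s) z.+2 T2) (v + PI) sa sb
  (continuous_angle_s T2) ltac:(lra); try lra.
have nt : log_ratio (I s2) z T2 < 100 * m.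
  case: (Rlt_le_dec (log_ratio (I s2) z T2) (100 * m)) => // hc; exfalso.
  have := transferred_pinned _ _ _ (curve_orbit s2) z hz3 L m m_big L_big m_vs_L (curve_start s2) hc.
  have := E_bounds L m m_big L_big m_vs_L.
  rewrite e2 cos_plus cos_PI sin_PI (cos_v v sv).
  have -> : 1 + 2 * (0 * -1 - sin v * 0) = 1 by ring.
  by rewrite Rabs_R1; lra.
have hsa := favourable_exit _ _ _ (curve_orbit sa) z hz3 L m m_big L_big m_vs_L (curve_start sa) v sv ea.
have hc s : continuous (fun s => - log_ratio (I s) z T2) s.
  by apply: continuous_opp; exact: continuous_log_ratio_s.
have hsa2 := hsa T2 ltac:(lra).
have [||s1 [hs1 [e1 l1]]] := first_hitting _ (- (100 * m)) sa s2 hc ltac:(lra); try lra.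
have tr s : sa <= s <= s1 -> transferred s.
  rewrite /transferred => hs; case: (Rlt_le_dec s s1) => h; first by have := l1 s ltac:(lra); lra.
  by (have -> : s = s1 by lra); lra.
exists sa, s1; split=> //; first lra.
have ta := tr sa ltac:(lra); have tb := tr s1 ltac:(lra).
have [ha _] := exit_timeP sa ta; have [hb _] := exit_timeP s1 tb.
have ua : exit_time sa <= T1.
  case: (Rle_lt_dec (exit_time sa) T1) => // h.
  have [h' _] := exit_time_unique sa T1 ta ltac:(lra).
  by have := h' h; have := hsa T1 ltac:(lra); lra.
have ub : exit_time s1 = T2.
  case: (Rle_lt_dec T2 (exit_time s1)) => h; first lra.
  have [_ h'] := exit_time_unique s1 T2 tb ltac:(lra).
  by have := h' h; lra.
have [g1 _] := fav sa v sv ea (exit_time sa) ltac:(lra).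
have g2 : angle (phi s1) z.+2 T2 <= v + PI.
  case: (Rlt_le_dec s1 s2) => h; first by have := l2 s1 ltac:(lra); lra.
  by (have -> : s1 = s2 by lra); lra.
have /Rabs_le_between pa := exit_phase_gap sa ta.
have /Rabs_le_between pb := exit_phase_gap s1 tb.
have low := hlow s1 ltac:(lra).
rewrite ub in pb; rewrite ePsi in ea; rewrite ePsi in low.
have e12 : T2 = T1 + 190 * m by rewrite /late_time /early_exit_time; ring.
lra.
Qed.

Lemma gate_curve_step : exists (sigma tau : R -> R),
  (forall s, 0 <= tau s) /\
  gate_curve N L (100 * m) z.+1 (fun s => polar_flow N (gamma (sigma s)) (tau s)).
Proof.
have [sa [sb [hab tr turn]]] := step_interval.
have le : sa <= sb by lra.
have trc s : transferred (clamp sa sb s) by apply: tr; apply: clamp_bounds.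
exists (clamp sa sb), (fun s => exit_time (clamp sa sb s)); split.
  by move=> s; have [h _] := exit_timeP _ (trc s); have := stay_ge0 L m m_big L_big; lra.
split.
- by move=> s; apply: exit_state_gate.
- move=> s eps he.
  have [d [hd hb]] := flow_curve_continuous N gamma (curve_continuous _ _ _ _ _ curve)
    (clamp sa sb s) (exit_time (clamp sa sb s)) eps he.
  have [d' [hd' hb']] := exit_time_continuous (clamp sa sb s) d (trc s) hd.
  exists (Rmin d d'); split; first exact: Rmin_glb_lt.
  move=> s' hs i; have m1 := Rmin_l d d'; have m2 := Rmin_r d d'.
  have h := clamp_lipschitz sa sb s' s.
  by apply: hb; [lra | apply: hb'; [exact: trc | lra]].
- exists sa, sb; split=> //; rewrite !clamp_id; try lra.
  exact: turn.
Qed.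

End Step.

(** * Uniqueness for the toy model *)

Lemma coord_in (N : nat) (b : CN N) (i : nat) (h : (i < N)%N) : coord b i.+1 = b (Ordinal h).
Proof. by rewrite /coord insubT. Qed.

Lemma coord_out (N : nat) (b : CN N) (k : nat) : ~~ (0 < k <= N)%N -> coord b k = RtoC 0.
Proof. by case: k => [|i] // h; rewrite /coord insubF //; apply/negbTE; lia. Qed.

Lemma coord_inj (N : nat) (b c : CN N) :
  (forall k, (1 <= k <= N)%N -> coord b k = coord c k) -> b = c.
Proof.
move=> h; apply: functional_extensionality => -[i hi].
by have := h i.+1 ltac:(lia); rewrite !(coord_in _ _ i hi).
Qed.

Lemma is_derive_pair (f g : R -> R) (t f' g' : R) : is_derive f t f' -> is_derive g t g' ->
  @is_derive R_AbsRing C_R_NormedModule (fun s => (f s, g s)) t (f', g').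
Proof.
move=> hf hg.
apply: (is_derive_ext (V := C_R_NormedModule) (fun s => plus (scal (f s) ((1, 0) : C)) (scal (g s) ((0, 1) : C)))).
  by move=> s; rewrite /plus /scal /= /prod_plus /prod_scal /= /plus /scal /= /mult /=; f_equal; ring.
evar_last.
  by apply: (is_derive_plus (V := C_R_NormedModule)); apply: (is_derive_scal_l (V := C_R_NormedModule)); [exact: hf | exact: hg].
by rewrite /plus /scal /= /prod_plus /prod_scal /= /plus /scal /= /mult /=; f_equal; ring.
Qed.

Lemma is_derive_fst (F : R -> C) (t : R) (l : C) :
  @is_derive R_AbsRing C_R_NormedModule F t l -> is_derive (fun s => fst (F s)) t (fst l).
Proof.
move=> h.
have lin := filterdiff_linear (K := R_AbsRing) (U := C_R_NormedModule) (V := R_NormedModule)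
  (F := locally (F t)) fst (is_linear_fst (K := R_AbsRing) (U := R_NormedModule) (V := R_NormedModule)).
exact: (filterdiff_comp' (K := R_AbsRing) (U := R_NormedModule) (V := C_R_NormedModule)
  (W := R_NormedModule) F (fst : C -> R) t _ _ h lin).
Qed.

Lemma is_derive_snd (F : R -> C) (t : R) (l : C) :
  @is_derive R_AbsRing C_R_NormedModule F t l -> is_derive (fun s => snd (F s)) t (snd l).
Proof.
move=> h.
have lin := filterdiff_linear (K := R_AbsRing) (U := C_R_NormedModule) (V := R_NormedModule)
  (F := locally (F t)) snd (is_linear_snd (K := R_AbsRing) (U := R_NormedModule) (V := R_NormedModule)).
exact: (filterdiff_comp' (K := R_AbsRing) (U := R_NormedModule) (V := C_R_NormedModule)
  (W := R_NormedModule) F (snd : C -> R) t _ _ h lin).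
Qed.

Lemma Cmod_le_sum (x : C) : Cmod x <= Rabs (fst x) + Rabs (snd x).
Proof.
have p1 := Rabs_pos (fst x); have p2 := Rabs_pos (snd x).
rewrite /Cmod -(sqrt_Rsqr (Rabs (fst x) + Rabs (snd x))); last lra.
apply: sqrt_le_1_alt; rewrite /Rsqr.
have e1 : Rabs (fst x) * Rabs (fst x) = fst x * fst x by rewrite -Rabs_mult Rabs_pos_eq //; nra.
have e2 : Rabs (snd x) * Rabs (snd x) = snd x * snd x by rewrite -Rabs_mult Rabs_pos_eq //; nra.
nra.
Qed.

Lemma Rabs_fst_le (x : C) : Rabs (fst x) <= Cmod x.
Proof. exact: Rle_trans (Rmax_l _ _) (Rmax_Cmod x). Qed.

Lemma Rabs_snd_le (x : C) : Rabs (snd x) <= Cmod x.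
Proof. exact: Rle_trans (Rmax_r _ _) (Rmax_Cmod x). Qed.

Lemma trilinear_lipschitz (K d : R) (a b c a' b' c' : C) :
  Cmod a <= K -> Cmod b <= K -> Cmod c <= K ->
  Cmod a' <= K -> Cmod b' <= K -> Cmod c' <= K ->
  Cmod (a - a') <= d -> Cmod (b - b') <= d -> Cmod (c - c') <= d ->
  Cmod (a * b * c - a' * b' * c') <= 3 * K ^ 2 * d.
Proof.
move=> a1 b1 c1 a2 b2 c2 da db dc.
have -> : (a * b * c - a' * b' * c' = (a - a') * b * c + a' * (b - b') * c + a' * b' * (c - c'))%C by ring.
apply: Rle_trans (Cmod_triangle _ _) _.
apply: Rle_trans (Rplus_le_compat_r _ _ _ (Cmod_triangle _ _)) _.
have prod x y z u v w : 0 <= x -> 0 <= y -> 0 <= z -> x <= u -> y <= v -> z <= w -> x * y * z <= u * v * w.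
  by move=> *; apply: Rmult_le_compat => //; [apply: Rmult_le_pos | apply: Rmult_le_compat].
rewrite !Cmod_mult.
have := prod _ _ _ _ _ _ (Cmod_ge_0 _) (Cmod_ge_0 _) (Cmod_ge_0 _) da b1 c1.
have := prod _ _ _ _ _ _ (Cmod_ge_0 _) (Cmod_ge_0 _) (Cmod_ge_0 _) a2 db c1.
have := prod _ _ _ _ _ _ (Cmod_ge_0 _) (Cmod_ge_0 _) (Cmod_ge_0 _) a2 b2 dc.
lra.
Qed.

Lemma toy_field_lipschitz (N : nat) (K d : R) (b c : CN N) :
  (forall k, Cmod (coord b k) <= K) -> (forall k, Cmod (coord c k) <= K) ->
  (forall k, Cmod (coord b k - coord c k) <= d) ->
  forall k, Cmod (toy_field b k - toy_field c k) <= 15 * K ^ 2 * d.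
Proof.
move=> hb hc hd k; rewrite /toy_field !Cmod2_conj.
have cj x y : Cmod (Cconj x - Cconj y) = Cmod (x - y).
  by rewrite -(Cmod_conj (x - y)) Cminus_conj.
have t1 := trilinear_lipschitz K d (coord b k) (Cconj (coord b k)) (coord b k)
  (coord c k) (Cconj (coord c k)) (coord c k).
have t2 j := trilinear_lipschitz K d (Cconj (coord b k)) (coord b j) (coord b j)
  (Cconj (coord c k)) (coord c j) (coord c j).
rewrite !Cmod_conj cj in t1.
have {}t2 j := ltac:(have := t2 j; rewrite !Cmod_conj cj => h; exact: h (hb k) (hb j) (hb j) (hc k) (hc j) (hc j) (hd k) (hd j) (hd j)).
have {}t1 := t1 (hb k) (hb k) (hb k) (hc k) (hc k) (hc k) (hd k) (hd k) (hd k).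
set T1 := (coord b k * _ * _ - _)%C in t1.
pose T2 j := (Cconj (coord b k) * coord b j * coord b j - Cconj (coord c k) * coord c j * coord c j)%C.
have -> : (- Ci * (coord b k * Cconj (coord b k)) * coord b k +
   2 * Ci * Cconj (coord b k) * (coord b k.-1 ^ 2 + coord b k.+1 ^ 2) -
   (- Ci * (coord c k * Cconj (coord c k)) * coord c k +
    2 * Ci * Cconj (coord c k) * (coord c k.-1 ^ 2 + coord c k.+1 ^ 2))
   = - Ci * T1 + 2 * Ci * (T2 k.-1 + T2 k.+1))%C by rewrite /T1 /T2 /=; ring.
apply: Rle_trans (Cmod_triangle _ _) _.
rewrite !Cmod_mult Cmod_opp Cmod_Ci Cmod_R (Rabs_pos_eq 2); last lra.
have := Cmod_triangle (T2 k.-1) (T2 k.+1); have := t2 k.-1; have := t2 k.+1; rewrite -!/(T2 _).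
lra.
Qed.

Lemma bounded_on_interval (f : R -> R) (T : R) : (forall t, continuous f t) ->
  exists K, forall s, Rabs s <= T -> Rabs (f s) <= K.
Proof.
move=> hf; have [K hK] := bounded_continuity (K := R_AbsRing) (V := R_NormedModule) f (- T) T (fun x _ => hf x).
by exists K => s /Rabs_le_between hs; left; apply: hK.
Qed.

Lemma derive_coord_fst (N : nat) (b : R -> CN N) (k : nat) (t : R) : toy_solution b ->
  is_derive (fun s => fst (coord (b s) k)) t (if (0 < k <= N)%N then fst (toy_field (b t) k) else 0).
Proof.
move=> sol; case: ifP => hk; first by apply: (is_derive_fst (fun s => coord (b s) k)); apply: sol.
apply: (is_derive_ext (fun _ => 0)); last exact: is_derive_const.
by move=> s; rewrite coord_out ?hk.
Qed.

Lemma derive_coord_snd (N : nat) (b : R -> CN N) (k : nat) (t : R) : toy_solution b ->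
  is_derive (fun s => snd (coord (b s) k)) t (if (0 < k <= N)%N then snd (toy_field (b t) k) else 0).
Proof.
move=> sol; case: ifP => hk; first by apply: (is_derive_snd (fun s => coord (b s) k)); apply: sol.
apply: (is_derive_ext (fun _ => 0)); last exact: is_derive_const.
by move=> s; rewrite coord_out ?hk.
Qed.

Lemma toy_solution_bounded (N : nat) (b : R -> CN N) (T : R) : toy_solution b ->
  exists K, forall k s, Rabs s <= T -> Cmod (coord (b s) k) <= K.
Proof.
move=> sol.
have [K hK] : exists K, forall k, (k < N.+1)%N -> forall s, Rabs s <= T -> Cmod (coord (b s) k) <= K.
  elim: (N.+1) => [|n [K ih]]; first by exists 0.
  have [K1 h1] := bounded_on_interval (fun s => fst (coord (b s) n)) T
    (fun t => derive_continuous _ _ _ (derive_coord_fst _ _ n t sol)).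
  have [K2 h2] := bounded_on_interval (fun s => snd (coord (b s) n)) T
    (fun t => derive_continuous _ _ _ (derive_coord_snd _ _ n t sol)).
  exists (Rmax K (K1 + K2)) => k hk s hs; case: (ltnP k n) => h.
    by apply: Rle_trans (Rmax_l _ _); apply: ih.
  have -> : k = n by lia.
  apply: Rle_trans (Cmod_le_sum _) _; apply: Rle_trans (Rmax_r _ _).
  by have := h1 s hs; have := h2 s hs; lra.
exists (Rmax K 0) => k s hs; case: (ltnP k N.+1) => h.
  by apply: Rle_trans (Rmax_l _ _); apply: hK.
rewrite coord_out; last lia.
by rewrite Cmod_0; apply: Rmax_r.
Qed.

(** On a compact time interval both solutions are bounded, and the weighted
    estimate of the Picard iteration halves any bound on their difference. *)
Lemma toy_solution_unique (N : nat) (b c : R -> CN N) :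
  toy_solution b -> toy_solution c -> b 0 = c 0 -> forall t, b t = c t.
Proof.
move=> sb sc e0 t.
have [K1 h1] := toy_solution_bounded N b (Rabs t) sb.
have [K2 h2] := toy_solution_bounded N c (Rabs t) sc.
set K := Rmax 1 (Rmax K1 K2).
have hK : 1 <= K by apply: Rmax_l.
have hb k s : Rabs s <= Rabs t -> Cmod (coord (b s) k) <= K.
  by move=> hs; apply: Rle_trans (h1 k s hs) _; apply: Rle_trans (Rmax_r _ _); apply: Rmax_l.
have hc k s : Rabs s <= Rabs t -> Cmod (coord (c s) k) <= K.
  by move=> hs; apply: Rle_trans (h2 k s hs) _; apply: Rle_trans (Rmax_r _ _); apply: Rmax_r.
pose w := 60 * K ^ 2.
have hw : 0 < w by rewrite /w; nra.
have step n : forall k s, Rabs s <= Rabs t ->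
   Cmod (coord (b s) k - coord (c s) k) <= 2 * K * (/ 2) ^ n * exp (w * Rabs s).
  elim: n => [|n ih] k s hs.
    have := Cmod_triangle (coord (b s) k) (- coord (c s) k); rewrite Cmod_opp => h.
    apply: Rle_trans (h : Cmod (_ - _) <= _) _.
    have := hb k s hs; have := hc k s hs; have := exp_ineq1_le (w * Rabs s).
    have : 0 <= w * Rabs s by apply: Rmult_le_pos; [lra | apply: Rabs_pos].
    by rewrite /=; nra.
  have hd r : Rabs r <= Rabs s -> Cmod (toy_field (b r) k - toy_field (c r) k)
     <= 15 * K ^ 2 * (2 * K * (/ 2) ^ n) * exp (w * Rabs r).
    move=> hr; rewrite Rmult_assoc; apply: toy_field_lipschitz => j.
    - by apply: hb; lra.
    - by apply: hc; lra.
    - by apply: ih; lra.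
  have cpos : 0 <= 15 * K ^ 2 * (2 * K * (/ 2) ^ n).
    have := pow_le (/ 2) n ltac:(lra) => p.
    by apply: Rmult_le_pos; [nra | apply: Rmult_le_pos; lra].
  have e : 15 * K ^ 2 * (2 * K * (/ 2) ^ n) / w = 2 * K * (/ 2) ^ n / 4 by rewrite /w; field; nra.
  have b1 := abs_le_exp_integral (fun s => fst (coord (b s) k) - fst (coord (c s) k)) _ _ w s hw cpos.
  have b2 := abs_le_exp_integral (fun s => snd (coord (b s) k) - snd (coord (c s) k)) _ _ w s hw cpos.
  rewrite e in b1; rewrite e in b2.
  have d1 r := is_derive_minus _ _ r _ _ (derive_coord_fst N b k r sb) (derive_coord_fst N c k r sc).
  have d2 r := is_derive_minus _ _ r _ _ (derive_coord_snd N b k r sb) (derive_coord_snd N c k r sc).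
  have ex r := exp_pos (w * Rabs r).
  have {}b1 := b1 _ _ d1; have {}b2 := b2 _ _ d2.
  have {}b1 : Rabs (fst (coord (b s) k) - fst (coord (c s) k)) <= 2 * K * (/ 2) ^ n / 4 * exp (w * Rabs s).
    apply: b1; first by rewrite e0; ring.
    move=> r hr; case: ifP => _.
      by apply: Rle_trans (hd r hr); exact: (Rabs_fst_le (toy_field (b r) k - toy_field (c r) k)%C).
    by rewrite minus_eq_zero Rabs_R0; have := ex r; nra.
  have {}b2 : Rabs (snd (coord (b s) k) - snd (coord (c s) k)) <= 2 * K * (/ 2) ^ n / 4 * exp (w * Rabs s).
    apply: b2; first by rewrite e0; ring.
    move=> r hr; case: ifP => _.
      by apply: Rle_trans (hd r hr); exact: (Rabs_snd_le (toy_field (b r) k - toy_field (c r) k)%C).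
    by rewrite minus_eq_zero Rabs_R0; have := ex r; nra.
  apply: Rle_trans (Cmod_le_sum _) _.
  apply: (Rle_trans _ _ _ (Rplus_le_compat _ _ _ _ b1 b2)).
  by right; rewrite /=; field.
apply: coord_inj => k _.
suff : Cmod (coord (b t) k - coord (c t) k) = 0.
  by move/Cmod_eq_0 => h; rewrite -(Cplus_0_r (coord (c t) k)) -h; ring.
apply: Rle_antisym; last exact: Cmod_ge_0.
apply: Rnot_lt_le => hpos.
set d := Cmod _ in hpos.
set M := 2 * K * exp (w * Rabs t).
have hM : 0 < M by rewrite /M; have := exp_pos (w * Rabs t); nra.
have [n hn] := pow_lt_1_zero (/ 2) ltac:(rewrite Rabs_pos_eq; lra) (d / M) ltac:(by apply: Rdiv_lt_0_compat).
have := hn n ltac:(lia); rewrite Rabs_pos_eq; last by apply: pow_le; lra.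
move=> h3; have := step n k t (Rle_refl _); rewrite -/d => h4.
have : (/ 2) ^ n * M < d.
  have := Rmult_lt_compat_r M _ _ hM h3.
  by rewrite /Rdiv Rmult_assoc Rinv_l ?Rmult_1_r //; lra.
rewrite /M; lra.
Qed.

(** * From polar coordinates to the toy model *)

Definition polar_coord (N : nat) (x : state) (k : nat) : C :=
  if (0 < k <= N)%N then (exp (x (true, k) / 2) * cos (x (false, k) / 2),
                          exp (x (true, k) / 2) * sin (x (false, k) / 2))
  else RtoC 0.

Definition toy_state (N : nat) (x : state) : CN N := fun j => polar_coord N x j.+1.

Lemma coord_toy_state (N : nat) (x : state) (k : nat) : coord (toy_state N x) k = polar_coord N x k.
Proof.
case hk : (0 < k <= N)%N; last by rewrite coord_out ?hk // /polar_coord hk.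
case: k hk => [|i] // hi.
have h : (i < N)%N by lia.
by rewrite (coord_in _ _ i h).
Qed.

Lemma exp_half_sqr (y : R) : exp (y / 2) * exp (y / 2) = exp y.
Proof. by rewrite -exp_plus; f_equal; field. Qed.

Lemma polar_coord_Cmod2 (N : nat) (x : state) (k : nat) : Cmod (polar_coord N x k) ^ 2 = intensity N x k.
Proof.
rewrite /polar_coord /intensity; case: ifP => _; last by rewrite Cmod_0 /=; ring.
rewrite /Cmod pow2_sqrt; last by apply: Rplus_le_le_0_compat; apply: pow2_ge_0.
rewrite -(exp_half_sqr (x (true, k))) /=.
have := sin2_cos2 (x (false, k) / 2); rewrite /Rsqr => e.
set r := exp _; set c := cos _ in e *; set s := sin _ in e *.
have -> : r * c * (r * c * 1) + r * s * (r * s * 1) = r * r * (s * s + c * c) by ring.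
by rewrite e; ring.
Qed.

Lemma polar_coord_sqr (N : nat) (x : state) (k : nat) :
  (polar_coord N x k ^ 2)%C = (intensity N x k * cos (x (false, k)), intensity N x k * sin (x (false, k))).
Proof.
rewrite /polar_coord /intensity; case: ifP => _; last first.
  by rewrite /= /Cmult /RtoC /=; f_equal; ring.
rewrite -(exp_half_sqr (x (true, k))).
have -> : cos (x (false, k)) = cos (2 * (x (false, k) / 2)) by f_equal; field.
have -> : sin (x (false, k)) = sin (2 * (x (false, k) / 2)) by f_equal; field.
by rewrite cos_2a sin_2a; apply: injective_projections => /=; ring.
Qed.

Lemma toy_solution_polar_flow (N : nat) (x : state) : mass N x = 1 ->
  toy_solution (fun t => toy_state N (polar_flow N x t)).
Proof.
move=> hx t [|i] hj; first lia.
have orb := polar_flow_orbit N x hx.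
have hi : (0 < i.+1 <= N)%N by lia.
set X := polar_flow N x.
have cap j : capped_intensity N (X t) j = intensity N (X t) j.
  apply: capped_below1; have := four_modes_le1 N _ _ orb j j.+1 j.+2 j.+3 t ltac:(lia).
  rewrite -/X => h4.
  have := intensity_ge0 N (X t) j.+1; have := intensity_ge0 N (X t) j.+2.
  have := intensity_ge0 N (X t) j.+3; lra.
apply: (is_derive_ext (V := C_R_NormedModule) (fun s =>
   (exp (X s (true, i.+1) / 2) * cos (X s (false, i.+1) / 2),
    exp (X s (true, i.+1) / 2) * sin (X s (false, i.+1) / 2)))).
  by move=> s; rewrite coord_toy_state /polar_coord hi.
have dy := derive_polar_flow N x (true, i.+1) t; have dphi := derive_polar_flow N x (false, i.+1) t.
have half u u' : is_derive u t u' -> is_derive (fun s => u s / 2) t (u' / 2).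
  move=> hu; apply: (is_derive_ext (fun s => / 2 * u s)); first by move=> s; exact: Rmult_comm.
  by evar_last; [apply: is_derive_scal; exact: hu | exact: Rmult_comm].
have dr : is_derive (fun s => exp (X s (true, i.+1) / 2)) t
    (polar_field N (X t) (true, i.+1) / 2 * exp (X t (true, i.+1) / 2)).
  by apply: (is_derive_comp exp _ t _ _ (is_derive_exp _) (half _ _ dy)).
have dc : is_derive (fun s => cos (X s (false, i.+1) / 2)) t
    (polar_field N (X t) (false, i.+1) / 2 * - sin (X t (false, i.+1) / 2)).
  by apply: (is_derive_comp cos _ t _ _ (is_derive_cos _) (half _ _ dphi)).
have ds : is_derive (fun s => sin (X s (false, i.+1) / 2)) t
    (polar_field N (X t) (false, i.+1) / 2 * cos (X t (false, i.+1) / 2)).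
  by apply: (is_derive_comp sin _ t _ _ (is_derive_sin _) (half _ _ dphi)).
evar_last; first by apply: is_derive_pair; apply: is_derive_mult_R; [exact: dr | exact: dc | exact: dr | exact: ds].
rewrite /toy_field !coord_toy_state polar_coord_Cmod2 !polar_coord_sqr /= !cap /phase_gap.
have eI : intensity N (X t) i.+1 = exp (X t (true, i.+1) / 2) * exp (X t (true, i.+1) / 2).
  by rewrite /intensity hi exp_half_sqr.
rewrite eI {1 2}/polar_coord hi.
set h := X t (false, i.+1) / 2.
have eh : X t (false, i.+1) = h + h by rewrite /h; field.
rewrite eh.
set p := X t (false, i); set q := X t (false, i.+2); set r := exp _.
set Ip := intensity N (X t) i; set Iq := intensity N (X t) i.+2.
have sc a b : sin (a - b) = sin a * cos b - cos a * sin b by exact: sin_minus.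
have -> : sin (h + h - p) = 2 * sin h * cos h * cos p - (cos h * cos h - sin h * sin h) * sin p.
  by rewrite sc sin_plus cos_plus; ring.
have -> : cos (h + h - p) = (cos h * cos h - sin h * sin h) * cos p + 2 * sin h * cos h * sin p.
  by rewrite cos_minus sin_plus cos_plus; ring.
have -> : sin (q - (h + h)) = sin q * (cos h * cos h - sin h * sin h) - cos q * (2 * sin h * cos h).
  by rewrite sc sin_plus cos_plus; ring.
have -> : cos (q - (h + h)) = cos q * (cos h * cos h - sin h * sin h) + sin q * (2 * sin h * cos h).
  by rewrite cos_minus sin_plus cos_plus; ring.
have e1 := sin2_cos2 h; rewrite /Rsqr in e1.
have es : sin h * sin h = 1 - cos h * cos h by lra.
rewrite /Cmult /Cplus /Cconj /Copp /RtoC /Ci /=.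
move: es; set c := cos h; set s := sin h => es.
apply: injective_projections => /=; field [es].
Qed.

Lemma toy_flow_eq (N : nat) (b : R -> CN N) (t : R) : toy_solution b -> toy_flow t (b 0) = b t.
Proof.
move=> sol; rewrite /toy_flow /toy_trajectory.
have [h1 h2] := epsilon_spec (inhabits (fun (_ : R) (_ : 'I_N) => RtoC 0))
  (fun c => toy_solution c /\ c 0 = b 0) (ex_intro _ b (conj sol (erefl _))).
exact: toy_solution_unique.
Qed.

Lemma toy_solution_shift (N : nat) (b : R -> CN N) (t0 : R) :
  toy_solution b -> toy_solution (fun t => b (t0 + t)).
Proof.
move=> sol t j hj.
have h := sol (t0 + t) j hj.
evar_last.
  apply: (is_derive_comp (V := C_R_NormedModule) (fun s => coord (b s) j) (fun s => t0 + s)); first exact: h.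
  by apply: is_derive_plus; [exact: is_derive_const | exact: is_derive_id].
rewrite plus_zero_l; exact: (@scal_one R_AbsRing C_R_NormedModule).
Qed.

Lemma toy_state_polar_flow0 (N : nat) (x : state) : toy_state N (polar_flow N x 0) = toy_state N x.
Proof.
by apply: functional_extensionality => j; rewrite /toy_state /polar_coord !polar_flow0.
Qed.

Lemma toy_flow_polar (N : nat) (x : state) (t : R) : mass N x = 1 ->
  toy_flow t (toy_state N x) = toy_state N (polar_flow N x t).
Proof.
move=> hx; rewrite -{1}(toy_state_polar_flow0 N x).
exact: (toy_flow_eq N (fun t => toy_state N (polar_flow N x t)) t (toy_solution_polar_flow N x hx)).
Qed.

Lemma toy_flow_add (N : nat) (x : state) (s t : R) : mass N x = 1 ->
  toy_flow t (toy_flow s (toy_state N x)) = toy_flow (s + t) (toy_state N x).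
Proof.
move=> hx; rewrite (toy_flow_polar N x s hx) (toy_flow_polar N x (s + t) hx).
have sol := toy_solution_shift _ _ s (toy_solution_polar_flow N x hx).
have e := toy_flow_eq N _ t sol.
by rewrite Rplus_0_r in e.
Qed.

(** * The transition chain *)

Lemma gate_curves (N : nat) (L m : R) (z n : nat) (gamma : R -> state) :
  100 <= m -> 10000 * (100 ^ n * m) <= L -> 10000 * L * exp (- m) <= 1 ->
  (z + n + 3 <= N)%N -> gate_curve N L m z gamma ->
  exists gamma', gate_curve N L (100 ^ n * m) (z + n) gamma' /\
    forall s, exists s0 t, 0 <= t /\
      toy_state N (gamma' s) = toy_flow t (toy_state N (gamma s0)).
Proof.
move=> hm hL hE; elim: n hL => [|n ih] hL hN curve.
  exists gamma; rewrite addn0 /= Rmult_1_l; split=> // s.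
  exists s, 0; split; first lra.
  rewrite toy_flow_polar ?toy_state_polar_flow0 //.
  by case: (curve_gate _ _ _ _ _ curve s).
have p : 1 <= 100 ^ n by apply: pow_R1_Rle; lra.
have hLn : 10000 * (100 ^ n * m) <= L by move: hL => /=; nra.
have [gamma1 [curve1 reach1]] := ih hLn ltac:(lia) curve.
have hmn : m <= 100 ^ n * m by nra.
have hEn : 10000 * L * exp (- (100 ^ n * m)) <= 1.
  apply: Rle_trans hE; apply: Rmult_le_compat_l; first by nra.
  by apply: exp_le_exp; lra.
have [sigma [tau [htau curve2]]] := gate_curve_step N (z + n) ltac:(lia) L (100 ^ n * m)
   ltac:(lra) hLn hEn gamma1 curve1.
exists (fun s => polar_flow N (gamma1 (sigma s)) (tau s)); split.
  by rewrite addnS /= Rmult_assoc.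
move=> s; have [s0 [t [ht e]]] := reach1 (sigma s).
exists s0, (t + tau s); split; first by have := htau s; lra.
rewrite -toy_flow_polar; last by case: (curve_gate _ _ _ _ _ curve1 (sigma s)).
rewrite e toy_flow_add //.
by case: (curve_gate _ _ _ _ _ curve s0).
Qed.

Lemma sum_n_m_from1 (f : nat -> R) (N : nat) : f 0%N = 0 -> sum_n_m f 1 N = sum_n f N.
Proof.
move=> f0; rewrite /sum_n (sum_Sn_m _ 0 N); last lia.
by rewrite f0 plus_zero_l.
Qed.

Lemma normCN_eq (N : nat) (x : CN N) : normCN x = sqrt (sum_n (fun k => Cmod (coord x k) ^ 2) N).
Proof. by rewrite /normCN sum_n_m_from1 // coord_out // Cmod_0 /=; ring. Qed.

Lemma toy_state_Sigma (N : nat) (x : state) : mass N x = 1 -> Sigma (toy_state N x).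
Proof.
move=> hx; rewrite /Sigma normCN_eq.
rewrite (sum_n_ext _ (intensity N x)); last by move=> k; rewrite coord_toy_state polar_coord_Cmod2.
by rewrite -/(mass N x) hx sqrt_1 /=; ring.
Qed.

Lemma near_circle (N : nat) (x : state) (B : nat) (eps : R) : (0 < B <= N)%N -> mass N x = 1 ->
  0 <= eps -> 2 * (1 - intensity N x B) <= eps ^ 2 ->
  within_dist eps (toy_state N x) (@circle N B).
Proof.
move=> hB hx he hI.
pose phi := x (false, B).
pose u : C := (cos (phi / 2), sin (phi / 2)).
pose y : CN N := fun j => if j.+1 == B then u else RtoC 0.
have cy k : coord y k = if k == B then u else RtoC 0.
  case hk : (0 < k <= N)%N; last by rewrite coord_out ?hk // ifF //; lia.
  by case: k hk => [|i] // hk; have h : (i < N)%N by [lia]; rewrite (coord_in _ _ i h).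
have mu : Cmod u = 1.
  rewrite /Cmod /u /= (_ : _ + _ = 1) ?sqrt_1 //.
  by have := sin2_cos2 (phi / 2); rewrite /Rsqr; lra.
exists y; split; last first.
  rewrite /distCN normCN_eq -(sqrt_pow2 eps he); apply: sqrt_le_1_alt.
  apply: Rle_trans hI.
  pose D k := Cmod (coord (toy_state N x) k - coord y k) ^ 2.
  have -> : sum_n (fun k => Cmod (coord (fun j : 'I_N => (toy_state N x j - y j)%C) k) ^ 2) N = sum_n D N.
    apply: sum_n_ext => k; rewrite /D.
    case hk : (0 < k <= N)%N; last by rewrite !coord_out ?hk //; do 2!f_equal; ring.
    by case: k hk => [|i] // hk; have h : (i < N)%N by [lia]; rewrite !(coord_in _ _ i h).
  have hBN : (B <= N)%N by lia.
  have eD : sum_n (fun k => if k == B then 0 else D k) N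
       = sum_n (fun k => if k == B then 0 else intensity N x k) N.
    apply: sum_n_ext => k; case: ifP => // e.
    by rewrite /D cy e coord_toy_state -polar_coord_Cmod2; do 2!f_equal; ring.
  have hm : 1 = intensity N x B + sum_n (fun k => if k == B then 0 else intensity N x k) N.
    by rewrite -hx /mass (sum_n_remove _ N B hBN).
  rewrite (sum_n_remove D N B hBN) eD.
  have DB : D B = (exp (x (true, B) / 2) - 1) ^ 2.
    rewrite /D cy eqxx coord_toy_state /polar_coord hB -/phi.
    have -> : (((exp (x (true, B) / 2) * cos (phi / 2))%R, (exp (x (true, B) / 2) * sin (phi / 2))%R) - u)%C
       = (RtoC (exp (x (true, B) / 2) - 1)%R * u)%C.
      by rewrite /u /Cminus /Cplus /Copp /Cmult /RtoC /=; apply: injective_projections => /=; ring.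
    by rewrite Cmod_mult mu Cmod_R Rmult_1_r RPow_abs Rabs_pos_eq //; apply: pow2_ge_0.
  have eI : intensity N x B = exp (x (true, B) / 2) * exp (x (true, B) / 2).
    by rewrite exp_half_sqr /intensity hB.
  have rest0 : 0 <= sum_n (fun k => if k == B then 0 else intensity N x k) N.
    by apply: sum_n_ge0 => k; case: ifP => _; [lra | exact: intensity_ge0].
  have := exp_pos (x (true, B) / 2); rewrite DB; move: eI => -> in hm * => ep; nra.
split.
  rewrite /Sigma normCN_eq (sum_n_remove _ N B); last lia.
  rewrite cy eqxx mu (sum_n_ext _ (fun _ => 0)).
    by rewrite sum_n_const Rmult_0_r (_ : 1 ^ 2 + 0 = 1) ?sqrt_1 /=; ring.
  by move=> k; case: ifP => // e; rewrite cy e Cmod_0 /=; ring.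
split; first by rewrite cy eqxx.
by move=> k hk /eqP /negbTE e; rewrite cy e.
Qed.

Lemma gate_near_circle (N : nat) (L m : R) (z : nat) (x : state) (eps : R) :
  0 <= eps -> 100 <= m -> 10000 * m <= L -> 4 * exp (- m) <= eps ^ 2 -> (z.+3 <= N)%N ->
  state_gate N L m z x -> within_dist eps (toy_state N x) (@circle N z.+2).
Proof.
move=> he hm hL hs hz [hx g]; apply: near_circle => //; first lia.
apply: Rle_trans hs.
have r := gate_ratio _ _ _ _ _ _ g; have o := gate_rest _ _ _ _ _ _ g.
have p : exp m * exp (- m) = 1 by rewrite -exp_plus -exp_0; f_equal; ring.
have h : exp (- 2 * L + 10 * m) <= exp (- m) by apply: exp_le_exp; lra.
have a0 := intensity_ge0 N x z.+1; have b0 := intensity_ge0 N x z.+2.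
have b1 : intensity N x z.+2 <= 1.
  by rewrite -hx; apply: term_le_sum_n; [exact: intensity_ge0 | lia].
have a : intensity N x z.+1 = exp (- m) * intensity N x z.+2.
  by rewrite r -Rmult_assoc (Rmult_comm (exp (- m))) p; ring.
have := exp_pos (- m); nra.
Qed.

(** The modes [2] and [3] lie exactly on the connection between their circles,
    so that their coupling vanishes; the parameter of the curve is a common
    rotation of these two modes against all the others. *)
Lemma initial_gate_curve (N : nat) (L m : R) :
  (4 <= N)%N -> 1 <= m -> 100 * m <= L -> INR N + 1 <= exp (10 * m) ->
  exists gamma, gate_curve N L m 1 gamma.
Proof.
move=> hN hm hL hNm.
pose small j := if (0 < j <= N)%N && (j != 2%N) && (j != 3%N) then exp (- 2 * L) else 0.
pose S := sum_n small N.
have S0 : 0 <= S by apply: sum_n_ge0 => j; rewrite /small; case: ifP => _; [left; apply: exp_pos | lra].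
have SN : S <= exp (- 2 * L + 10 * m).
  have : S <= sum_n (fun _ => exp (- 2 * L)) N.
    apply: sum_n_m_le => k; rewrite /small; case: ifP => _; [lra | left; exact: exp_pos].
  rewrite sum_n_const exp_plus S_INR; have := exp_pos (- 2 * L); nra.
have S1 : S < 1.
  apply: Rle_lt_trans SN _; rewrite -exp_0; apply: exp_increasing; lra.
pose a := (1 - S) / (1 + exp m).
have em := exp_pos m.
have apos : 0 < a by apply: Rdiv_lt_0_compat; lra.
have ea : a + exp m * a = 1 - S by rewrite /a; field; lra.
pose gamma (s : R) : state := fun i => match i with
  | (true, j) => if j == 2%N then ln a else if j == 3%N then m + ln a else - 2 * L
  | (false, j) => if j == 2%N then - s - 2 * (PI / 3) else if j == 3%N then - s else 0 end.
have i2 s : intensity N (gamma s) 2 = a by rewrite /intensity ifT /= ?exp_ln //; lia.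
have i3 s : intensity N (gamma s) 3 = exp m * a.
  by rewrite /intensity ifT /= ?exp_plus ?exp_ln //; lia.
have ismall s j : j != 2%N -> j != 3%N -> intensity N (gamma s) j = small j.
  by move=> h2 h3; rewrite /intensity /small /= (negbTE h2) (negbTE h3) !andbT.
exists gamma; split.
- move=> s; split.
    rewrite /mass (sum_n_remove _ N 2); last lia.
    rewrite (sum_n_remove _ N 3) /=; last lia.
    rewrite i2 i3 (sum_n_ext _ small); first by rewrite -/S; lra.
    move=> j; case: ifP => [/eqP ->|h3]; first by rewrite /small !andbF.
    case: ifP => [/eqP ->|h2]; first by rewrite /small andbF.
    by apply: ismall; rewrite ?h2 ?h3.
  have gap : - s - (- s - 2 * (PI / 3)) = 2 * (PI / 3) by ring.
  split.
  + by rewrite i2 i3.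
  + by rewrite i2 i3; lra.
  + rewrite i2 i3 /= gap cos_2PI3.
    rewrite (_ : 1 + 2 * (-1 / 2) = 0); last by field.
    by rewrite Rmult_0_r Rabs_R0; left; apply: exp_pos.
  + by rewrite /= gap sin_2PI3; have := sqrt_lt_R0 3; lra.
  + move=> j hj; rewrite ismall; [|lia|lia].
    rewrite /small ifT; last lia.
    by apply: exp_le_exp; lra.
  + move=> j hj /=; rewrite !ifF; [|lia|lia].
    by rewrite Rabs_R0; lra.
- move=> s eps he; exists eps; split=> // s' hs [[] j] /=.
    by rewrite Rminus_diag Rabs_R0.
  case: ifP => _; last case: ifP => _.
  + by rewrite (_ : _ - _ = - (s' - s)) ?Rabs_Ropp //; ring.
  + by rewrite (_ : _ - _ = - (s' - s)) ?Rabs_Ropp //; ring.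
  + by rewrite Rminus_diag Rabs_R0.
- exists 0, 17; split; first lra.
  by rewrite /phase_gap /=; lra.
Qed.

Lemma exp_beats_square (x : R) : 270000 <= x -> 10000 * (x * x) <= exp x.
Proof.
move=> hx; have h := exp_ineq1_le (x / 3).
have -> : exp x = exp (x / 3) * exp (x / 3) * exp (x / 3) by rewrite -!exp_plus; f_equal; field.
have : x / 3 * (x / 3) * (x / 3) <= exp (x / 3) * exp (x / 3) * exp (x / 3).
  by apply: Rmult_le_compat; [nra | lra | apply: Rmult_le_compat; lra | lra].
nra.
Qed.

Theorem theorem3p1 :
  forall (N : nat), (6 <= N)%N ->
  forall eps : R, (0 < eps)%R ->
  exists (x3 xN2 : CN N) (t : R),
    Sigma x3 /\ within_dist eps x3 (@circle N 3) /\
    Sigma xN2 /\ within_dist eps xN2 (@circle N (N - 2)) /\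
    (0 <= t)%R /\
    toy_flow t x3 = xN2.
Proof.
move=> N hN eps heps.
pose n := (N - 5)%N.
have p : 1 <= 100 ^ n by apply: pow_R1_Rle; lra.
have q : 0 < 4 / eps ^ 2 by apply: Rdiv_lt_0_compat; [lra | apply: pow_lt].
have hINR := pos_INR N.
(* The term [10000 * 100 ^ n] keeps all tolerances [100 ^ k * m] small against
   [L = m ^ 2], the term [4 / eps ^ 2] yields the distance to the circles. *)
pose m := 270000 + 10000 * 100 ^ n + INR N + 4 / eps ^ 2.
pose L := m * m.
have m1 : 270000 <= m by rewrite /m; lra.
have hL : 10000 * (100 ^ n * m) <= L by rewrite /L -Rmult_assoc; apply: Rmult_le_compat_r; rewrite /m; lra.
have em : exp m * exp (- m) = 1 by rewrite -exp_plus -exp_0; f_equal; ring.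
have ep := exp_pos (- m).
have hE : 10000 * L * exp (- m) <= 1.
  by rewrite -em; apply: Rmult_le_compat_r; [lra | exact: exp_beats_square].
have hs : 4 * exp (- m) <= eps ^ 2.
  have e2 : 0 < eps ^ 2 by apply: pow_lt.
  have h4 : 4 / eps ^ 2 <= exp m by have := exp_ineq1_le m; rewrite /m; lra.
  have : 4 / eps ^ 2 * (eps ^ 2 * exp (- m)) <= exp m * (eps ^ 2 * exp (- m)).
    by apply: Rmult_le_compat_r => //; nra.
  have -> : 4 / eps ^ 2 * (eps ^ 2 * exp (- m)) = 4 * exp (- m) by field; lra.
  by rewrite (Rmult_comm (eps ^ 2)) -Rmult_assoc em; lra.
have hL1 : 10000 * m <= L by nra.
have [|||gamma curve] := initial_gate_curve N L m ltac:(lia); try lra.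
  by have := exp_ineq1_le (10 * m); rewrite /m; lra.
have [gamma' [curve' reach]] := gate_curves N L m 1 n gamma ltac:(lra) hL hE ltac:(lia) curve.
have [s0 [t [ht e]]] := reach 0.
have g0 := curve_gate _ _ _ _ _ curve s0; have g1 := curve_gate _ _ _ _ _ curve' 0.
exists (toy_state N (gamma s0)), (toy_state N (gamma' 0)), t.
split; first by apply: toy_state_Sigma; case: g0.
split; first by apply: (gate_near_circle N L m 1); try lra; [lia | exact: g0].
split; first by apply: toy_state_Sigma; case: g1.
split; last by [].
have -> : (N - 2)%N = (1 + n).+2 by rewrite /n; lia.
have hmn : m <= 100 ^ n * m by nra.
apply: (gate_near_circle N L (100 ^ n * m)); try lra; [|lia|exact: g1].
apply: Rle_trans hs; apply: Rmult_le_compat_l; first lra.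
by apply: exp_le_exp; lra.
Qed.
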